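(* Let $N\ge 2$, $\lambda>0$, $p>1$, $q>1$, and let $u\in C^2(\overline{\mathbb{R}^N_+})$ be a solution of problem (A) or of problem (B), both defined in the context. For $\tau>0$ let $u^\tau(x)=\tau^{\frac{2}{p-1}}u(\tau x)$ and set $$E(u,\tau)=\int_{B_1\cap\mathbb{R}^N_+}\left(\frac12|\nabla u^\tau|^2+\frac{\lambda\tau^2}{2}|u^\tau|^2-\frac{1}{p+1}|u^\tau|^{p+1}\right)-\frac{\tau^{1-2\frac{q-1}{p-1}}}{q+1}\int_{\Sigma_1\cap B_1}|u^\tau|^{q+1}+\frac{1}{p-1}\int_{\partial B_1\cap\mathbb{R}^N_+}|u^\tau|^2 .$$ Then, for all $\tau>0$, $$\frac{dE}{d\tau}=\tau\int_{\partial B_1\cap\mathbb{R}^N_+}\left(\frac{du^\tau}{d\tau}\right)^2ds+\lambda\tau\int_{B_1\cap\mathbb{R}^N_+}(u^\tau)^2dx+\frac{2q-p-1}{(p-1)(q+1)}\,\tau^{-2\frac{q-1}{p-1}}\int_{\Sigma_1\cap B_1}|u^\tau|^{q+1}.$$ Furthermore, $E$ is a nondecreasing function of $\tau$ if $2q-p-1\geq 0$.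
   Context: Let $\mathbb{R}^N_+=\{x=(x',x_N): x'\in\mathbb{R}^{N-1},\ x_N>0\}$, $\Sigma_1=\{x\in\mathbb{R}^N: x_N=0,\ x_1>0\}$, $\Sigma_2=\{x\in\mathbb{R}^N: x_N=0,\ x_1<0\}$, and let $\nu$ be the outward unit normal on $\partial\mathbb{R}^N_+$, so $\frac{\partial u}{\partial\nu}=-\frac{\partial u}{\partial x_N}$ there. $B_1$ is the open unit ball centered at the origin. Integrals over subsets of $\Sigma_1$ are with respect to $(N-1)$-dimensional Lebesgue measure, and integrals over $\partial B_1\cap\mathbb{R}^N_+$ are with respect to surface measure $ds$. Solutions are real-valued. Problem (A): $-\Delta u+\lambda u=|u|^{p-1}u$ in $\mathbb{R}^N_+$, $\ \frac{\partial u}{\partial\nu}=|u|^{q-1}u$ on $\Sigma_1$, $\ \frac{\partial u}{\partial\nu}=0$ on $\Sigma_2$. Problem (B): $-\Delta u+\lambda u=|u|^{p-1}u$ in $\mathbb{R}^N_+$, $\ \frac{\partial u}{\partial\nu}=|u|^{q-1}u$ on $\Sigma_1$, $\ u=0$ on $\Sigma_2$. *)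

(* Defs.v *)
From HB Require Import structures.
From mathcomp Require Import all_boot all_order all_algebra.
From mathcomp Require Import all_classical all_reals all_analysis.

Set Implicit Arguments.
Unset Strict Implicit.
Unset Printing Implicit Defensive.
Import Order.TTheory GRing.Theory Num.Theory.
Import numFieldNormedType.Exports.

Local Open Scope classical_set_scope.
Local Open Scope ring_scope.

(* The library has Lebesgue measure only on R. On R^n, as n-tuples with the
   Borel sigma-algebra, it is built here as an iterated product measure. *)
Section lebesgue_cons.
Context {R : realType} {n : nat}.
Variable m : {sigma_finite_measure set (n.-tuple (measurableTypeR R)) -> \bar R}.

Definition tuple_cons (p : measurableTypeR R * n.-tuple (measurableTypeR R)) :
  n.+1.-tuple (measurableTypeR R) := [tuple of p.1 :: p.2].

Lemma measurable_tuple_cons : measurable_fun [set: _] tuple_cons.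
Proof. exact: measurable_cons. Qed.

Definition lebesgue_cons :=
  pushforward (lebesgue_measure \x m)%E tuple_cons.

Let lebesgue_cons0 : lebesgue_cons set0 = 0%E.
Proof. by rewrite /lebesgue_cons /pushforward preimage_set0 measure0. Qed.

Let lebesgue_cons_ge0 A : (0 <= lebesgue_cons A)%E.
Proof. by rewrite /lebesgue_cons /pushforward. Qed.

Let lebesgue_cons_sigma_additive : semi_sigma_additive lebesgue_cons.
Proof.
move=> F mF tF mUF; rewrite /lebesgue_cons.
by apply: measure_semi_sigma_additive => //; exact: measurable_tuple_cons.
Qed.

HB.instance Definition _ := isMeasure.Build _ _ _ lebesgue_cons
  lebesgue_cons0 lebesgue_cons_ge0 lebesgue_cons_sigma_additive.

Lemma lebesgue_cons_sigma_finite : sigma_finite [set: _] lebesgue_cons.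
Proof.
have /sigma_finiteP[F [FT ndF Foo]] :=
  sigma_finiteT (@lebesgue_measure R : {sigma_finite_measure set _ -> \bar R}).
have /sigma_finiteP[G [GT ndG Goo]] := sigma_finiteT m.
pose untuple (t : n.+1.-tuple (measurableTypeR R)) :
    measurableTypeR R * n.-tuple (measurableTypeR R) :=
  (thead t, [tuple of behead t]).
have mu : measurable_fun setT untuple.
  apply/measurable_fun_pairP; split.
    exact: measurable_tnth.
  exact: measurable_behead.
have tK : cancel tuple_cons untuple.
  by move=> [x t]; rewrite /untuple/= theadE; congr pair; apply: val_inj.
exists (fun k => untuple @^-1` (F k `*` G k)).
  rewrite -preimage_bigcup -(preimage_setT untuple); congr (_ @^-1` _).
  rewrite -setXTT FT GT predeqE => -[x y]; split.
    move=> [/= [i _ Fix] [j _ Gjy]]; exists (maxn i j) => //; split.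
    - by move: x Fix; exact/subsetPset/ndF/leq_maxl.
    - by move: y Gjy; exact/subsetPset/ndG/leq_maxr.
  by move=> [i _ []/= ? ?]; split; exists i.
move=> k; have [mF Fk] := Foo k; have [mG Gk] := Goo k; split.
  by rewrite -[X in measurable X]setTI; apply: mu => //; exact: measurableX.
rewrite /lebesgue_cons /pushforward -comp_preimage.
have -> : untuple \o tuple_cons = id by apply/funext => p /=; exact: tK.
by rewrite preimage_id product_measure1E// lte_mul_pinfty// ge0_fin_numE.
Qed.

HB.instance Definition _ := Measure_isSigmaFinite.Build _ _ _ lebesgue_cons
  lebesgue_cons_sigma_finite.

End lebesgue_cons.

Fixpoint lebesgue_tuple (R : realType) (n : nat) :
    {sigma_finite_measure set (n.-tuple (measurableTypeR R)) -> \bar R} :=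
  match n with
  | 0 => \d_ [tuple]
  | n'.+1 => lebesgue_cons (lebesgue_tuple R n')
  end.

(* Points of R^n are row vectors; the norm that mathcomp-analysis puts on them
   is the sup norm, which matters only for the topology. Balls and spheres are
   Euclidean, through [enorm]. *)
Definition tuple_row (R : realType) (n : nat) (t : n.-tuple R) : 'rV[R]_n :=
  \row_i tnth t i.

Definition vol_integral (R : realType) (n : nat) (A : set 'rV[R]_n)
    (f : 'rV[R]_n -> R) : R :=
  \int[lebesgue_tuple R n]_(t in [set t | A (tuple_row t)]) f (tuple_row t).

Definition enorm (R : realType) (n : nat) (x : 'rV[R]_n) : R :=
  Num.sqrt (\sum_i x 0 i ^+ 2).

Definition unit_ball (R : realType) (n : nat) : set 'rV[R]_n :=
  [set x | enorm x < 1].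

Definition unit_sphere (R : realType) (n : nat) : set 'rV[R]_n :=
  [set x | enorm x = 1].

Definition partial (R : realType) (n : nat) (i : 'I_n) (f : 'rV[R]_n -> R)
    (x : 'rV[R]_n) : R :=
  'D_(delta_mx 0 i) f x.

Definition grad_sqr (R : realType) (n : nat) (f : 'rV[R]_n -> R)
    (x : 'rV[R]_n) : R :=
  \sum_i partial i f x ^+ 2.

Definition laplacian (R : realType) (n : nat) (f : 'rV[R]_n -> R)
    (x : 'rV[R]_n) : R :=
  \sum_i partial i (partial i f) x.

Definition extends_continuously (R : realType) (n : nat) (D : set 'rV[R]_n)
    (f : 'rV[R]_n -> R) : Prop :=
  exists g : 'rV[R]_n -> R,
    {within closure D, continuous g} /\ (forall x, D x -> f x = g x).

(* f \in C^2(closure D) for D open: f is continuous on the closure, and its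
   partial derivatives of order 1 and 2 exist in D and extend continuously to
   the closure. *)
Definition C2_closure (R : realType) (n : nat) (D : set 'rV[R]_n)
    (f : 'rV[R]_n -> R) : Prop :=
  [/\ {within closure D, continuous f},
      forall i, (forall x, D x -> derivable f x (delta_mx 0 i)) /\
        extends_continuously D (partial i f) &
      forall i j, (forall x, D x -> derivable (partial i f) x (delta_mx 0 j)) /\
        extends_continuously D (partial j (partial i f))].

(* R^N with N = n.+1: x_1 is the coordinate [ord0] and x_N is [ord_max]. *)
Definition half_space (R : realType) (n : nat) : set 'rV[R]_n.+1 :=
  [set x | 0 < x 0 ord_max].

Definition Sigma1 (R : realType) (n : nat) : set 'rV[R]_n.+1 :=
  [set x | x 0 ord_max = 0 /\ 0 < x 0 ord0].

Definition Sigma2 (R : realType) (n : nat) : set 'rV[R]_n.+1 :=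
  [set x | x 0 ord_max = 0 /\ x 0 ord0 < 0].

(* The point (y, h), with y = x' and h = x_N. *)
Definition row_snoc (R : realType) (n : nat) (y : 'rV[R]_n) (h : R) :
    'rV[R]_n.+1 :=
  \row_i (if unlift ord_max i is Some j then y 0 j else h).

(* Integral over a subset A of {x_N = 0} for (N-1)-dimensional Lebesgue
   measure. *)
Definition flat_integral (R : realType) (n : nat) (A : set 'rV[R]_n.+1)
    (f : 'rV[R]_n.+1 -> R) : R :=
  vol_integral [set y | A (row_snoc y 0)] (fun y => f (row_snoc y 0)).

(* Surface integral over the graph {(y, g y) : y \in D}, with
   ds = sqrt (1 + |grad g|^2) dy. *)
Definition graph_integral (R : realType) (n : nat) (D : set 'rV[R]_n)
    (g : 'rV[R]_n -> R) (f : 'rV[R]_n.+1 -> R) : R :=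
  vol_integral D
    (fun y => f (row_snoc y (g y)) * Num.sqrt (1 + grad_sqr g y)).

Definition hemisphere_height (R : realType) (n : nat) (y : 'rV[R]_n) : R :=
  Num.sqrt (1 - enorm y ^+ 2).

Lemma row_snoc_max (R : realType) (n : nat) (y : 'rV[R]_n) (h : R) :
  row_snoc y h 0 ord_max = h.
Proof. by rewrite mxE unlift_none. Qed.

Lemma row_snoc_lift (R : realType) (n : nat) (y : 'rV[R]_n) (h : R) i :
  row_snoc y h 0 (lift ord_max i) = y 0 i.
Proof. by rewrite mxE liftK. Qed.

Lemma enorm_ge0 (R : realType) (n : nat) (x : 'rV[R]_n) : 0 <= enorm x.
Proof. exact: sqrtr_ge0. Qed.

Lemma enorm_sqr (R : realType) (n : nat) (x : 'rV[R]_n) :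
  enorm x ^+ 2 = \sum_i x 0 i ^+ 2.
Proof. by rewrite sqr_sqrtr// sumr_ge0// => i _; exact: sqr_ge0. Qed.

Lemma enorm_row_snoc (R : realType) (n : nat) (y : 'rV[R]_n) (h : R) :
  enorm (row_snoc y h) ^+ 2 = enorm y ^+ 2 + h ^+ 2.
Proof.
rewrite !enorm_sqr big_ord_recr/= row_snoc_max; congr (_ + _).
apply: eq_bigr => i _; rewrite -[y 0 i](row_snoc_lift y h).
congr (row_snoc _ _ _ _ ^+ 2).
by apply: val_inj; rewrite /= /bump leqNgt ltn_ord.
Qed.

Lemma hemisphere_graphE (R : realType) (n : nat) :
  @unit_sphere R n.+1 `&` @half_space R n =
  [set row_snoc y (hemisphere_height y) | y in @unit_ball R n].
Proof.
apply/seteqP; split => [x [x1 x0]|_ [y y1 <-]]; last first.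
  have hy : 0 < 1 - enorm y ^+ 2.
    by rewrite subr_gt0 expr_lt1// enorm_ge0.
  split; last by rewrite /half_space/= row_snoc_max sqrtr_gt0.
  apply/eqP; rewrite -(@eqrXn2 _ 2)// ?enorm_ge0// expr1n.
  by rewrite enorm_row_snoc [hemisphere_height y ^+ 2]sqr_sqrtr ?(ltW hy)// subrKC.
pose y : 'rV[R]_n := \row_i x 0 (lift ord_max i).
have xE : x = row_snoc y (x 0 ord_max).
  apply/rowP => i; case: (unliftP ord_max i) => [j ->|->].
    by rewrite row_snoc_lift mxE.
  by rewrite row_snoc_max.
have : enorm x ^+ 2 = 1 by rewrite x1 expr1n.
rewrite {1}xE enorm_row_snoc => /(canRL (addrK _)) yE.
have {}x0 : 0 < x 0 ord_max := x0.
exists y.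
  rewrite /unit_ball/= -(@expr_lt1 _ 2)// ?enorm_ge0// yE.
  by rewrite ltrBlDr ltrDl exprn_gt0.
by rewrite [RHS]xE /hemisphere_height yE opprB subrKC sqrtr_sqr gtr0_norm.
Qed.

(* Integral over the part of the unit sphere in the half-space, see
   [hemisphere_graphE]. *)
Definition hemisphere_integral (R : realType) (n : nat)
    (f : 'rV[R]_n.+1 -> R) : R :=
  graph_integral (@unit_ball R n) (@hemisphere_height R n) f.

Definition half_ball (R : realType) (n : nat) : set 'rV[R]_n.+1 :=
  @unit_ball R n.+1 `&` @half_space R n.

Definition spow (R : realType) (r x : R) : R := `|x| `^ (r - 1) * x.

(* [normal_derivative u x l]: the derivative of u at a point x of the boundary
   of the half-space, along the outward normal nu = - e_N, exists and is l. It
   is one-sided because u matters only on the closed half-space. *)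
Definition normal_derivative (R : realType) (n : nat) (u : 'rV[R]_n.+1 -> R)
    (x : 'rV[R]_n.+1) (l : R) : Prop :=
  let nu := - delta_mx 0 ord_max in
  (u x - u (x - h *: nu)) / h @[h --> 0^'+] --> l.

Definition solves_interior (R : realType) (n : nat) (lam p : R)
    (u : 'rV[R]_n.+1 -> R) : Prop :=
  forall x, half_space x -> - laplacian u x + lam * u x = spow p (u x).

Definition problemA (R : realType) (n : nat) (lam p q : R)
    (u : 'rV[R]_n.+1 -> R) : Prop :=
  [/\ solves_interior lam p u,
      forall x, Sigma1 x -> normal_derivative u x (spow q (u x)) &
      forall x, Sigma2 x -> normal_derivative u x 0].

Definition problemB (R : realType) (n : nat) (lam p q : R)
    (u : 'rV[R]_n.+1 -> R) : Prop :=
  [/\ solves_interior lam p u,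
      forall x, Sigma1 x -> normal_derivative u x (spow q (u x)) &
      forall x, Sigma2 x -> u x = 0].

Definition rescale (R : realType) (n : nat) (p : R) (u : 'rV[R]_n -> R)
    (tau : R) (x : 'rV[R]_n) : R :=
  tau `^ (2 / (p - 1)) * u (tau *: x).

Definition energy (R : realType) (n : nat) (lam p q : R)
    (u : 'rV[R]_n.+1 -> R) (tau : R) : R :=
  let v := rescale p u tau in
  vol_integral (@half_ball R n)
    (fun x => 1 / 2 * grad_sqr v x + lam * tau ^+ 2 / 2 * `|v x| ^+ 2
              - 1 / (p + 1) * `|v x| `^ (p + 1))
  - tau `^ (1 - 2 * ((q - 1) / (p - 1))) / (q + 1)
    * flat_integral (@Sigma1 R n `&` @unit_ball R n.+1)
        (fun x => `|v x| `^ (q + 1))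
  + 1 / (p - 1) * hemisphere_integral (fun x => `|v x| ^+ 2).

(* Main.v *)
(** Write v = u^tau and v' = u^tau'. With w = v' - v and M = (v + v') / 2 the
    Dirichlet integrals of v' and v differ by the integral of grad w . grad M,
    which the divergence theorem turns into that of - w Laplace(M) plus boundary
    terms. No derivative of w is left, so after division by tau' - tau dominated
    convergence only needs u^tau to be differentiable in tau with bounded
    quotients; mixed second derivatives of u never appear. The equation, the
    boundary conditions and x . grad v = tau dv/dtau - 2/(p-1) v then give dE/dtau.

    The divergence theorem on the half ball is proved coordinate by coordinate.
    Along e_N it is the fundamental theorem of calculus on vertical segments.
    Along e_i, i < N, Fubini reduces both sides to the half disc of radius c in
    the (x_i, x_N)-plane, where they agree by the substitution
    h = sqrt (c^2 - s^2).

    Replacing x_N by max(x_N, 0) extends u and its derivatives from the closed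
    half-space to continuous functions on the whole space. *)

Require Import Defs.
From HB Require Import structures.
From mathcomp Require Import all_boot all_order all_algebra.
From mathcomp Require Import all_classical all_reals all_analysis.
From mathcomp Require Import measurable_realfun ring lra.
Set Implicit Arguments.
Unset Strict Implicit.
Unset Printing Implicit Defensive.
Import Order.TTheory GRing.Theory Num.Theory.
Import numFieldNormedType.Exports.
Local Open Scope classical_set_scope.
Local Open Scope ring_scope.

(** The mean M replaces v because it makes |grad v'|^2 - |grad v|^2 = 2 grad w . grad M exact: no
    remainder quadratic in grad w has to be shown negligible. After division by tau' - tau, w tends
    to dv/dtau and M to v, so every term produced by the divergence theorem carries the factor
    dv/dtau.

    Problems (A) and (B) differ only on Sigma2, where the flux term is the product of dv/dtau and
    dv/dx_N. In (A) the second factor vanishes; in (B) the first one does, since Sigma2 is a cone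
    and every u^tau is zero on it. One formula therefore covers both problems.

    The surface measure of the hemisphere lives on the unit ball of R^(N-1) with density 1 / height,
    which is unbounded near the equator. Its integrability has to be proved, and it is the reason
    why the integrals are treated as integrals of continuous functions against an integrable
    weight. *)

(** Tonelli for the measure of the sections, a measurable function on T1 * T2. In the induction of
    [lebesgue_tuple_ins] it exchanges the first coordinate with the inserted one. *)
Lemma integral_section_swap d1 d2 d3 (T1 : measurableType d1)
    (T2 : measurableType d2) (T3 : measurableType d3) (R : realType)
    (m1 : {sigma_finite_measure set T1 -> \bar R})
    (m2 : {sigma_finite_measure set T2 -> \bar R})
    (m3 : {sigma_finite_measure set T3 -> \bar R}) (B : set ((T1 * T2) * T3)) :
  measurable B ->
  (\int[m1]_t \int[m2]_s m3 (xsection B (t, s)) =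
   \int[m2]_s \int[m1]_t m3 (xsection B (t, s)))%E.
Proof.
move=> mB; rewrite (fubini_tonelli (m3 \o xsection B))//.
exact: measurable_fun_xsection.
Qed.

(** * Fubini for any coordinate *)

Section insertion.
Context {R : realType}.
Local Notation mR := (measurableTypeR R).

Definition tuple_ins (n : nat) (i : 'I_n.+1) (p : mR * n.-tuple mR) :
    n.+1.-tuple mR :=
  [tuple if unlift i j is Some k then tnth p.2 k else p.1 | j < n.+1].

Lemma measurable_tuple_ins n (i : 'I_n.+1) :
  measurable_fun [set: mR * n.-tuple mR] (tuple_ins i).
Proof.
apply/measurable_fun_tnthP => j.
rewrite (_ : _ \o _ = fun p : mR * n.-tuple mR =>
  if unlift i j is Some k then tnth p.2 k else p.1); last first.
  by apply/funext => p /=; rewrite tnth_mktuple.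
case: (unlift i j) => [k|]; last exact: measurable_fst.
apply: (@measurableT_comp _ _ _ _ _ _ (fun x => tnth x k)) => //.
exact: measurable_tnth.
Qed.

Lemma tuple_ins0 n (p : mR * n.-tuple mR) :
  tuple_ins ord0 p = tuple_cons p.
Proof.
apply: eq_from_tnth => j; rewrite tnth_mktuple.
case: (unliftP ord0 j) => [k ->|->]; last by rewrite [RHS]tnth0.
by rewrite [RHS]tnthS.
Qed.

Lemma tuple_ins_lift n (i : 'I_n.+1) s t (r : n.-tuple mR) :
  tuple_ins (lift ord0 i) (s, tuple_cons (t, r)) =
  tuple_cons (t, tuple_ins i (s, r)).
Proof.
apply: eq_from_tnth => j; rewrite tnth_mktuple /=.
case: (unliftP ord0 j) => [k ->|->]; last first.
  rewrite [RHS]tnth0; case: unliftP => [l|/(congr1 val)//].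
    case: (unliftP ord0 l) => [m ->|-> _]; last by rewrite tnth0.
    by move/(congr1 val); rewrite /= /bump /= !add1n addnS.
rewrite [RHS]tnthS tnth_mktuple.
case: (unliftP i k) => [l ->|->]; last by rewrite unlift_none.
have -> : lift ord0 (lift i l) = lift (lift ord0 i) (lift ord0 l).
  by apply: val_inj; rewrite /= /bump /= !add1n ltnS addnS.
by rewrite liftK tnthS.
Qed.

Local Notation leb := (@lebesgue_measure R).
Local Notation L n := (lebesgue_tuple R n).

(* The definition of [lebesgue_tuple] singles out the first coordinate; by
   Tonelli any coordinate can play its role. *)
Lemma lebesgue_tuple_ins n (i : 'I_n.+1) (A : set (n.+1.-tuple mR)) :
  measurable A -> L n.+1 A = (leb \x L n)%E (tuple_ins i @^-1` A).
Proof.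
elim: n i A => [|n IH] i A mA.
  by rewrite (ord1 i) (_ : tuple_ins _ = @tuple_cons R 0)//; apply/funext => p; exact: tuple_ins0.
case: (unliftP ord0 i) => [{}i ->|->]; last first.
  by rewrite (_ : tuple_ins _ = @tuple_cons R n.+1)//; apply/funext => p; exact: tuple_ins0.
(* [B] is [A] with the first coordinate and the inserted one split off. Peeling the first coordinate
   and using the induction hypothesis on the tail integrates them in one order; the right-hand side
   has the other order. *)
pose B : set ((mR * mR) * n.-tuple mR) :=
  [set p | A (tuple_cons (p.1.1, tuple_ins i (p.1.2, p.2)))].
have mB : measurable B.
  have mg : measurable_fun setT (fun p : (mR * mR) * n.-tuple mR =>
      tuple_cons (p.1.1, tuple_ins i (p.1.2, p.2))).
    apply: (measurableT_comp measurable_tuple_cons).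
    apply/measurable_fun_pairP; split => /=.
      exact: (measurableT_comp (measurable_fst : measurable_fun setT (fst : mR * mR -> mR)) (measurable_fst : measurable_fun setT (fst : (mR * mR) * n.-tuple mR -> _))). 
    apply: (measurableT_comp (measurable_tuple_ins i)).
    apply/measurable_fun_pairP; split => /=; last exact: measurable_snd.
    by apply: (measurableT_comp measurable_snd); exact: measurable_fst.
  by have := mg measurableT _ mA; rewrite setTI.
transitivity (\int[leb]_t \int[leb]_s L n (xsection B (t, s)))%E.
  rewrite /= /lebesgue_cons /pushforward /product_measure1 /=.
  apply: eq_integral => t _ /=.
  rewrite [LHS](IH i); last first.
    rewrite [X in measurable X](_ : _ = [set w | A (tuple_cons (t, w))]); last first.
      by apply/seteqP; split => w; rewrite /= /xsection /= inE.
    have mg := measurableT_comp measurable_tuple_cons (measurable_pair1 t).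
    by have := mg _ measurableT _ mA; rewrite setTI.
  rewrite /product_measure1 /=; apply: eq_integral => s _ /=; congr (L n _).
  by apply/seteqP; split => r; rewrite /xsection /= ?inE /= ?inE.
transitivity (\int[leb]_s \int[leb]_t L n (xsection B (t, s)))%E.
  exact: integral_section_swap.
rewrite [RHS]/product_measure1 /=; apply: eq_integral => s _ /=.
rewrite /lebesgue_cons /pushforward /product_measure1 /=.
apply: eq_integral => t _ /=; congr (L n _).
by apply/seteqP; split => r; rewrite /xsection /= ?inE /= ?inE /B /= tuple_ins_lift.
Qed.

End insertion.

(** * Integrals of functions of a row vector *)

Section row_integral.
Context {R : realType}.
Local Notation mR := (measurableTypeR R).
Local Notation leb := (@lebesgue_measure R).
Local Notation L n := (lebesgue_tuple R n).

Definition ins n (i : 'I_n.+1) (s : R) (y : 'rV[R]_n) : 'rV[R]_n.+1 :=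
  \row_j (if unlift i j is Some k then y 0 k else s).

Definition rint n (f : 'rV[R]_n -> R) : R :=
  \int[L n]_t f (tuple_row t).

Definition rmeasurable n (f : 'rV[R]_n -> R) : Prop :=
  measurable_fun [set: n.-tuple mR] (fun t : n.-tuple mR => f (tuple_row t)).

Definition rintegrable n (f : 'rV[R]_n -> R) : Prop :=
  (L n).-integrable setT (fun t : n.-tuple mR => (f (tuple_row t))%:E).

Lemma tuple_row_ins n (i : 'I_n.+1) s (t : n.-tuple mR) :
  tuple_row (tuple_ins i (s, t)) = ins i s (tuple_row t).
Proof.
apply/rowP => j; rewrite !mxE tnth_mktuple; case: (unlift i j) => [k|//].
by rewrite !mxE.
Qed.

Lemma vol_integralE n (A : set 'rV[R]_n) f : vol_integral A f = rint (f \_ A).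
Proof.
rewrite /vol_integral Rintegral_mkcond /rint; apply: eq_Rintegral => t _.
by rewrite !patchE; congr (if _ then _ else _); apply/idP/idP; rewrite !inE.
Qed.

Lemma eq_rint n (f g : 'rV[R]_n -> R) : f =1 g -> rint f = rint g.
Proof. by move=> fg; apply: eq_Rintegral => t _; rewrite fg. Qed.

Lemma rintD n (f g : 'rV[R]_n -> R) : rintegrable f -> rintegrable g ->
  rint (fun x => f x + g x) = rint f + rint g.
Proof. by move=> fi gi; exact: RintegralD. Qed.

Lemma rintB n (f g : 'rV[R]_n -> R) : rintegrable f -> rintegrable g ->
  rint (fun x => f x - g x) = rint f - rint g.
Proof. by move=> fi gi; exact: RintegralB. Qed.

Lemma rintZ n (k : R) (f : 'rV[R]_n -> R) : rintegrable f ->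
  rint (fun x => k * f x) = k * rint f.
Proof. by move=> fi; exact: RintegralZl. Qed.

Lemma rintegrable_measurable n (f : 'rV[R]_n -> R) :
  rintegrable f -> rmeasurable f.
Proof. by move=> /integrableP[/measurable_EFinP]. Qed.

Lemma rintegrableD n (f g : 'rV[R]_n -> R) : rintegrable f -> rintegrable g ->
  rintegrable (fun x => f x + g x).
Proof.
move=> fi gi; rewrite /rintegrable.
by under eq_fun do rewrite EFinD; exact: integrableD.
Qed.

Lemma rintegrableZ n (k : R) (f : 'rV[R]_n -> R) : rintegrable f ->
  rintegrable (fun x => k * f x).
Proof.
move=> fi; rewrite /rintegrable.
by under eq_fun do rewrite EFinM; exact: integrableZl.
Qed.

Lemma rint_sum n m (f : 'I_m -> 'rV[R]_n -> R) :
  (forall i, rintegrable (f i)) ->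
  rintegrable (fun x => \sum_i f i x) /\
  rint (fun x => \sum_i f i x) = \sum_i rint (f i).
Proof.
elim: m f => [|m IH] f fi.
  have e : (fun x => \sum_(i < 0) f i x) = cst 0 by apply/funext => x; rewrite big_ord0.
  rewrite e big_ord0; split; first exact: integrable0.
  by rewrite /rint Rintegral_cst// mul0r.
have [h1 h2] := IH (fun i => f (lift ord0 i)) (fun i => fi _).
have e : (fun x => \sum_i f i x) = fun x => f ord0 x + \sum_(i < m) f (lift ord0 i) x.
  by apply/funext => x; rewrite big_ord_recl.
rewrite e; split; first exact: rintegrableD.
by rewrite rintD// h2 big_ord_recl.
Qed.

Lemma le_rintegrable n (f g : 'rV[R]_n -> R) : rmeasurable f ->
  (forall x, `|f x| <= `|g x|) -> rintegrable g -> rintegrable f.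
Proof.
move=> mf fg; apply: le_integrable => //; first exact/measurable_EFinP.
by move=> t _ /=; rewrite lee_fin.
Qed.

Lemma ge0_rint_ins n (i : 'I_n.+1) (f : 'rV[R]_n.+1 -> \bar R) :
  measurable_fun [set: n.+1.-tuple mR] (fun t : n.+1.-tuple mR => f (tuple_row t)) ->
  (forall x, 0 <= f x)%E ->
  (\int[L n.+1]_t f (tuple_row t) =
   \int[L n]_t \int[leb]_s f (ins i s (tuple_row t)))%E.
Proof.
move=> mf f0.
have mphi : measurable_fun [set: mR * n.-tuple mR] (tuple_ins i).
  exact: measurable_tuple_ins.
rewrite (eq_measure_integral (pushforward (leb \x L n)%E (tuple_ins i))); last first.
  by move=> A mA _; exact: lebesgue_tuple_ins.
rewrite ge0_integral_pushforward// preimage_setT.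
rewrite fubini_tonelli2; last 2 first.
- exact: (measurableT_comp mf mphi).
- by move=> x; exact: f0.
by apply: eq_integral => t _; apply: eq_integral => s _ /=; rewrite tuple_row_ins.
Qed.

Lemma ge0_measurable_rint_ins n (i : 'I_n.+1) (f : 'rV[R]_n.+1 -> \bar R) :
  measurable_fun [set: n.+1.-tuple mR] (fun t : n.+1.-tuple mR => f (tuple_row t)) ->
  (forall x, 0 <= f x)%E ->
  measurable_fun [set: n.-tuple mR]
    (fun t : n.-tuple mR => \int[leb]_s f (ins i s (tuple_row t)))%E.
Proof.
move=> mf f0.
have mphi : measurable_fun [set: mR * n.-tuple mR] (tuple_ins i).
  exact: measurable_tuple_ins.
have := measurable_fun_fubini_tonelli_G (m1 := leb) _ (measurableT_comp mf mphi).
move=> /(_ (fun x => f0 _)).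
rewrite (_ : fubini_G _ _ =
  (fun t : n.-tuple mR => \int[leb]_s f (ins i s (tuple_row t)))%E)//.
by apply/funext => t; apply: eq_integral => s _ /=; rewrite tuple_row_ins.
Qed.

Lemma rint_ins n (i : 'I_n.+1) (f : 'rV[R]_n.+1 -> R) : rintegrable f ->
  rint f = rint (fun y => \int[leb]_s f (ins i s y)).
Proof.
move=> fi; have mf := rintegrable_measurable fi.
have mphi : measurable_fun [set: mR * n.-tuple mR] (tuple_ins i).
  exact: measurable_tuple_ins.
have mF : measurable_fun setT (fun t : n.+1.-tuple mR => (f (tuple_row t))%:E).
  exact/measurable_EFinP.
have Fi : (leb \x L n)%E.-integrable setT
    ((fun t => (f (tuple_row t))%:E) \o tuple_ins i).
  apply/integrableP; split; first exact: (measurableT_comp mF mphi).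
  rewrite -[X in (X < _)%E](_ : (\int[L n.+1]_t `|(f (tuple_row t))%:E|)%E = _).
    by move/integrableP : fi => [].
  rewrite (eq_measure_integral (pushforward (leb \x L n)%E (tuple_ins i))); last first.
    by move=> A mA _; exact: lebesgue_tuple_ins.
  rewrite ge0_integral_pushforward//.
  exact: measurableT_comp.
rewrite /rint /Rintegral; congr fine.
rewrite (eq_measure_integral (pushforward (leb \x L n)%E (tuple_ins i))); last first.
  by move=> A mA _; exact: lebesgue_tuple_ins.
rewrite integral_pushforward// preimage_setT -integral21_prod_meas1//.
(* The inner integral is finite only for almost every t, and [Rintegral] turns an infinite one into
   0, so the two functions of t agree only almost everywhere. *)
have aef := ae_integrable2 Fi.
have mG : measurable_fun setT (fubini_G leb ((fun t : n.+1.-tuple mR => (f (tuple_row t))%:E) \o tuple_ins i)).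
  exact: (measurable_fubini_G Fi).
have GE t : leb.-integrable setT
    (fun s => ((fun t : n.+1.-tuple mR => (f (tuple_row t))%:E) \o tuple_ins i) (s, t)) ->
  fubini_G leb ((fun t : n.+1.-tuple mR => (f (tuple_row t))%:E) \o tuple_ins i) t =
  (\int[leb]_s f (ins i s (tuple_row t)))%:E.
  move=> /integrable_fin_num h; rewrite /Rintegral fineK.
    by apply: eq_integral => s _ /=; rewrite tuple_row_ins.
  under eq_integral do rewrite -tuple_row_ins.
  exact: h.
apply: ae_eq_integral => //.
  apply/measurable_EFinP.
  rewrite [X in measurable_fun _ X](_ : _ = fine \o fubini_G leb
    ((fun t : n.+1.-tuple mR => (f (tuple_row t))%:E) \o tuple_ins i)).
    exact: measurableT_comp.
  apply/funext => t /=; congr fine; apply: eq_integral => s _ /=.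
  by rewrite tuple_row_ins.
by apply: filterS aef => t /= /GE h _.
Qed.

End row_integral.

(** * Continuous and measurable functions of row vectors *)

Section row_topology.
Context {R : realType}.
Local Notation mR := (measurableTypeR R).

Lemma cvg_sumr (T : Type) (F : set_system T) m (f : 'I_m -> T -> R) (l : 'I_m -> R) :
  Filter F -> (forall i, f i x @[x --> F] --> l i) ->
  \sum_i f i x @[x --> F] --> \sum_i l i.
Proof. move=> FF h; apply: cvg_big => [|i _]; [exact: add_continuous|exact: h]. Qed.

Lemma cvg_row (T : Type) (F : set_system T) n (f : T -> 'rV[R]_n) (l : 'rV[R]_n) :
  Filter F -> (forall i, f x 0 i @[x --> F] --> l 0 i) -> f x @[x --> F] --> l.
Proof.
move=> FF h; apply/cvgrPdist_lt => e e0; near=> x.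
rewrite -[X in X < _]/(mx_norm _) mx_normrE; apply/bigmax_ltP => /=.
split=> // -[i j] _ /=; rewrite (ord1 i) !mxE.
move: j; near: x; apply: filter_forall => j.
exact: (cvgrPdist_lt _ _).1 (h j) _ e0.
Unshelve. all: by end_near. Qed.

Lemma continuous_row (T : topologicalType) n (f : T -> 'rV[R]_n) :
  (forall i, continuous (fun x => f x 0 i)) -> continuous f.
Proof. by move=> h x; apply: cvg_row => i; exact: h. Qed.

(** Bridges the sup-norm topology and the sigma-algebra of tuples: an open set is the union of the
    countably many boxes with rational centre and radius 1/(k+1) that it contains, and a box is a
    finite intersection of coordinate preimages. *)
Lemma open_rmeasurable n (O : set 'rV[R]_n) : open O ->
  measurable [set t : n.-tuple mR | O (tuple_row t)].
Proof.
move=> oO.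
pose box (qk : 'rV[rat]_n * nat) : set (n.-tuple mR) :=
  \bigcap_(i in [set: 'I_n]) [set t | `|tnth t i - ratr (qk.1 0 i)| < qk.2.+1%:R^-1].
pose D : set ('rV[rat]_n * nat) := [set qk : 'rV[rat]_n * nat |
  forall y : 'rV[R]_n, (forall i, `|y 0 i - ratr (qk.1 0 i)| < qk.2.+1%:R^-1) -> O y].
rewrite (_ : mkset _ = \bigcup_qk (if `[< D qk >] then box qk else set0)).
  apply: countable_bigcupT_measurable; first exact: countableP.
  move=> [q k]; case: ifP => // _.
  apply: fin_bigcap_measurable => //= i _.
  rewrite [X in measurable X](_ : _ =
    (fun t : n.-tuple mR => tnth t i) @^-1` (ball (ratr (q 0 i) : R) k.+1%:R^-1)); last first.
    by apply/seteqP; split => t; rewrite /ball /= /ball_ /= distrC.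
  have := measurable_tnth i measurableT (_ : measurable (ball (ratr (q 0 i) : R) k.+1%:R^-1)).
  by rewrite setTI; apply; apply: open_measurable; exact: ball_open.
apply/seteqP; split => [t Ot|t [[q k] _]]; last first.
  case: asboolP => // Dqk Bt; apply: Dqk => i /=.
  by rewrite mxE; exact: Bt.
have /nbhs_ballP[e /= e0 eO] : nbhs (tuple_row t) O by exact: open_nbhs_nbhs.
(* The factor 2 comes from the triangle inequality through the rational centre: both the given point
   and any point of the box are within 1/(k+1) of it. *)
have [k ke] : exists k, 2 * k.+1%:R^-1 < e :> R.
  exists (Num.trunc (2 / e)).
  rewrite ltr_pdivrMr ?ltr0n// mulrC -ltr_pdivrMr//.
  by rewrite truncnS_gt// divr_ge0// ltW.
have k0 : 0 < k.+1%:R^-1 :> R by rewrite invr_gt0 ltr0n.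
have hq i : exists q : rat, `|tnth t i - ratr q| < k.+1%:R^-1.
  move: (tnth t i : R) (k.+1%:R^-1 : R) k0 => a d d0.
  have [|q] := @rat_in_itvoo R (a - d) (a + d); first lra.
  by rewrite in_itv /= => /andP[q1 q2]; exists q; rewrite ltr_norml; apply/andP; lra.
have [q qP] := choice hq.
exists (\row_i q i, k) => //; case: asboolP => [_|].
  by move=> i _ /=; rewrite mxE.
case=> y /= yq; apply: eO; rewrite mx_norm_ball /ball_ /=.
rewrite -[X in X < _]/(mx_norm _) mx_normrE; apply/bigmax_ltP => /=.
split=> // -[a j] _ /=; rewrite (ord1 a) !mxE.
have := qP j; have := yq j; rewrite mxE; move: (tnth t j : R) (k.+1%:R^-1 : R) ke => a' d ke.
by rewrite !ltr_norml => /andP[? ?] /andP[? ?]; apply/andP; lra.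
Qed.

Lemma continuous_rmeasurable n (f : 'rV[R]_n -> R) : continuous f -> rmeasurable f.
Proof.
move=> /continuousP cf; apply: (measurability _ (RGenOpens.measurableE R)).
move=> _ [_ [a [b ->] <-]]; rewrite setTI.
rewrite [X in measurable X](_ : _ = [set t | (f @^-1` `]a, b[%classic) (tuple_row t)])//.
by apply: open_rmeasurable; apply: cf; exact: interval_open.
Qed.

Lemma rmeasurable_patch n (A : set 'rV[R]_n) (f : 'rV[R]_n -> R) :
  measurable [set t : n.-tuple mR | A (tuple_row t)] ->
  rmeasurable f -> rmeasurable (f \_ A).
Proof.
move=> mA mf; rewrite /rmeasurable.
have := (measurable_restrictT (fun t : n.-tuple mR => f (tuple_row t)) mA).1.
rewrite (_ : _ \_ _ = fun t : n.-tuple mR => (f \_ A) (tuple_row t)); last first.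
  apply/funext => t; rewrite !patchE; congr (if _ then _ else _).
by apply; exact: measurable_funTS.
Qed.

Lemma continuous_enorm n : continuous (@enorm R n).
Proof.
move=> x; apply: (@continuous_comp _ _ _ (fun y : 'rV[R]_n => \sum_i y 0 i ^+ 2) Num.sqrt).
  apply: (@cvg_sumr _ (nbhs x)) => i; apply: (@cvgM _ _ _ _ (fun y : 'rV[R]_n => y 0 i) (fun y : 'rV[R]_n => y 0 i)); exact: coord_continuous.
exact: sqrt_continuous.
Qed.

Lemma open_unit_ball n : open (@unit_ball R n).
Proof.
have : open ((@enorm R n) @^-1` [set x | x < 1]).
  by apply: open_comp => [x _|]; [exact: continuous_enorm|exact: open_lt].
by [].
Qed.

Lemma open_half_space n : open (@half_space R n).
Proof.
have : open ((fun x : 'rV[R]_n.+1 => x 0 ord_max) @^-1` [set x | 0 < x]).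
  by apply: open_comp => [x _|]; [exact: coord_continuous|exact: open_gt].
by [].
Qed.

Lemma open_half_ball n : open (@half_ball R n).
Proof. by apply: openI; [exact: open_unit_ball|exact: open_half_space]. Qed.

Lemma continuous_ins n i (T : topologicalType) (s : T -> R) (y : T -> 'rV[R]_n) :
  continuous s -> continuous y -> continuous (fun t => ins i (s t) (y t)).
Proof.
move=> cs cy; apply: continuous_row => j; under eq_fun do rewrite mxE.
case: (unlift i j) => [k|//] t.
exact: (continuous_comp (cy t) (@coord_continuous _ _ _ _ _ _)).
Qed.

Lemma coord_le_enorm n (x : 'rV[R]_n) i : `|x 0 i| <= enorm x.
Proof.
rewrite -sqrtr_sqr ler_sqrt; last by rewrite sumr_ge0// => j _; exact: sqr_ge0.
by rewrite (bigD1 i)//= lerDl sumr_ge0// => j _; exact: sqr_ge0.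
Qed.

End row_topology.

(** * Improper integrals on the line and the half disc *)

Section line_integrals.
Context {R : realType}.
Local Notation leb := (@lebesgue_measure R).

Lemma itv_oo_measurable_fun (f : R -> R) (a b : R) :
  (forall x, a < x < b -> {for x, continuous f}) -> measurable_fun `]a, b[ f.
Proof.
move=> cf; apply: open_continuous_measurable_fun; first exact: interval_open.
by move=> x; rewrite inE /= in_itv => /cf.
Qed.

(** The integrand may blow up at both ends. The closed-interval theorem is applied on an increasing
    sequence of segments, and monotone convergence gives integrability together with the value. *)
Lemma ge0_FTC_oo (f F : R -> R) (a b : R) : a < b ->
  (forall x, a <= x <= b -> {for x, continuous F}) ->
  (forall x, a < x < b -> is_derive x 1 F (f x)) ->
  (forall x, a < x < b -> {for x, continuous f}) ->
  (forall x, a < x < b -> 0 <= f x) ->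
  leb.-integrable `]a, b[ (EFin \o f) /\
  \int[leb]_(x in `]a, b[) f x = F b - F a.
Proof.
move=> ab cF dF cf f0.
(* Starting the denominators at 3 keeps [d k] at most a third of the length, so that every segment
   [a + d k, b - d k] is nondegenerate. *)
pose d k : R := (b - a) / k.+3%:R.
have d0 k : 0 < d k.
  by rewrite divr_gt0 ?subr_gt0// ltr0n.
have dle k m : (k <= m)%N -> d m <= d k.
  by move=> km; rewrite ler_pM2l ?subr_gt0// lef_pV2 ?posrE ?ltr0n// ler_nat.
have d3 k : d k <= (b - a) / 3.
  exact: (dle 0%N).
have dcvg : d k @[k --> \oo] --> 0.
  rewrite -(mulr0 (b - a)); apply: cvgMr.
  have := @cvg_harmonic R; rewrite -(cvg_shiftn 2).
  rewrite (_ : (fun k => _) = (fun k : nat => k.+3%:R^-1))//.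
  by apply/funext => k; rewrite /harmonic addn2.
pose D k : set R := `[a + d k, b - d k]%classic.
have mf : measurable_fun `]a, b[ (EFin \o f).
  by apply/measurable_EFinP; apply: itv_oo_measurable_fun.
have DE : \bigcup_k D k = `]a, b[%classic.
  apply/seteqP; split => x.
    move=> [k _]; rewrite /D /= !in_itv /= => /andP[h1 h2]; have := d0 k => h3.
    by apply/andP; lra.
  rewrite /= in_itv /= => /andP[ax xb].
  have e0 : 0 < Num.min (x - a) (b - x) by rewrite lt_min !subr_gt0 ax.
  have [k _ /(_ k (leqnn _))] := (cvgrPdist_lt _ _).1 dcvg _ e0.
  rewrite sub0r normrN gtr0_norm// lt_min => /andP[h1 h2]; exists k => //.
  by rewrite /D /= in_itv /=; apply/andP; lra.
have mD k : measurable (D k) by exact: measurable_itv.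
have ndD : nondecreasing_seq D.
  move=> k m km; apply/subsetPset => x; rewrite /D /= !in_itv /= => /andP[h1 h2].
  by have := dle _ _ km => h3; apply/andP; lra.
have ID k : (\int[leb]_(x in D k) (EFin \o f) x = (F (b - d k) - F (a + d k))%:E)%E.
  have d0k := d0 k; have d3k := d3 k.
  have sub x : x \in `[a + d k, b - d k] -> a < x < b.
    by rewrite in_itv /= => /andP[? ?]; apply/andP; lra.
  rewrite EFinB; apply: continuous_FTC2.
  - lra.
  - apply: continuous_in_subspaceT => x; rewrite inE /= => /sub; exact: cf.
  - split.
    + move=> x /subset_itv_oo_cc /sub /dF dx; exact: ex_derive.
    + by apply: cvg_at_right_filter; apply: cF; apply/andP; lra.
    + by apply: cvg_at_left_filter; apply: cF; apply/andP; lra.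
  - move=> x /subset_itv_oo_cc /sub /dF dx; rewrite derive1E; exact: derive_val.
have fpos x : (\bigcup_k D k) x -> (0 <= (EFin \o f) x)%E.
  by rewrite DE /= in_itv /= lee_fin => /f0.
have mfD : measurable_fun (\bigcup_k D k) (EFin \o f) by rewrite DE.
have h : (\int[leb]_(x in D i) (EFin \o f) x)%E @[i --> \oo] -->
    (\int[leb]_(x in `]a, b[) (EFin \o f) x)%E.
  rewrite -DE; apply: ge0_nondecreasing_set_cvg_integral => //.
    move=> k; apply: measurable_funS mfD; first exact: bigcupT_measurable.
    exact: bigcup_sup.
  by move=> k x Dx; apply: fpos; exists k.
have IE : (\int[leb]_(x in `]a, b[) (EFin \o f) x = (F b - F a)%:E)%E.
  rewrite -(cvg_lim (@ereal_hausdorff R) h); apply: cvg_lim => //.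
  under eq_cvg do rewrite ID.
  apply: cvg_EFin; first exact: nearW.
  apply: cvgB.
    apply: continuous_cvg; first by apply: cF; rewrite lexx ltW.
    by rewrite -[X in _ --> X]subr0; apply: cvgB => //; exact: cvg_cst.
  apply: continuous_cvg; first by apply: cF; rewrite lexx ltW.
  by rewrite -[X in _ --> X]addr0; apply: cvgD => //; exact: cvg_cst.
split; last by rewrite /Rintegral IE.
apply/integrableP; split; first exact: mf.
suff -> : (\int[leb]_(x in `]a, b[) `|(EFin \o f) x| =
    \int[leb]_(x in `]a, b[) (EFin \o f) x)%E by rewrite IE ltry.
apply: eq_integral => x; rewrite inE /= in_itv /= => /f0 fx0.
by rewrite ger0_norm.
Qed.

(** For a signed integrand: f is the difference of f + C g and C g, both nonnegative, and each has a
    continuous antiderivative built from F and G. *)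
Lemma FTC_oo (f F g G : R -> R) (a b C : R) : a < b ->
  (forall x, a <= x <= b -> {for x, continuous F}) ->
  (forall x, a < x < b -> is_derive x 1 F (f x)) ->
  (forall x, a < x < b -> {for x, continuous f}) ->
  (forall x, a <= x <= b -> {for x, continuous G}) ->
  (forall x, a < x < b -> is_derive x 1 G (g x)) ->
  (forall x, a < x < b -> {for x, continuous g}) ->
  (forall x, a < x < b -> `|f x| <= C * g x) ->
  leb.-integrable `]a, b[ (EFin \o f) /\
  \int[leb]_(x in `]a, b[) f x = F b - F a.
Proof.
move=> ab cF dF cf cG dG cg fg.
have Cg0 x : a < x < b -> 0 <= C * g x.
  by move=> /fg; apply: le_trans.
have [i1 e1] : leb.-integrable `]a, b[ (EFin \o (fun x => C * g x)) /\
    \int[leb]_(x in `]a, b[) (C * g x) = C * G b - C * G a.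
  apply: (@ge0_FTC_oo _ (fun x => C * G x)) => // x xab.
  - by apply: cvgMr; exact: cG.
  - by have := dG _ xab => ?; apply: is_deriveZ.
  - by apply: cvgMr; exact: cg.
have [i2 e2] : leb.-integrable `]a, b[ (EFin \o (fun x => f x + C * g x)) /\
    \int[leb]_(x in `]a, b[) (f x + C * g x) =
    (F b + C * G b) - (F a + C * G a).
  apply: (@ge0_FTC_oo _ (fun x => F x + C * G x)) => // x xab.
  - by apply: cvgD; [exact: cF|apply: cvgMr; exact: cG].
  - have := dG _ xab => ?; have := dF _ xab => ?.
    by apply: is_deriveD; apply: is_deriveZ.
  - by apply: cvgD; [exact: cf|apply: cvgMr; exact: cg].
  - by have := fg _ xab; rewrite ler_norml => /andP[+ _]; rewrite -subr_ge0 opprK.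
have e : f = (fun x => (f x + C * g x) - C * g x) by apply/funext => x; rewrite addrK.
have i3 : leb.-integrable `]a, b[ (EFin \o f).
  rewrite e; under [X in _.-integrable _ X]eq_fun do rewrite /= EFinB.
  exact: integrableB.
split => //; rewrite e RintegralB// e1 e2; ring.
Qed.

End line_integrals.

Section half_disc.
Context {R : realType}.
Local Notation leb := (@lebesgue_measure R).

Lemma antiderivative (f : R -> R) (a b : R) : continuous f ->
  exists F : R -> R, forall x, a <= x <= b -> is_derive x 1 F (f x).
Proof.
(* The margins of 1 on both sides make a and b interior points, where the derivative is
   two-sided. *)
move=> cf; exists (fun x => \int[leb]_(t in `[a - 1, x]) f t) => x /andP[ax xb].
have h : leb.-integrable `[a - 1, b + 1] (EFin \o f).
  apply: continuous_compact_integrable; first exact: segment_compact.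
  exact: continuous_subspaceT.
have [||dF eF] := @continuous_FTC1_closed R f (a - 1) x (b + 1) _ h _ (cf x); [lra|lra|].
by rewrite -eF derive1E; exact: derivableP.
Qed.

Lemma is_derive1_continuous (F : R -> R) (x f : R) :
  is_derive x 1 F f -> {for x, continuous F}.
Proof.
by move=> [dF _]; apply: differentiable_continuous; exact/derivable1_diffP.
Qed.

Lemma continuous_itv_bounded (f : R -> R) (a b : R) :
  (forall x, a <= x <= b -> {for x, continuous f}) ->
  exists C, 0 <= C /\ forall x, a <= x <= b -> `|f x| <= C.
Proof.
move=> cf; have [ab|ab] := leP a b; last first.
  by exists 0; split => // x /andP[ax xb]; have := le_trans ax xb; rewrite leNgt ab.
have [|c _ hc] := @EVT_max R (fun x => `|f x|) a b ab.
  apply: continuous_in_subspaceT => x; rewrite inE /= in_itv /= => xab.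
  by apply: cvg_norm; exact: cf.
exists `|f c|; split => // x xab; by apply: hc; rewrite in_itv.
Qed.

Lemma FTC_oo_bounded (f F : R -> R) (a b : R) : a < b ->
  (forall x, a <= x <= b -> {for x, continuous f}) ->
  (forall x, a <= x <= b -> {for x, continuous F}) ->
  (forall x, a < x < b -> is_derive x 1 F (f x)) ->
  leb.-integrable `]a, b[ (EFin \o f) /\
  \int[leb]_(x in `]a, b[) f x = F b - F a.
Proof.
move=> ab cf cF dF; have [C [C0 hC]] := continuous_itv_bounded cf.
have W x : a < x < b -> a <= x <= b by move=> /andP[h1 h2]; rewrite !ltW.
apply: (@FTC_oo _ f F (cst 1) id _ _ C) => // x xab.
- exact/cf/W.
- exact: cvg_id.
- exact: cst_continuous.
- by rewrite mulr1; exact/hC/W.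
Qed.

(** Half the chord of the circle of radius |c| at distance |s| from its centre; it is 0 beyond the
    circle, where the root is taken of a negative number. *)
Definition sig (c s : R) : R := Num.sqrt (c ^+ 2 - s ^+ 2).

Lemma continuous_sig (c : R) : continuous (sig c).
Proof.
have -> : sig c = Num.sqrt \o (fun s => c ^+ 2 - s ^+ 2) by [].
move=> x; apply: continuous_comp.
  by apply: cvgB; [exact: cvg_cst|exact: exprn_continuous].
exact: sqrt_continuous.
Qed.

Lemma sigN (c s : R) : sig c (- s) = sig c s.
Proof. by rewrite /sig sqrrN. Qed.

Lemma sig_gt0 (c s : R) : - c < s < c -> 0 < sig c s.
Proof.
by move=> /andP[h1 h2]; rewrite sqrtr_gt0 subr_sqr mulr_gt0//; lra.
Qed.

Lemma sig_ge0 (c s : R) : 0 <= sig c s.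
Proof. exact: sqrtr_ge0. Qed.

Lemma sqr_sig (c s : R) : - c <= s <= c -> sig c s ^+ 2 = c ^+ 2 - s ^+ 2.
Proof.
by move=> /andP[h1 h2]; rewrite sqr_sqrtr// subr_sqr mulr_ge0//; lra.
Qed.

Lemma sig_le (c s : R) : 0 <= c -> sig c s <= c.
Proof.
move=> c0; rewrite -[leRHS](ger0_norm c0) -sqrtr_sqr ler_sqrt ?sqr_ge0//.
by rewrite gerBl sqr_ge0.
Qed.

Lemma sigK (c s : R) : 0 <= s <= c -> sig c (sig c s) = s.
Proof.
move=> /andP[s0 sc]; rewrite /sig sqr_sig; last by apply/andP; lra.
by rewrite opprB addrC subrK sqrtr_sqr ger0_norm.
Qed.

Lemma sig0 (c : R) : 0 <= c -> sig c 0 = c.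
Proof. by move=> c0; rewrite /sig expr0n subr0 sqrtr_sqr ger0_norm. Qed.

Lemma sigc (c : R) : sig c c = 0.
Proof. by rewrite /sig subrr sqrtr0. Qed.

Lemma is_derive_sig (c s : R) : - c < s < c -> is_derive s 1 (sig c) (- (s / sig c s)).
Proof.
move=> /andP[h1 h2].
have g0 : 0 < c ^+ 2 - s ^+ 2 by rewrite subr_sqr mulr_gt0//; lra.
have d1 : is_derive s 1 (fun s => c ^+ 2 - s ^+ 2) (- (2 * s)).
  have e : (fun s : R => c ^+ 2 - s ^+ 2) = (cst (c ^+ 2) - (id ^+ 2)) by [].
  rewrite e; apply: is_derive_eq; rewrite /= add0r.
  by rewrite expr1 /GRing.scale /= mulr1.
have d2 := is_derive1_sqrt g0.
have d3 := is_derive1_comp (f := Num.sqrt) (g := fun s => c ^+ 2 - s ^+ 2) d2 d1.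
suff <- : (2 * sig c s)^-1 * - (2 * s) = - (s / sig c s) by exact: d3.
have s0 : sig c s != 0 by rewrite gt_eqF// sig_gt0// h1.
by field.
Qed.

(* [c^2/sig = 2 sig - (s sig)'] exhibits an antiderivative of [1/sig] without
   trigonometric functions. *)
Lemma inv_sig_antiderivative (c : R) : 0 < c -> exists G : R -> R,
  [/\ forall x, - c <= x <= c -> {for x, continuous G},
      forall x, - c < x < c -> is_derive x 1 G (sig c x)^-1 &
      G c - G (- c) <= 4].
Proof.
move=> c0; have [H dH] := antiderivative (- c) c (@continuous_sig c).
have cH x : - c <= x <= c -> {for x, continuous H}.
  by move=> /dH; exact: is_derive1_continuous.
exists (fun s => (2 * H s - s * sig c s) / c ^+ 2); split.
- move=> x xc; apply: cvgMl; apply: cvgB; first by apply: cvgMr; exact: cH.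
  by apply: cvgM; [exact: cvg_id|exact: continuous_sig].
- move=> x xc; have [h1 h2] := andP xc.
  have xc' : - c <= x <= c by rewrite !ltW.
  have d1 := dH x xc'; have d2 := is_derive_sig xc.
  have -> : (fun s => (2 * H s - s * sig c s) / c ^+ 2) =
      (c ^+ 2)^-1 \*: (2 \*: H - id * sig c).
    by apply/funext => s /=; rewrite !fctE /= mulrC.
  apply: is_derive_eq; rewrite /GRing.scale /=.
  have s0 : sig c x != 0 by rewrite gt_eqF// sig_gt0.
  have := sqr_sig xc' => e.
  have e2 : x ^+ 2 = c ^+ 2 - sig c x ^+ 2 by rewrite e; ring.
  have cn0 : c != 0 by rewrite gt_eqF.
  rewrite (_ : c ^- 2 * _ = c ^- 2 * ((sig c x ^+ 2 + x ^+ 2) / sig c x)); last by field; rewrite cn0 s0.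
  by rewrite e2 addrC subrK mulrA mulVf ?mul1r// sqrf_eq0.
(* As [sig c] vanishes at c and -c, the increment is 2 (H c - H (- c)) / c^2, and the mean value
   theorem bounds H c - H (- c) by 2 c * c. The exact value is pi; what matters is a bound
   independent of c. *)
- rewrite sigN sigc !mulr0 !subr0 -mulrBl ler_pdivrMr ?exprn_gt0// -mulrBr.
  have [|||x _ ->] := @MVT R H (sig c) (- c) c; first lra.
  + by move=> x; rewrite in_itv /= => /andP[h1 h2]; apply: dH; rewrite !ltW.
  + apply: continuous_in_subspaceT => x; rewrite inE /= in_itv /=; exact: cH.
  + have := sig_le x (ltW c0); rewrite expr2; nra.
Qed.

Lemma inv_sig_integrable (c : R) : 0 < c ->
  leb.-integrable `]- c, c[ (EFin \o (fun s => (sig c s)^-1)) /\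
  \int[leb]_(s in `]- c, c[) (sig c s)^-1 <= 4.
Proof.
move=> c0; have [G [cG dG G4]] := inv_sig_antiderivative c0.
have cc : - c < c by lra.
have ci x : - c < x < c -> {for x, continuous (fun s => (sig c s)^-1)}.
  move=> xc; apply: cvgV; first by rewrite gt_eqF// sig_gt0.
  exact: continuous_sig.
have i0 x : - c < x < c -> 0 <= (sig c x)^-1.
  by move=> xc; rewrite invr_ge0 sig_ge0.
have [i e] := ge0_FTC_oo cc cG dG ci i0.
by split => //; rewrite e.
Qed.

(** [sig c] is an involution of [0, c] with derivative - s / sig c s. Hence - P1 (sig c s) is an
    antiderivative of the integrand for s > 0. For s < 0 one has s = - sig c (sig c s), and - P2
    (sig c s) takes over. The integrand is unbounded near c and -c, so it is dominated by a multiple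
    of 1 / sig. *)
Lemma half_disc_subst (phi : R -> R) (c : R) : continuous phi -> 0 < c ->
  leb.-integrable `]- c, c[ (EFin \o (fun s => phi s * (s / sig c s))) /\
  \int[leb]_(s in `]- c, c[) (phi s * (s / sig c s)) =
  \int[leb]_(h in `]0, c[) (phi (sig c h) - phi (- sig c h)).
Proof.
move=> cphi c0; pose f s := phi s * (s / sig c s).
have cphim : continuous (fun h => phi (sig c h)).
  by move=> x; apply: (continuous_comp (@continuous_sig c x)); exact: cphi.
have cphin : continuous (fun h => phi (- sig c h)).
  move=> x; apply: (continuous_comp (f := fun h => - sig c h)); last exact: cphi.
  by apply: cvgN; exact: continuous_sig.
have [P1 dP1] := antiderivative 0 c cphim.
have [P2 dP2] := antiderivative 0 c cphin.
have cP1 x : 0 <= x <= c -> {for x, continuous P1}.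
  by move=> /dP1; exact: is_derive1_continuous.
have cP2 x : 0 <= x <= c -> {for x, continuous P2}.
  by move=> /dP2; exact: is_derive1_continuous.
have sigi x : 0 <= sig c x <= c by rewrite sig_ge0 sig_le// ltW.
have cphia x : - c <= x <= c -> {for x, continuous phi} by move=> _; exact: cphi.
have [C [C0 hC]] := continuous_itv_bounded cphia.
have [G [cG dG G4]] := inv_sig_antiderivative c0.
have cinv x : - c < x < c -> {for x, continuous (fun s => (sig c s)^-1)}.
  move=> xc; apply: cvgV; first by rewrite gt_eqF// sig_gt0.
  exact: continuous_sig.
have cf x : - c < x < c -> {for x, continuous f}.
  move=> xc; apply: cvgM; first exact: cphi.
  by apply: cvgM; [exact: cvg_id|exact: cinv].
have fle x : - c < x < c -> `|f x| <= C * c * (sig c x)^-1.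
  move=> /andP[h1 h2]; rewrite /f mulrA normrM (ger0_norm (_ : 0 <= (sig c x)^-1)) ?invr_ge0 ?sig_ge0//.
  rewrite ler_wpM2r ?invr_ge0 ?sig_ge0// normrM ler_pM//; first by apply: hC; rewrite !ltW.
  by rewrite ler_norml !ltW.
have fi : leb.-integrable `]- c, c[ (EFin \o f).
  have [gi _] := inv_sig_integrable c0.
  have gi' : leb.-integrable `]- c, c[ (EFin \o (fun s => C * c * (sig c s)^-1)).
    by under [X in _.-integrable _ X]eq_fun do rewrite /= EFinM; exact: integrableZl.
  apply: le_integrable gi' => //.
  - by apply/measurable_EFinP; exact: itv_oo_measurable_fun.
  - by move=> x; rewrite /= in_itv /= => xc; rewrite lee_fin (le_trans (fle _ xc))// ler_norm.
have c0' : - c < 0 by lra.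
have [i1 e1] : leb.-integrable `]0, c[ (EFin \o f) /\
    \int[leb]_(s in `]0, c[) f s = - P1 (sig c c) - - P1 (sig c 0).
  apply: (@FTC_oo R f (fun s => - P1 (sig c s)) (fun s => (sig c s)^-1) G 0 c (C * c)) => // x /andP[h1 h2].
  - by apply: cvgN; apply: (continuous_comp (@continuous_sig c x)); exact: cP1.
  - have xc : - c < x < c by apply/andP; lra.
    have d := is_derive1_comp (dP1 _ (sigi x)) (is_derive_sig xc).
    have -> : f x = - (phi (sig c (sig c x)) * - (x / sig c x)).
      by rewrite sigK ?mulrN ?opprK//; apply/andP; lra.
    exact: is_deriveN.
  - by apply: cf; apply/andP; lra.
  - by apply: cG; apply/andP; lra.
  - by apply: dG; apply/andP; lra.
  - by apply: cinv; apply/andP; lra.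
  - by apply: fle; apply/andP; lra.
have [i2 e2] : leb.-integrable `](- c), 0[ (EFin \o f) /\
    \int[leb]_(s in `](- c), 0[) f s = - P2 (sig c 0) - - P2 (sig c (- c)).
  apply: (@FTC_oo R f (fun s => - P2 (sig c s)) (fun s => (sig c s)^-1) G (- c) 0 (C * c)) => // x /andP[h1 h2].
  - by apply: cvgN; apply: (continuous_comp (@continuous_sig c x)); exact: cP2.
  - have xc : - c < x < c by apply/andP; lra.
    have d := is_derive1_comp (dP2 _ (sigi x)) (is_derive_sig xc).
    have -> : f x = - (phi (- sig c (sig c x)) * - (x / sig c x)).
      rewrite -(sigN c x) sigK ?sigN ?opprK ?mulrN ?opprK//; apply/andP; lra.
    exact: is_deriveN.
  - by apply: cf; apply/andP; lra.
  - by apply: cG; apply/andP; lra.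
  - by apply: dG; apply/andP; lra.
  - by apply: cinv; apply/andP; lra.
  - by apply: fle; apply/andP; lra.
have [i3 e3] : leb.-integrable `]0, c[ (EFin \o (fun h => phi (sig c h) - phi (- sig c h))) /\
    \int[leb]_(h in `]0, c[) (phi (sig c h) - phi (- sig c h)) = (P1 c - P2 c) - (P1 0 - P2 0).
  apply: (@FTC_oo_bounded _ (fun x => P1 x - P2 x)) => // x xc.
  - by apply: cvgB; [exact: cphim|exact: cphin].
  - by apply: cvgB; [exact: cP1|exact: cP2].
  - have xc' : 0 <= x <= c by case/andP: xc => ? ?; rewrite !ltW.
    have d1 := dP1 _ xc'; have d2 := dP2 _ xc'; exact: is_deriveB.
split => //.
have := @Rintegral_itvB R f (BRight (- c)) (BLeft c) 0 fi.
rewrite !bnd_simp => /(_ (ltW c0') c0).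
rewrite -Rintegral_itv_bndo_bndc// e1 e2 => /eqP; rewrite subr_eq => /eqP ->.
rewrite e3 sigN sigc sig0 ?ltW//; ring.
Qed.

End half_disc.

(** * The divergence theorem on the half ball *)

Section ball_integrals.
Context {R : realType}.
Local Notation mR := (measurableTypeR R).
Local Notation leb := (@lebesgue_measure R).
Local Notation L n := (lebesgue_tuple R n).

(** The two difference quotients are the same function of h. The equivalence carries one-variable
    calculus over to directional derivatives and back, without total differentiability. *)
Lemma is_derive_line (V : normedModType R) (f : V -> R) (g : R -> V) (s : R) (v : V) (d : R) :
  (forall h, g (h + s) = h *: v + g s) ->
  is_derive s 1 (f \o g) d <-> is_derive (g s) v f d.
Proof.
move=> gE.
have e : (fun h => h^-1 *: ((f \o shift (g s)) (h *: v) - f (g s))) =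
    (fun h => h^-1 *: (((f \o g) \o shift s) (h *: 1) - (f \o g) s)).
  by apply/funext => h /=; rewrite [h%:A]mulr1 gE.
split=> [[h1 h2]|[h1 h2]]; apply: DeriveDef.
- by rewrite /derivable e.
- by rewrite /derive e.
- by rewrite /derivable -e.
- by rewrite /derive -e.
Qed.

Lemma insE n (i : 'I_n.+1) (s h : R) (y : 'rV[R]_n) :
  ins i (h + s) y = h *: delta_mx 0 i + ins i s y.
Proof.
apply/rowP => j; rewrite !mxE eqxx /=; case: (unliftP i j) => [k ->|->].
  by rewrite eq_sym (negbTE (neq_lift _ _)) mulr0 add0r.
by rewrite eqxx mulr1.
Qed.

Lemma is_derive_ins n (i : 'I_n.+1) (f : 'rV[R]_n.+1 -> R) (s d : R) (y : 'rV[R]_n) :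
  is_derive (ins i s y) (delta_mx 0 i) f d -> is_derive s 1 (fun t => f (ins i t y)) d.
Proof.
exact: (@is_derive_line _ f (fun t => ins i t y) s _ d (fun h => insE i s h y)).2.
Qed.

Lemma enorm_ins n (i : 'I_n.+1) (s : R) (y : 'rV[R]_n) :
  enorm (ins i s y) ^+ 2 = s ^+ 2 + enorm y ^+ 2.
Proof.
rewrite !enorm_sqr (bigD1_ord i)//= mxE unlift_none; congr (_ + _).
by apply: eq_bigr => k _; rewrite mxE liftK.
Qed.

Lemma unit_ballE n (x : 'rV[R]_n) : unit_ball x <-> enorm x ^+ 2 < 1.
Proof. by rewrite /unit_ball /= expr_lt1// enorm_ge0. Qed.

(** Freezing all coordinates but the i-th cuts the hemisphere along a half circle of radius
    [hemisphere_height y]. *)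
Lemma hemisphere_height_sig n (i : 'I_n.+1) (s : R) (y : 'rV[R]_n) :
  enorm y ^+ 2 <= 1 ->
  hemisphere_height (ins i s y) = sig (hemisphere_height y) s.
Proof.
rewrite -subr_ge0 => /sqr_sqrtr y1.
rewrite /hemisphere_height /sig enorm_ins y1.
by congr Num.sqrt; ring.
Qed.

Lemma hemisphere_height_gt0 n (y : 'rV[R]_n) :
  unit_ball y <-> 0 < hemisphere_height y.
Proof. by rewrite unit_ballE sqrtr_gt0 subr_gt0. Qed.

Lemma hemisphere_height_out n (y : 'rV[R]_n) :
  ~ unit_ball y -> hemisphere_height y = 0.
Proof.
move=> /hemisphere_height_gt0/negP; rewrite -leNgt => h.
by apply/eqP; rewrite eq_le h sqrtr_ge0.
Qed.

Lemma continuous_hemisphere_height n : continuous (@hemisphere_height R n).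
Proof.
have -> : @hemisphere_height R n = Num.sqrt \o (fun y => 1 - enorm y ^+ 2) by [].
move=> x; apply: continuous_comp; last exact: sqrt_continuous.
apply: continuousB; first exact: cst_continuous.
by apply: continuousM; exact: continuous_enorm.
Qed.

(** A box around the unit ball, whose measure is accessible through the product structure; only its
    finiteness is used. *)
Definition cube n : set (n.-tuple mR) :=
  \bigcap_(i in [set: 'I_n]) [set t | tnth t i \in `[-1, 1]].
Arguments cube : clear implicits.

Lemma measurable_cube n : measurable (cube n).
Proof.
apply: fin_bigcap_measurable => //= i _.
have := measurable_tnth i measurableT (_ : measurable (`[(-1), 1]%classic : set R)).
by rewrite setTI; apply; exact: measurable_itv.
Qed.

Lemma cube_fin n : (L n (cube n) < +oo)%E.
Proof.
elim: n => [|n IH]; first by rewrite /= diracE; case: (_ \in _); rewrite ?ltry.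
rewrite /= /lebesgue_cons /pushforward.
rewrite (_ : _ @^-1` _ = (`[(-1), 1]%classic : set R) `*` cube n); last first.
  apply/seteqP; split => [[s t] h|[s t] [h1 h2] i _] /=.
    split => [|i _] /=; first by have := h ord0 I; rewrite /= tnth0.
    by have := h (lift ord0 i) I; rewrite /= tnthS.
  by case: (unliftP ord0 i) => [k ->|->]; rewrite ?tnthS ?tnth0//; exact: h2.
rewrite product_measure1E//; last exact: measurable_cube.
rewrite lte_mul_pinfty//.
have e := @lebesgue_measure_itv R `[(-1), 1].
by rewrite [X in X \is a _]e /=; case: ifP.
Qed.

Lemma rintegrable_bounded n (f : 'rV[R]_n -> R) (C : R) : rmeasurable f ->
  (forall x, `|f x| <= C) -> (forall x, ~ unit_ball x -> f x = 0) ->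
  rintegrable f.
Proof.
move=> mf fC f0.
have h : (L n).-integrable (cube n) (EFin \o (fun t : n.-tuple mR => f (tuple_row t))).
  apply: measurable_bounded_integrable; [exact: measurable_cube|exact: cube_fin| |].
    exact: measurable_funTS.
  by exists C; split; [rewrite num_real|move=> D CD t _; exact: le_trans (fC _) (ltW CD)].
move/integrable_mkcond : h => /(_ (@measurable_cube n)).
congr (_.-integrable _ _); apply/funext => t; rewrite patchE /=.
case: ifPn => // /negP; rewrite inE => h; rewrite f0// => tb; apply: h => i _ /=.
rewrite in_itv /= -ler_norml; have := coord_le_enorm (tuple_row t) i.
by rewrite mxE => h; exact: (le_trans h (ltW tb)).
Qed.

(** Compactness of a box containing the ball of radius r. Continuity is asked only for t in [a, b],
    because the functions in view contain powers of t and are controlled only for t > 0. *)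
Lemma continuous_cube_bounded n (f : R * 'rV[R]_n -> R) (a b r : R) :
  (forall t x, a <= t <= b -> {for (t, x), continuous f}) ->
  exists C, 0 <= C /\ forall t x, a <= t <= b -> enorm x <= r -> `|f (t, x)| <= C.
Proof.
move=> cf.
have [ab|ab] := leP a b; last first.
  by exists 0; split => // t x /andP[ax xb]; have := le_trans ax xb; rewrite leNgt ab.
have [r0|r0] := leP 0 r; last first.
  by exists 0; split => // t x _ xr; have := le_trans (enorm_ge0 x) xr; rewrite leNgt r0.
pose K : set (R * 'rV[R]_n) :=
  `[a, b]%classic `*` [set v : 'rV[R]_n | forall i, `[- r, r]%classic (v 0 i)].
have cK : compact K.
  apply: compact_setX; first exact: segment_compact.
  by apply: (@rV_compact _ _ (fun=> `[- r, r]%classic)) => i; exact: segment_compact.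
have [| |c _ hc] := @compact_EVT_max _ R (fun z => `|f z|) K _ cK.
- exists (a, 0); split => /=; first by rewrite in_itv /= lexx.
  by move=> i; rewrite /= in_itv /= mxE oppr_le0 r0.
- apply: continuous_in_subspaceT => -[t x]; rewrite inE => -[/= h _].
  by apply: cvg_norm; apply: cf; rewrite in_itv in h.
exists `|f c|; split => // t x tab xr; apply: hc; rewrite inE; split => /=.
  by rewrite in_itv.
by move=> i /=; rewrite in_itv /= -ler_norml (le_trans (coord_le_enorm _ _)).
Qed.

Lemma continuous_ball_bounded n (f : 'rV[R]_n -> R) (r : R) : continuous f ->
  exists C, 0 <= C /\ forall x, enorm x <= r -> `|f x| <= C.
Proof.
move=> cf; have [|C [C0 hC]] := @continuous_cube_bounded n (f \o snd) 0 0 r.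
  by move=> t x _; apply: continuous_comp; [exact: cvg_snd|exact: cf].
by exists C; split => // x; apply: (hC 0 x); rewrite lexx.
Qed.

Lemma rintegrable_ball n (A : set 'rV[R]_n) (f : 'rV[R]_n -> R) :
  open A -> A `<=` @unit_ball R n -> continuous f -> rintegrable (f \_ A).
Proof.
move=> oA Ab cf; have [C [C0 hC]] := continuous_ball_bounded 1 cf.
apply: (@rintegrable_bounded _ _ C).
- by apply: rmeasurable_patch; [exact: open_rmeasurable|exact: continuous_rmeasurable].
- move=> x; rewrite patchE; case: ifPn; rewrite ?normr0// inE => /Ab xb.
  exact/hC/ltW.
- by move=> x xb; rewrite patchE; case: ifPn => //; rewrite inE => /Ab.
Qed.

End ball_integrals.

Section divergence.
Context {R : realType}.
Local Notation mR := (measurableTypeR R).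
Local Notation leb := (@lebesgue_measure R).
Local Notation L n := (lebesgue_tuple R n).
Local Notation ht := (@hemisphere_height R _).

Lemma rmeasurable_patch_open n (A : set 'rV[R]_n) (f : 'rV[R]_n -> R) :
  open A -> (forall x, A x -> {for x, continuous f}) -> rmeasurable (f \_ A).
Proof.
move=> oA cf; have mA := open_rmeasurable oA; rewrite /rmeasurable.
rewrite (_ : (fun t => _) =
    (fun t : n.-tuple mR => f (tuple_row t)) \_ [set t | A (tuple_row t)]); last first.
  apply/funext => t; rewrite !patchE; congr (if _ then _ else _).
apply/(measurable_restrictT _ mA).
apply: (measurability _ (RGenOpens.measurableE R)) => _ [_ [a [b ->] <-]].
rewrite (_ : _ `&` _ = [set t | (A `&` f @^-1` `]a, b[%classic) (tuple_row t)])//.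
apply: open_rmeasurable; rewrite openE => x [Ax fx].
apply: filterI; first by apply: open_nbhs_nbhs.
apply: (cf _ Ax); apply: open_nbhs_nbhs; split; last exact: fx.
exact: interval_open.
Qed.

(* Outside the ball the height is the square root of a negative number, that is
   0, so its inverse is 0 too and integrals against [(ht y)^-1] need no
   indicator of the ball. *)
Lemma inv_height_patch n (f : 'rV[R]_n -> R) :
  (fun y => f y / ht y) = (fun y => f y / ht y) \_ (@unit_ball R n).
Proof.
apply/funext => y; rewrite patchE; case: ifPn => //; rewrite notin_setE => yb.
by rewrite hemisphere_height_out// invr0 mulr0.
Qed.

Lemma rmeasurable_div_height n (f : 'rV[R]_n -> R) : continuous f ->
  rmeasurable (fun y => f y / ht y).
Proof.
move=> cf; rewrite inv_height_patch.
apply: rmeasurable_patch_open; first exact: open_unit_ball.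
move=> x /hemisphere_height_gt0 xb; apply: continuousM; first exact: cf.
by apply: continuousV; [rewrite gt_eqF|exact: continuous_hemisphere_height].
Qed.

(** This is the finiteness of the area of the hemisphere. Along the first coordinate 1 / height
    becomes 1 / [sig c] on a chord of half length c, whose integral is at most 4 whatever c is; what
    remains is 4 times the indicator of a ball of one dimension less. *)
Lemma rintegrable_inv_height n : rintegrable (fun y : 'rV[R]_n.+1 => (ht y)^-1).
Proof.
have mg : rmeasurable (fun y : 'rV[R]_n.+1 => (ht y)^-1).
  rewrite (_ : (fun _ => _) = fun y : 'rV[R]_n.+1 => cst 1 y / ht y); last first.
    by apply/funext => y; rewrite /= mul1r.
  by apply: rmeasurable_div_height => ?; exact: cst_continuous.
apply/integrableP; split; first exact/measurable_EFinP.
rewrite (ge0_rint_ins ord0 (f := fun y => `|((ht y)^-1)%:E|%E))//; last first.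
  by apply: measurableT_comp => //; exact/measurable_EFinP.
pose four := fun _ : 'rV[R]_n => 4 : R.
have i4 : rintegrable (four \_ (@unit_ball R n)).
  by apply: rintegrable_ball => //; [exact: open_unit_ball|move=> ?; exact: cst_continuous].
apply: le_lt_trans (_ : \int[L n]_t `|((four \_ (@unit_ball R n)) (tuple_row t))%:E| < +oo)%E; last first.
  by move/integrableP : i4 => [].
apply: ge0_le_integral => //.
- by move=> t _; apply: integral_ge0.
- apply: (ge0_measurable_rint_ins ord0 (f := fun y => `|((ht y)^-1)%:E|%E)) => //.
  by apply: measurableT_comp => //; exact/measurable_EFinP.
- by apply: measurableT_comp => //; apply/measurable_EFinP; exact: rintegrable_measurable i4.
move=> t _; set y := tuple_row t; rewrite patchE; case: ifPn => [|]; rewrite ?notin_setE ?inE => yb; last first.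
  rewrite /= normr0 integral0_eq// => s _ /=.
  rewrite hemisphere_height_out ?invr0 ?normr0// unit_ballE enorm_ins.
  move=> h; apply: yb; apply/unit_ballE; have := sqr_ge0 s; lra.
have c0 := (hemisphere_height_gt0 y).1 yb; set c := ht y in c0.
have yl : enorm y ^+ 2 <= 1 by apply/ltW/unit_ballE.
have [i1 i2] := inv_sig_integrable c0.
rewrite /= (ger0_norm (_ : 0 <= 4))//.
have e (s : R) : `|(ht (ins ord0 s y))^-1|%:E =
    ((EFin \o (fun s => (sig c s)^-1)) \_ `]- c, c[) s.
  rewrite hemisphere_height_sig// ger0_norm ?invr_ge0 ?sig_ge0// patchE.
  case: ifPn => //; rewrite notin_setE /= in_itv /= => /negP h.
  rewrite (_ : sig _ _ = 0) ?invr0//; apply: ler0_sqrtr.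
  rewrite subr_sqr; move: h; rewrite negb_and -!leNgt => /orP[] h; [apply: mulr_ge0_le0|apply: mulr_le0_ge0]; move: c0 h; rewrite -/c; move: (c) => d; lra.
under eq_integral do rewrite e.
rewrite -integral_mkcond -[leLHS]fineK ?lee_fin//.
exact: integrable_fin_num.
Qed.

Lemma rintegrable_div_height n (f : 'rV[R]_n.+1 -> R) : continuous f ->
  rintegrable (fun y => f y / ht y).
Proof.
move=> cf; have [C [C0 hC]] := continuous_ball_bounded 1 cf.
apply: le_rintegrable (rintegrableZ C (rintegrable_inv_height n)).
  exact: rmeasurable_div_height.
move=> y; have [yb|yb] := pselect (unit_ball y).
  by rewrite !normrM ler_wpM2r// (le_trans (hC _ (ltW yb)))// ler_norm.
by rewrite hemisphere_height_out// invr0 !mulr0.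
Qed.

End divergence.

Section divergence.
Context {R : realType}.
Local Notation leb := (@lebesgue_measure R).
Local Notation ht := (@hemisphere_height R _).

Lemma Rintegral_supp (f g : R -> R) (D : set R) :
  (forall x, D x -> f x = g x) -> (forall x, ~ D x -> f x = 0) ->
  \int[leb]_s f s = \int[leb]_(s in D) g s.
Proof.
move=> fg f0; rewrite Rintegral_mkcond [RHS]Rintegral_mkcond; congr Rintegral.
apply/funext => x; rewrite !patchE in_setT; case: ifPn.
  by rewrite inE => /fg.
by rewrite notin_setE => /f0.
Qed.

Lemma sig_itv (c s : R) : 0 < c -> (- c < s < c) = (s ^+ 2 < c ^+ 2).
Proof.
move=> c0; rewrite -ltr_norml -(@ltr_pXn2r _ 2)// ?nnegrE ?ltW//.
by rewrite real_normK// num_real.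
Qed.

Lemma sqr_ht n (y : 'rV[R]_n) : unit_ball y -> ht y ^+ 2 = 1 - enorm y ^+ 2.
Proof. by move=> /unit_ballE yb; rewrite sqr_sqrtr// subr_ge0 ltW. Qed.

Lemma unit_ball_ins n (i : 'I_n.+1) (s : R) (y : 'rV[R]_n) : unit_ball y ->
  unit_ball (ins i s y) <-> - ht y < s < ht y.
Proof.
move=> yb; rewrite unit_ballE enorm_ins sig_itv; last exact/hemisphere_height_gt0.
by rewrite sqr_ht//; split; lra.
Qed.

Lemma unit_ball_ins_out n (i : 'I_n.+1) (s : R) (y : 'rV[R]_n) :
  ~ unit_ball y -> ~ unit_ball (ins i s y).
Proof.
by rewrite !unit_ballE enorm_ins => h1 h2; apply: h1; have := sqr_ge0 s; lra.
Qed.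

Lemma lift_max_val n (i : 'I_n) : lift ord_max i = i :> nat.
Proof. by rewrite /= /bump leqNgt ltn_ord. Qed.

Lemma lift_lift_max n (i : 'I_n.+1) :
  ord_max = lift (lift ord_max i) (ord_max : 'I_n.+1).
Proof.
apply: val_inj; rewrite /=.
have -> : bump n.+1 i = i by exact: lift_max_val.
by rewrite /bump -ltnS ltn_ord.
Qed.

Lemma lift_lift_comm n (i : 'I_n.+1) (k : 'I_n) :
  lift ord_max (lift i k) = lift (lift ord_max i) (lift ord_max k).
Proof.
apply: val_inj; rewrite [LHS]lift_max_val /=.
have -> : bump n.+1 i = i by exact: lift_max_val.
by have -> : bump n k = k by exact: lift_max_val.
Qed.

Lemma half_space_lift n (i : 'I_n.+1) (s : R) (y : 'rV[R]_n.+1) :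
  half_space (ins (lift ord_max i) s y) <-> half_space y.
Proof.
rewrite /half_space /= !mxE.
by rewrite {2}(lift_lift_max i) liftK.
Qed.

Lemma ins_at n (i : 'I_n.+1) (s : R) (y : 'rV[R]_n) : ins i s y 0 i = s.
Proof. by rewrite mxE unlift_none. Qed.

Lemma ins_lift n (i : 'I_n.+1) (s : R) (y : 'rV[R]_n) k :
  ins i s y 0 (lift i k) = y 0 k.
Proof. by rewrite mxE liftK. Qed.

Lemma ins_snoc n (i : 'I_n.+1) (s h : R) (z : 'rV[R]_n) :
  row_snoc (ins i s z) h = ins (lift ord_max i) s (row_snoc z h).
Proof.
apply/rowP => j; case: (unliftP ord_max j) => [k ->|->].
  rewrite row_snoc_lift; case: (unliftP i k) => [l ->|->]; last by rewrite !ins_at.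
  by rewrite lift_lift_comm !ins_lift ?row_snoc_lift.
by rewrite row_snoc_max [X in _ = _ _ _ X](lift_lift_max i) ins_lift ?row_snoc_max ?ins_at.
Qed.

Lemma div_vertical n (F F' : 'rV[R]_n.+1 -> R) : continuous F -> continuous F' ->
  (forall x, half_space x -> is_derive x (delta_mx 0 ord_max) F (F' x)) ->
  rint (F' \_ (@half_ball R n)) =
  rint ((fun y => F (row_snoc y (ht y)) - F (row_snoc y 0)) \_ (@unit_ball R n)).
Proof.
move=> cF cF' dF; rewrite (rint_ins ord_max); last first.
  by apply: rintegrable_ball => //; [exact: open_half_ball|move=> x []].
apply: eq_rint => y; rewrite [RHS]patchE; case: ifPn => [|]; last first.
  rewrite notin_setE => yb; rewrite -[RHS](Rintegral_set0 leb (cst 0)).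
  apply: Rintegral_supp => // s _; rewrite patchE; case: ifPn => //.
  by rewrite inE => -[/unit_ball_ins_out]; case.
rewrite inE => yb; have c0 := (hemisphere_height_gt0 y).1 yb.
have cl : continuous (fun h => row_snoc y h).
  by apply: continuous_ins => x; [exact: cvg_id|exact: cst_continuous].
transitivity (\int[leb]_(h in `]0, ht y[) F' (row_snoc y h)).
  have hb h : half_ball (ins ord_max h y) <-> `]0, ht y[%classic h.
    rewrite /half_ball /= in_itv /= unit_ball_ins// /half_space /= mxE unlift_none.
    by split => [[/andP[h1 h2] h3]|/andP[h1 h2]]; [apply/andP|split => //; apply/andP; lra].
  apply: Rintegral_supp => h; rewrite -hb patchE; case: ifPn => //.
    by rewrite notin_setE.
  by rewrite inE.
apply: (@FTC_oo_bounded _ _ (fun h => F (row_snoc y h)) 0 (ht y) c0 _ _ _).2 => h hb.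
- by apply: continuous_comp; [exact: cl|exact: cF'].
- by apply: continuous_comp; [exact: cl|exact: cF].
- apply: (@is_derive_ins _ _ ord_max); apply: dF.
  by rewrite /half_space /= mxE unlift_none; case/andP: hb.
Qed.

Lemma div_tangential n (i : 'I_n.+1) (F F' : 'rV[R]_n.+2 -> R) :
  continuous F -> continuous F' ->
  (forall x, half_space x -> is_derive x (delta_mx 0 (lift ord_max i)) F (F' x)) ->
  rint (F' \_ (@half_ball R n.+1)) =
  rint (fun y => F (row_snoc y (ht y)) * (y 0 i / ht y)).
Proof.
move=> cF cF' dF; rewrite (rint_ins (lift ord_max i)); last first.
  by apply: rintegrable_ball => //; [exact: open_half_ball|move=> x []].
pose j := lift ord_max i.
pose H (y : 'rV[R]_n.+1) := F (ins j (ht y) y) - F (ins j (- ht y) y).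
have cH : continuous H.
  move=> y; apply: continuousB.
    apply: continuous_comp; last exact: cF.
    by apply: continuous_ins => x; [exact: continuous_hemisphere_height|exact: cvg_id].
  apply: continuous_comp; last exact: cF.
  by apply: continuous_ins => x; [apply: continuousN; exact: continuous_hemisphere_height|exact: cvg_id].
(* The half ball is swept by the chords parallel to e_i, over the half ball of one dimension less;
   the fundamental theorem on each chord leaves the values of F at its two ends. *)
transitivity (rint (H \_ (@half_ball R n))).
  apply: eq_rint => y; rewrite [RHS]patchE.
  have hb s : half_ball (ins j s y) <-> half_ball y /\ `]- ht y, ht y[%classic s.
    rewrite /half_ball /= in_itv /=; split.
      move=> [h1 /half_space_lift h2]; have yb : unit_ball y.
        by have [//|/(unit_ball_ins_out (i := j) (s := s))] := pselect (unit_ball y).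
      by split => //; apply/(unit_ball_ins j).
    by move=> [[h1 h2] h3]; split; [apply/unit_ball_ins|apply/half_space_lift].
  case: ifPn => [|]; last first.
    rewrite notin_setE => yb; rewrite -[RHS](Rintegral_set0 leb (cst 0)).
    apply: Rintegral_supp => // s _; rewrite patchE; case: ifPn => //.
    by rewrite inE => /hb[].
  rewrite inE => yb; have c0 := (hemisphere_height_gt0 y).1 yb.1.
  have cl : continuous (fun h => ins j h y).
    by apply: continuous_ins => x; [exact: cvg_id|exact: cst_continuous].
  transitivity (\int[leb]_(s in `]- ht y, ht y[) F' (ins j s y)).
    apply: Rintegral_supp => s hs; rewrite patchE; case: ifPn => //.
      by rewrite notin_setE hb => /not_andP[].
    by rewrite inE hb => -[].
  have cc : - ht y < ht y by rewrite (lt_trans _ c0)// oppr_lt0.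
  apply: (@FTC_oo_bounded _ _ (fun s => F (ins j s y)) (- ht y) (ht y) cc _ _ _).2 => h hbt.
  - by apply: continuous_comp; [exact: cl|exact: cF'].
  - by apply: continuous_comp; [exact: cl|exact: cF].
  - apply: is_derive_ins; apply: dF; apply/half_space_lift; exact: yb.2.
(* From here both sides are integrated first over one variable, x_N on the left and x_i on the
   right, with the other coordinates z fixed. The function [phi] below is F along the half circle of
   radius c over z; the chord at height h ends at s = sig c h and s = - sig c h. *)
rewrite (rint_ins ord_max); last first.
  by apply: rintegrable_ball => //; [exact: open_half_ball|move=> x []].
have cFh : continuous (fun y => F (row_snoc y (ht y))).
  move=> y; apply: continuous_comp; last exact: cF.
  by apply: continuous_ins => x; [exact: continuous_hemisphere_height|exact: cvg_id].
rewrite (rint_ins i); last first.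
  under [X in rintegrable X]eq_fun do rewrite mulrA.
  apply: rintegrable_div_height => y.
  by apply: continuousM; [exact: cFh|exact: coord_continuous].
apply: eq_rint => z.
have [zb|zb] := pselect (unit_ball z); last first.
  transitivity (0 : R).
    rewrite -(Rintegral_set0 leb (cst 0)); apply: Rintegral_supp => // s _.
    by rewrite patchE; case: ifPn => //; rewrite inE => -[/unit_ball_ins_out]; case.
  rewrite -(Rintegral_set0 leb (cst 0)); apply/esym; apply: Rintegral_supp => // s _.
  rewrite (hemisphere_height_out (y := ins i s z)) ?invr0 ?mulr0//.
  exact: unit_ball_ins_out.
have c0 := (hemisphere_height_gt0 z).1 zb; set c := ht z in c0.
have zl : enorm z ^+ 2 <= 1 by apply/ltW/unit_ballE.
pose phi s := F (row_snoc (ins i s z) (sig c s)).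
have cphi : continuous phi.
  move=> s; apply: continuous_comp; last exact: cF.
  apply: continuous_ins; first exact: continuous_sig.
  by apply: continuous_ins => x; [exact: cvg_id|exact: cst_continuous].
transitivity (\int[leb]_(h in `]0, c[) (phi (sig c h) - phi (- sig c h))).
  have hb h : half_ball (ins ord_max h z) <-> `]0, c[%classic h.
    rewrite /half_ball /= in_itv /= unit_ball_ins// -/c /half_space /= mxE unlift_none.
    by split => [[/andP[h1 h2] h3]|/andP[h1 h2]]; [apply/andP|split => //; apply/andP; lra].
  apply: Rintegral_supp => h; rewrite -hb patchE; case: ifPn => //; last 2 first.
    by rewrite notin_setE.
    by rewrite inE.
  move=> _ /hb; rewrite /= in_itv /= => /andP[h1 h2].
  rewrite /H /phi sigN sigK; last by rewrite !ltW.
  by rewrite !ins_snoc hemisphere_height_sig.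
have [_ <-] := half_disc_subst cphi c0.
apply/esym; apply: Rintegral_supp => s /=.
  move=> _; rewrite /phi hemisphere_height_sig// -/c; congr (_ * (_ / _)).
  by rewrite mxE unlift_none.
rewrite in_itv /= -(unit_ball_ins i)// => /hemisphere_height_out ->.
by rewrite invr0 !mulr0.
Qed.

End divergence.

Section half_ball_divergence.
Context {R : realType}.
Local Notation ht := (@hemisphere_height R _).

Lemma ins_eta n (i : 'I_n.+1) (y : 'rV[R]_n.+1) :
  exists z : 'rV[R]_n, y = ins i (y 0 i) z.
Proof.
exists (\row_k y 0 (lift i k)); apply/rowP => j.
case: (unliftP i j) => [k ->|->]; last by rewrite ins_at.
by rewrite ins_lift mxE.
Qed.

Lemma is_derive_hemisphere_height n (i : 'I_n) (y : 'rV[R]_n) : unit_ball y ->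
  is_derive y (delta_mx 0 i) (@hemisphere_height R n) (- (y 0 i / ht y)).
Proof.
case: n i y => [[]//|n] i y; have [z ->] := ins_eta i y; rewrite ins_at.
move: (y 0 i) => s yb; have [zb|zb] := pselect (unit_ball z); last first.
  by have := unit_ball_ins_out zb yb.
have zl : enorm z ^+ 2 <= 1 by apply/ltW/unit_ballE.
apply: (@is_derive_line _ _ (@hemisphere_height R _) (fun t => ins i t z) s _ _ (fun h => insE i s h z)).1.
rewrite (_ : _ \o _ = sig (ht z)); last first.
  by apply/funext => t; rewrite /= hemisphere_height_sig.
rewrite hemisphere_height_sig//; apply: is_derive_sig.
exact/(unit_ball_ins i).
Qed.

(** On the ball |grad ht|^2 = |y|^2 / ht^2 and |y|^2 = 1 - ht^2, so the area element of the graph is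
    1 / ht; off the ball 1 / ht is 0. *)
Lemma hemisphere_integralE n (f : 'rV[R]_n.+1 -> R) :
  hemisphere_integral f = rint (fun y => f (row_snoc y (ht y)) / ht y).
Proof.
rewrite /hemisphere_integral /graph_integral vol_integralE; apply: eq_rint => y.
rewrite patchE; case: ifPn; last first.
  by rewrite notin_setE => /hemisphere_height_out ->; rewrite invr0 mulr0.
rewrite inE => yb; congr (_ * _).
have h0 := (hemisphere_height_gt0 y).1 yb.
have -> : 1 + grad_sqr ht y = ((ht y)^-1) ^+ 2.
  have -> : grad_sqr ht y = enorm y ^+ 2 / ht y ^+ 2.
    rewrite enorm_sqr mulr_suml; apply: eq_bigr => i _.
    have d := is_derive_hemisphere_height i yb.
    by rewrite /partial derive_val sqrrN expr_div_n.
  have -> : enorm y ^+ 2 = 1 - ht y ^+ 2 by rewrite sqr_ht//; ring.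
  by field; rewrite gt_eqF.
by rewrite sqrtr_sqr ger0_norm// invr_ge0 ltW.
Qed.

Lemma continuous_height_graph n (f : 'rV[R]_n.+1 -> R) : continuous f ->
  continuous (fun y => f (row_snoc y (ht y))).
Proof.
move=> cf y; apply: continuous_comp; last exact: cf.
by apply: continuous_ins => x; [exact: continuous_hemisphere_height|exact: cvg_id].
Qed.

Lemma continuous_flat n (f : 'rV[R]_n.+1 -> R) : continuous f ->
  continuous (fun y => f (row_snoc y 0)).
Proof.
move=> cf y; apply: continuous_comp; last exact: cf.
by apply: continuous_ins => x; [exact: cst_continuous|exact: cvg_id].
Qed.

(** The outward normal is x on the unit sphere and - e_N on the flat part. The vertical contribution
    has no density, so it is written as F_N ht / ht: there ht is the coordinate x_N, and the term
    joins the tangential ones under the surface measure. *)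
Lemma divergence_half_ball n (F F' : 'I_n.+2 -> 'rV[R]_n.+2 -> R) :
  (forall i, continuous (F i)) -> (forall i, continuous (F' i)) ->
  (forall i x, half_space x -> is_derive x (delta_mx 0 i) (F i) (F' i x)) ->
  rint ((fun x => \sum_i F' i x) \_ (@half_ball R n.+1)) =
  hemisphere_integral (fun x => \sum_i F i x * x 0 i)
  - rint ((fun y => F ord_max (row_snoc y 0)) \_ (@unit_ball R n.+1)).
Proof.
move=> cF cF' dF.
have -> : (fun x => \sum_i F' i x) \_ (@half_ball R n.+1) =
    fun x => \sum_i (F' i \_ (@half_ball R n.+1)) x.
  apply/funext => x; rewrite patchE; case: ifPn => h.
    by apply: eq_bigr => i _; rewrite patchE h.
  by rewrite big1// => i _; rewrite patchE (negbTE h).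
have iF' i : rintegrable (F' i \_ (@half_ball R n.+1)).
  by apply: rintegrable_ball => //; [exact: open_half_ball|move=> x []].
rewrite (rint_sum iF').2.
rewrite (bigD1_ord ord_max)//= (div_vertical (cF _) (cF' _) (dF _)).
under eq_bigr do rewrite (div_tangential (cF _) (cF' _) (dF _)).
rewrite hemisphere_integralE.
have iFi (i : 'I_n.+1) : rintegrable (fun y : 'rV[R]_n.+1 =>
    F (lift ord_max i) (row_snoc y (ht y)) * (y 0 i / ht y)).
  under [X in rintegrable X]eq_fun do rewrite mulrA.
  apply: rintegrable_div_height => y; apply: continuousM; last exact: coord_continuous.
  exact: continuous_height_graph.
rewrite -(rint_sum iFi).2.
have -> : (fun y : 'rV[R]_n.+1 => F ord_max (row_snoc y (ht y)) - F ord_max (row_snoc y 0)) \_ (@unit_ball R n.+1)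
  = fun y => (F ord_max (row_snoc y (ht y)) * ht y) / ht y
     - ((fun y => F ord_max (row_snoc y 0)) \_ (@unit_ball R n.+1)) y.
  apply/funext => y; rewrite !patchE; case: ifPn; last first.
    by rewrite notin_setE => /hemisphere_height_out ->; rewrite invr0 !mulr0 subr0.
  by rewrite inE => /hemisphere_height_gt0 h; rewrite mulfK// gt_eqF.
have i1 : rintegrable (fun y : 'rV[R]_n.+1 => (F ord_max (row_snoc y (ht y)) * ht y) / ht y).
  apply: rintegrable_div_height => y; apply: continuousM; last exact: continuous_hemisphere_height.
  exact: continuous_height_graph.
have i2 : rintegrable ((fun y => F ord_max (row_snoc y 0)) \_ (@unit_ball R n.+1)).
  by apply: rintegrable_ball => //; [exact: open_unit_ball|exact: continuous_flat].
rewrite rintB// addrAC -rintD//; last exact: (rint_sum iFi).1.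
congr (_ - _); apply: eq_rint => y.
rewrite [in RHS](bigD1_ord ord_max)//= mulrDl row_snoc_max; congr (_ + _).
rewrite mulr_suml; apply: eq_bigr => i _; by rewrite row_snoc_lift mulrA.
Qed.

End half_ball_divergence.

(** * Differentiation under the integral *)

Section signed_power.
Context {R : realType}.
Implicit Types r x : R.

Lemma spow0 r : spow r 0 = 0 :> R.
Proof. by rewrite /spow mulr0. Qed.

Lemma powR_norm_spow r x : 0 < r -> `|x| `^ (r + 1) = spow r x * x.
Proof.
move=> r0; have [->|x0] := eqVneq x 0.
  by rewrite mulr0 normr0 powR0// gt_eqF// addr_gt0.
have -> : r + 1 = (r - 1) + 2%:R by ring.
rewrite powRD; last by rewrite normr_eq0 x0 implybT.
by rewrite powR_mulrn// real_normK ?num_real// /spow -mulrA expr2.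
Qed.

Lemma continuous_powR r x : 0 < x -> {for x, continuous (fun y => y `^ r)}.
Proof.
move=> x0; have [d _] := is_derive1_powR r x0.
by apply: differentiable_continuous; exact/derivable1_diffP.
Qed.

Lemma continuous_spow r : 1 < r -> continuous (@spow R r).
Proof.
move=> r1 x; have [->|x0] := eqVneq x 0; last first.
  rewrite (_ : spow r = (fun y : R => `|y| `^ (r - 1)) \* id)//.
  apply: continuousM; last exact: cvg_id.
  apply: (@continuous_comp _ _ _ (fun y : R => `|y|) (fun y => y `^ (r - 1))).
    exact: norm_continuous.
  by apply: continuous_powR; rewrite normr_gt0.
rewrite /continuous_at spow0; apply/cvgrPdist_le => e e0; near=> y.
rewrite sub0r normrN normrM.
have y1 : `|y| <= Num.min 1 e.
  by near: y; apply: (@nbhs0_le _ R); rewrite lt_min ltr01.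
move: y1; rewrite le_min => /andP[y1 ye].
rewrite -[leRHS]mul1r ler_pM//; rewrite ger0_norm ?powR_ge0//.
apply: (@le_trans _ _ (1 `^ (r - 1))); last by rewrite powR1.
by apply: ge0_ler_powR; rewrite ?nnegrE// subr_ge0 ltW.
Unshelve. all: by end_near. Qed.

Lemma is_derive_powR_norm r x : 1 < r ->
  is_derive x 1 (fun y => `|y| `^ (r + 1)) ((r + 1) * spow r x).
Proof.
move=> r1; have r0 : 0 < r by lra.
have [x0|x0|->] := ltgtP x 0.
- have x0' : 0 < - x by lra.
  apply: (@near_eq_is_derive _ _ _ (fun y => (- y) `^ (r + 1))).
    by near=> y; rewrite ltr0_norm//; near: y; exact: lt_nbhsl.
  have d1 : is_derive (- x) 1 (fun y : R => y `^ (r + 1)) _ := is_derive1_powR (r + 1) x0'.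
  have d2 : is_derive x 1 (fun y : R => - y) (- 1).
    by have := is_deriveN (is_derive_id x (1:R)).
  have d3 := is_derive1_comp (g := fun y : R => - y) d1 d2.
  apply: (is_derive_eq d3).
  rewrite /spow ltr0_norm// addrK mulrN1 -mulrN; congr (_ * _).
  have {1}-> : r = r - 1 + 1 by ring.
  have nx : - x != 0 by rewrite gt_eqF.
  by rewrite (@powRD _ (- x) (r - 1) 1) ?nx ?implybT// powRr1 ?ltW// mulrN opprK.
- apply: (@near_eq_is_derive _ _ _ (fun y => y `^ (r + 1))).
    by near=> y; rewrite gtr0_norm//; near: y; exact: lt_nbhsr.
  apply: (is_derive_eq (is_derive1_powR (r + 1) x0)).
  rewrite addrK /spow gtr0_norm//; congr (_ * _).
  have {1}-> : r = r - 1 + 1 by ring.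
  have nx : x != 0 by rewrite gt_eqF.
  by rewrite (@powRD _ x (r - 1) 1) ?nx ?implybT// powRr1 ?ltW.
- rewrite spow0 mulr0.
  (* At 0 the difference quotient is [spow r h] itself, which tends to 0. *)
  have hl : h^-1 *: (((fun y : R => `|y| `^ (r + 1)) \o shift (0 : R)) (h *: (1 : R)) - `|0 : R| `^ (r + 1)) @[h --> (0 : R)^'] --> (0 : R).
    apply: (@cvg_trans _ (spow r h @[h --> (0 : R)^'])).
      apply: near_eq_cvg; near=> h => /=.
      rewrite addr0 [h%:A]mulr1 !powR_norm_spow// mulr0 subr0 [_ *: _]mulrCA mulVf ?mulr1//.
      by near: h; exact: nbhs_dnbhs_neq.
    have := @continuous_spow r r1 0; rewrite /continuous_at spow0 => c0.
    by apply: cvg_trans c0; apply: cvg_app; exact: cvg_within.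
  by apply: DeriveDef; [apply/cvg_ex; exists 0|exact/cvg_lim].
Unshelve. all: by end_near. Qed.

End signed_power.

Section difference_quotients.
Context {R : realType}.

(** Dominated convergence for a real parameter: the limit is tested along sequences of nonzero h
    tending to 0, shifted by [N] so that every term lies in the range where the domination holds. *)
Lemma rint_cvg n (K : R -> 'rV[R]_n -> R) (K0 G : 'rV[R]_n -> R) (d : R) :
  0 < d -> (forall h, 0 < `|h| < d -> rmeasurable (K h)) -> rmeasurable K0 ->
  (forall h x, 0 < `|h| < d -> `|K h x| <= G x) -> rintegrable G ->
  (forall x, K h x @[h --> 0^'] --> K0 x) ->
  rint (K h) @[h --> 0^'] --> rint K0.
Proof.
move=> d0 mK mK0 KG iG cK; apply/cvgr_dnbhsP => u [u0 cu].
have [N _ hN] := (cvgrPdist_lt _ _).1 cu _ d0.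
have uN m : 0 < `|u (m + N)%N| < d.
  rewrite normr_gt0 u0 /=; have := hN (m + N)%N (leq_addl _ _).
  by rewrite sub0r normrN.
rewrite -(cvg_shiftn N).
pose mu := lebesgue_tuple R n.
pose f_ m (t : n.-tuple (measurableTypeR R)) := (K (u (m + N)%N) (tuple_row t))%:E.
pose f (t : n.-tuple (measurableTypeR R)) := (K0 (tuple_row t))%:E.
have mf_ m : measurable_fun setT (f_ m).
  by apply/measurable_EFinP; exact: mK.
have mf : measurable_fun setT f by apply/measurable_EFinP.
have ff : {ae mu, forall t, setT t -> f_ ^~ t @ \oo --> f t}.
  apply: aeW => t _; apply: cvg_EFin; first exact: nearW.
  have /cvgr_dnbhsP/(_ (fun m => u (m + N)%N)) := cK (tuple_row t).
  by apply; split => //; rewrite (cvg_shiftn N).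
have fg : {ae mu, forall t m, setT t -> (`|f_ m t| <= (G (tuple_row t))%:E)%E}.
  by apply: aeW => t m _; rewrite lee_fin; exact: KG.
have [i0 _ c0] := dominated_convergence measurableT mf_ mf ff iG fg.
apply: fine_cvg; rewrite fineK//; exact: integrable_fin_num.
Qed.

Lemma difference_quotient_bounded n (A : set 'rV[R]_n) (f f' : R -> 'rV[R]_n -> R) (t : R) :
  0 < t -> (forall (s : R) x, 0 < s -> A x -> is_derive s 1 (f ^~ x) (f' s x)) ->
  (forall (s : R) x, 0 < s -> {for (s, x), continuous (fun z => f' z.1 z.2)}) ->
  exists C, 0 <= C /\ forall (h : R) x, `|h| < t / 2 -> A x -> enorm x <= 1 ->
    `|h^-1 * (f (t + h) x - f t x)| <= C.
Proof.
move=> t0 df cf'.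
(* For |h| < t / 2 the times t + h stay in [t / 2, 3 t / 2], away from 0; by the mean value theorem
   a bound of f' on this compact range bounds all the quotients. *)
have [|C [C0 hC]] := @continuous_cube_bounded R n (fun z => f' z.1 z.2) (t / 2) (t + t / 2) 1.
  by move=> s x /andP[s0 _]; apply: cf'; lra.
exists C; split => // h x ht Ax x1.
have cfx s : 0 < s -> {for s, continuous (f ^~ x)}.
  move=> s0; have [ds _] := df s x s0 Ax.
  by apply: differentiable_continuous; exact/derivable1_diffP.
move: ht; rewrite ltr_norml => /andP[h1 h2].
have mvt a b : 0 < a -> a < b -> t / 2 <= a -> b <= t + t / 2 ->
    `|f b x - f a x| <= C * (b - a).
  move=> a0 ab ta bt.
  have [| |s] := @MVT R (f ^~ x) (f' ^~ x) a b ab.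
  - by move=> s; rewrite in_itv /= => /andP[sa sb]; apply: df => //; lra.
  - apply: continuous_in_subspaceT => s; rewrite inE /= in_itv /= => /andP[sa sb].
    by apply: cfx; lra.
  rewrite in_itv /= => /andP[sa sb] ->; rewrite normrM ler_pM//.
    by apply: (hC s x) => //; apply/andP; lra.
  by rewrite gtr0_norm ?subr_gt0.
have [h0|h0|->] := ltgtP h 0; last by rewrite invr0 mul0r normr0.
- rewrite normrM normfV ler_pdivrMl ?normr_gt0 ?lt_eqF// distrC.
  have := mvt (t + h) t; rewrite (ltr0_norm h0).
  have -> : t - (t + h) = - h by ring.
  rewrite [- h * C]mulrC; apply; lra.
- rewrite normrM normfV ler_pdivrMl ?normr_gt0 ?gt_eqF//.
  have := mvt t (t + h); rewrite (gtr0_norm h0).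
  have -> : t + h - t = h by ring.
  rewrite [h * C]mulrC; apply; lra.
Qed.

Lemma is_derive_quotient (f : R -> R) (t d : R) : is_derive t 1 f d ->
  h^-1 * (f (t + h) - f t) @[h --> 0^'] --> d.
Proof.
move=> [df <-]; have := df; rewrite /derivable => /cvg_ex[l hl].
rewrite /derive (cvg_lim _ hl)//; apply: cvg_trans hl; apply: near_eq_cvg.
by near=> h; rewrite /= [h%:A]mulr1 [h + t]addrC.
Unshelve. all: by end_near. Qed.

Lemma quotient_is_derive (f : R -> R) (t d : R) :
  h^-1 * (f (t + h) - f t) @[h --> 0^'] --> d -> is_derive t 1 f d.
Proof.
move=> hd; have h : h^-1 *: ((f \o shift t) (h *: 1) - f t) @[h --> (0 : R)^'] --> d.
  apply: cvg_trans hd; apply: near_eq_cvg.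
  by near=> h; rewrite /= [h%:A]mulr1 [h + t]addrC.
by apply: DeriveDef; [apply/cvg_ex; exists d|exact/cvg_lim].
Unshelve. all: by end_near. Qed.

End difference_quotients.

(** * Directional and radial derivatives *)

Section directional.
Context {R : realType}.

(** Parametrising the segment by s in [0, 1] treats both signs of b, and b = 0, at once. *)
Lemma mvt_line (V : normedModType R) (f P : V -> R) (x e : V) (b : R) :
  (forall s : R, 0 <= s <= 1 -> is_derive (x + (s * b) *: e) e f (P (x + (s * b) *: e))) ->
  exists s : R, 0 <= s <= 1 /\ f (x + b *: e) - f x = b * P (x + (s * b) *: e).
Proof.
move=> df; pose g s := f (x + (s * b) *: e).
have dg (s : R) : 0 <= s <= 1 -> is_derive s 1 g (P (x + (s * b) *: e) * b).
  move=> /df d.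
  have d1 : is_derive (s * b) 1 (fun r => f (x + r *: e)) (P (x + (s * b) *: e)).
    apply: (@is_derive_line R V f (fun r => x + r *: e) (s * b) e _ _).2 => // h.
    by rewrite scalerDl addrCA.
  have d2 : is_derive s 1 (fun s : R => s * b) b.
    have -> : (fun s : R => s * b) = b \*: id by apply/funext => r /=; rewrite mulrC.
    by apply: is_derive_eq; rewrite /GRing.scale /= mulr1.
  exact: (is_derive1_comp (f := fun r => f (x + r *: e)) (g := fun s : R => s * b) d1 d2).
have [| |s] := @MVT R g (fun s => P (x + (s * b) *: e) * b) 0 1 ltr01.
- by move=> s; rewrite in_itv /= => /andP[h1 h2]; apply: dg; rewrite !ltW.
- apply: continuous_in_subspaceT => s; rewrite inE /= in_itv /= => /dg.
  exact: is_derive1_continuous.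
rewrite in_itv /= => /andP[h1 h2]; rewrite /g mul1r mul0r scale0r addr0 subr0 mulr1 => e1.
by exists s; rewrite !ltW// e1 mulrC.
Qed.

(** Move first along v, then along e. The second move contributes h c P at an intermediate point,
    which tends to x, and P is continuous there. Adding one coordinate direction at a time,
    [is_derive_row] obtains every directional derivative from continuous partial derivatives. *)
Lemma is_derive_add_dir (V : normedModType R) (f P : V -> R) (x v e : V) (c d : R) :
  (\forall y \near x, is_derive y e f (P y)) -> {for x, continuous P} ->
  is_derive x v f d -> is_derive x (c *: e + v) f (c * P x + d).
Proof.
move=> df cP dv.
have q1 : h^-1 * (f (h *: (c *: e + v) + x) - f (h *: v + x)) @[h --> (0:R)^'] --> c * P x.
  apply/cvgrPdist_le => eps e0.
  have c1 : 0 < `|c| + 1 by rewrite ltr_wpDl.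
  have /nbhs_ballP[r /= r0 hr] : \forall y \near x, is_derive y e f (P y) /\ `|P x - P y| < eps / (`|c| + 1).
    near=> y; split; near: y => //.
    by apply: (cvgrPdist_lt _ _).1 cP _ _; rewrite divr_gt0.
  (* |h| M bounds the distance to x of every point used; the 1 keeps M positive, just as the one in
     |c| + 1 allows c = 0. *)
  pose M := `|c| * `|e| + `|v| + 1.
  have M0 : 0 < M by rewrite ltr_wpDl// addr_ge0// mulr_ge0.
  near=> h.
  have hM : `|h| * M < r.
    rewrite -ltr_pdivlMr//; near: h; apply: dnbhs0_lt; exact: divr_gt0.
  have h0 : h != 0 by near: h; exact: nbhs_dnbhs_neq.
  have inb (s : R) : 0 <= s <= 1 -> ball x r (h *: v + x + (s * (h * c)) *: e).
    move=> /andP[s0 s1]; rewrite -ball_normE /ball_ /=.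
    rewrite distrC addrAC addrK.
    apply: le_lt_trans hM; apply: (le_trans (ler_normD _ _)).
    rewrite !normrZ (ger0_norm s0) /M !mulrDr mulr1.
    have : s * (`|h| * `|c|) * `|e| <= `|h| * (`|c| * `|e|).
      by rewrite [leRHS]mulrA -[leRHS]mul1r -!mulrA ler_wpM2r// !mulr_ge0.
    have := normr_ge0 h; lra.
  have [s [s1 es]] := mvt_line (f := f) (P := P) (fun s s1 => (hr _ (inb s s1)).1).
  have -> : h *: (c *: e + v) + x = h *: v + x + (h * c) *: e.
    by rewrite scalerDr scalerA -addrA addrC.
  rewrite es -[h * c * _]mulrA mulKf// -mulrBr normrM.
  have := (hr _ (inb s s1)).2.
  set D := `|P x - _|; move=> Dl.
  have : `|c| * D <= `|c| * (eps / (`|c| + 1)) by rewrite ler_wpM2l// ltW.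
  move=> h1; apply: (le_trans h1); rewrite mulrA ler_pdivrMr// mulrC ler_wpM2l ?ltW//.
  by rewrite ltrDl.
have [dv1 dv2] := dv.
have q2 : h^-1 * (f (h *: v + x) - f x) @[h --> (0:R)^'] --> d.
  by have /cvg_ex[l hl] := dv1; rewrite -dv2 /derive (cvg_lim _ hl).
have q3 : h^-1 *: ((f \o shift x) (h *: (c *: e + v)) - f x) @[h --> (0:R)^'] --> c * P x + d.
  apply: cvg_trans (cvgD q1 q2); apply: near_eq_cvg; near=> h => /=.
  by rewrite -mulrDr; congr (_ * _); rewrite addrA subrK.
by apply: DeriveDef; [apply/cvg_ex; exists (c * P x + d)|exact/cvg_lim].
Unshelve. all: by end_near. Qed.

Lemma is_derive_row n (f : 'rV[R]_n -> R) (P : 'I_n -> 'rV[R]_n -> R) (x v : 'rV[R]_n) :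
  (forall i, \forall y \near x, is_derive y (delta_mx 0 i) f (P i y)) ->
  (forall i, {for x, continuous (P i)}) ->
  is_derive x v f (\sum_i v 0 i * P i x).
Proof.
move=> df cP; rewrite [X in is_derive _ X](row_sum_delta v).
elim: (index_enum _) => [|i r IH]; first by rewrite !big_nil; exact: is_derive0.
by rewrite !big_cons; apply: is_derive_add_dir.
Qed.

End directional.

(** * Functions of class C^2 up to the flat boundary *)

Section fields.
Context {R : realType} {n : nat}.
Implicit Types (x : 'rV[R]_n.+1).

Definition closed_half : set 'rV[R]_n.+1 := [set x | 0 <= x 0 ord_max].

Definition clamp x : 'rV[R]_n.+1 :=
  \row_i (if i == ord_max then Num.max (x 0 i) 0 else x 0 i).

Lemma continuous_clamp : continuous clamp.
Proof.
apply: continuous_row => i; under eq_fun do rewrite mxE.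
case: (i == ord_max) => x; last exact: coord_continuous.
by apply: continuous_max; [exact: coord_continuous|exact: cst_continuous].
Qed.

Lemma clamp_id x : closed_half x -> clamp x = x.
Proof.
move=> x0; apply/rowP => i; rewrite mxE; case: eqP => // ->.
by rewrite max_l.
Qed.

Lemma half_closed x : half_space x -> closed_half x.
Proof. exact: ltW. Qed.

Lemma shift_half x (e : R) : closed_half x -> 0 < e ->
  half_space (x + e *: delta_mx 0 ord_max).
Proof. by move=> x0 e0; rewrite /half_space /= !mxE !eqxx mulr1 ltr_wpDl. Qed.

Lemma cvg_shift x :
  x + e *: delta_mx 0 ord_max @[e --> (0 : R)] --> x.
Proof.
rewrite -[X in _ --> X]addr0 -(scale0r (delta_mx 0 ord_max)).
apply: cvgD; first exact: cvg_cst.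
by apply: cvgZr_tmp; exact: cvg_id.
Qed.

Lemma closed_half_closure x : closed_half x -> closure (@half_space R n) x.
Proof.
move=> x0 B /cvg_shift hB.
have /filter_ex[e [e0 Be]] : \forall e \near (0:R)^'+, 0 < e /\ B (x + e *: delta_mx 0 ord_max).
  near=> e; split; near: e; first exact: nbhs_right_gt.
  by apply: cvg_within; exact: hB.
by exists (x + e *: delta_mx 0 ord_max); split => //; exact: shift_half.
Unshelve. all: by end_near. Qed.

Lemma clamp_closed x : closed_half (clamp x).
Proof. by rewrite /closed_half /= mxE eqxx le_max lexx orbT. Qed.

Lemma within_continuous_clamp (g : 'rV[R]_n.+1 -> R) :
  {within closure (@half_space R n), continuous g} -> continuous (g \o clamp).
Proof.
move=> /subspace_continuousP cg x.
have Ax := closed_half_closure (clamp_closed x).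
move=> B /(cg _ Ax) hB.
have h : \forall y \near x, closure (@half_space R n) (clamp y) -> B (g (clamp y)).
  exact: (@continuous_clamp x _ hB).
suff : \forall y \near x, B (g (clamp y)) by [].
apply: filterS h => y /= h; apply: h.
exact/closed_half_closure/clamp_closed.
Qed.

(* [P i] and [Q i] are the first and the pure second derivatives of [U] along
   e_i, but only in the open half-space; all these functions are continuous on
   the whole space. *)
Definition C2_field (U : 'rV[R]_n.+1 -> R) (P Q : 'I_n.+1 -> 'rV[R]_n.+1 -> R) : Prop :=
  [/\ continuous U, forall i, continuous (P i), forall i, continuous (Q i) &
    forall i x, half_space x ->
      is_derive x (delta_mx 0 i) U (P i x) /\
      is_derive x (delta_mx 0 i) (P i) (Q i x)].

Lemma near_half_space x : half_space x -> \forall y \near x, half_space y.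
Proof. by move=> hx; apply: open_nbhs_nbhs; split => //; exact: open_half_space. Qed.

Lemma C2_closure_field (u : 'rV[R]_n.+1 -> R) : C2_closure (@half_space R n) u ->
  exists P Q, C2_field (u \o clamp) P Q /\
    forall i x, half_space x -> is_derive x (delta_mx 0 i) u (P i x) /\
      partial i (partial i u) x = Q i x.
Proof.
move=> [cu h1 h2].
have /choice[P hP] : forall i, exists g : 'rV[R]_n.+1 -> R, continuous g /\
    forall x, half_space x -> partial i u x = g x.
  move=> i; have [_ [g [cg gE]]] := h1 i; exists (g \o clamp); split.
    exact: within_continuous_clamp.
  by move=> x hx; rewrite gE//= clamp_id//; exact: half_closed.
have /choice[Q hQ] : forall i, exists g : 'rV[R]_n.+1 -> R, continuous g /\
    forall x, half_space x -> partial i (partial i u) x = g x.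
  move=> i; have [_ [g [cg gE]]] := h2 i i; exists (g \o clamp); split.
    exact: within_continuous_clamp.
  by move=> x hx; rewrite gE//= clamp_id//; exact: half_closed.
have dU i x : half_space x -> is_derive x (delta_mx 0 i) u (P i x).
  by move=> hx; rewrite -(hP i).2//; apply: derivableP; exact: (h1 i).1.
exists P, Q; split; last first.
  by move=> i x hx; split; [exact: dU|exact: (hQ i).2].
split => [|i|i|i x hx].
- exact: within_continuous_clamp.
- exact: (hP i).1.
- exact: (hQ i).1.
- split.
    apply: near_eq_is_derive (dU i x hx).
    near=> y; rewrite /= clamp_id//; apply: half_closed; near: y.
    exact: near_half_space.
  apply: (@near_eq_is_derive _ _ _ (partial i u)).
    by near=> y; rewrite (hP i).2//; near: y; exact: near_half_space.
  by rewrite -(hQ i).2//; apply: derivableP; exact: (h2 i i).1.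
Unshelve. all: by end_near. Qed.

Lemma half_scale x (t : R) : 0 < t -> half_space x -> half_space (t *: x).
Proof. by move=> t0 hx; rewrite /half_space /= mxE mulr_gt0. Qed.

Lemma closed_half_scale x (t : R) : 0 < t -> closed_half x -> closed_half (t *: x).
Proof. by move=> t0 hx; rewrite /closed_half /= mxE mulr_ge0// ltW. Qed.

(** Only the derivative along v is given, so the chain rule is applied on the line through t x with
    direction v, where the dilation acts as r -> t r. *)
Lemma is_derive_dilation (f : 'rV[R]_n.+1 -> R) x v (t d : R) :
  is_derive (t *: x) v f d -> is_derive x v (fun y => f (t *: y)) (t * d).
Proof.
move=> h.
have h1 : is_derive (t * 0) 1 (fun r : R => f (t *: x + r *: v)) d.
  apply: (@is_derive_line R _ f (fun r => t *: x + r *: v) (t * 0) v d _).2 => [r|].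
    by rewrite scalerDl addrCA.
  by rewrite mulr0 scale0r addr0.
have h2 : is_derive (0 : R) 1 (fun s : R => t * s) t.
  have -> : (fun s : R => t * s) = t \*: id by [].
  by apply: is_derive_eq; rewrite /GRing.scale /= mulr1.
have h3 := is_derive1_comp (f := fun r : R => f (t *: x + r *: v)) (g := fun s : R => t * s) h1 h2.
rewrite -[x]addr0 -(scale0r v) mulrC.
apply: (@is_derive_line R _ (fun y => f (t *: y)) (fun r => x + r *: v) 0 v (d * t) _).1 => [r|].
  by rewrite scalerDl addrCA.
rewrite (_ : _ \o _ = (fun r : R => f (t *: x + r *: v)) \o (fun s : R => t * s))//.
by apply/funext => s /=; rewrite scalerDr scalerA.
Qed.

Lemma C2_field_dilation U P Q (k t : R) : 0 < t -> C2_field U P Q ->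
  C2_field (fun x => k * U (t *: x)) (fun i x => k * t * P i (t *: x))
    (fun i x => k * t ^+ 2 * Q i (t *: x)).
Proof.
move=> t0 [cU cP cQ dU].
have cs (f : 'rV[R]_n.+1 -> R) c : continuous f -> continuous (fun x => c * f (t *: x)).
  move=> cf x; apply: continuousM; first exact: cst_continuous.
  apply: continuous_comp; last exact: cf.
  exact: scaler_continuous.
split => [|i|i|i x hx]; [exact: cs|exact: cs|exact: cs|].
have [d1 d2] := dU i _ (half_scale t0 hx).
have e1 := is_derive_dilation d1; have e2 := is_derive_dilation d2.
split.
  by rewrite -mulrA; apply: is_deriveZ.
rewrite (_ : k * t ^+ 2 * _ = k * t * (t * Q i (t *: x))); last by ring.
exact: is_deriveZ.
Qed.

Lemma C2_field_comb U1 P1 Q1 U2 P2 Q2 (a b : R) :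
  C2_field U1 P1 Q1 -> C2_field U2 P2 Q2 ->
  C2_field (fun x => a * U1 x + b * U2 x) (fun i x => a * P1 i x + b * P2 i x)
    (fun i x => a * Q1 i x + b * Q2 i x).
Proof.
move=> [cU1 cP1 cQ1 dU1] [cU2 cP2 cQ2 dU2].
have cs (f g : 'rV[R]_n.+1 -> R) : continuous f -> continuous g ->
    continuous (fun x => a * f x + b * g x).
  move=> cf cg x; apply: (@continuousD _ _ _ (fun x => a * f x) (fun x => b * g x)).
    by apply: continuousM; [exact: cst_continuous|exact: cf].
  by apply: continuousM; [exact: cst_continuous|exact: cg].
split => [|i|i|i x hx]; [exact: cs|exact: cs|exact: cs|].
have [d1 d2] := dU1 i _ hx; have [e1 e2] := dU2 i _ hx.
by split; apply: is_deriveD; apply: is_deriveZ.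
Qed.

End fields.

Section radial.
Context {R : realType} {n : nat}.
Implicit Types (x : 'rV[R]_n.+1).

Lemma continuous_dilation (f : 'rV[R]_n.+1 -> R) :
  continuous f -> continuous (fun z : R * 'rV[R]_n.+1 => f (z.1 *: z.2)).
Proof.
move=> cf z; apply: continuous_comp; last exact: cf.
exact: scale_continuous.
Qed.

Lemma continuous_radial (P : 'I_n.+1 -> 'rV[R]_n.+1 -> R) :
  (forall i, continuous (P i)) ->
  continuous (fun z : R * 'rV[R]_n.+1 => \sum_i z.2 0 i * P i (z.1 *: z.2)).
Proof.
move=> cP z; apply: (@cvg_sumr _ _ (nbhs z)) => i.
apply: (@continuousM _ _ (fun z : R * 'rV[R]_n.+1 => z.2 0 i)).
  apply: (@continuous_comp _ _ _ snd (fun y : 'rV[R]_n.+1 => y 0 i)); first exact: cvg_snd.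
  exact: coord_continuous.
exact: continuous_dilation.
Qed.

Lemma radial_derive_open U P Q x (t : R) : C2_field U P Q -> half_space x -> 0 < t ->
  is_derive t 1 (fun s => U (s *: x)) (\sum_i x 0 i * P i (t *: x)).
Proof.
move=> [cU cP cQ dU] hx t0.
apply: (@is_derive_line R _ U (fun s => s *: x) t x _ _).2 => [h|].
  by rewrite scalerDl.
apply: is_derive_row => [i|i]; last exact: cP.
near=> y; apply: (dU i y _).1; near: y.
exact/near_half_space/half_scale.
Unshelve. all: by end_near. Qed.

(* On the flat boundary [U] is not differentiable in the sense of [C2_field]:
   move [x] inside by [e * e_N], apply the mean value theorem, let [e] tend to
   [0]. *)
Lemma radial_derive U P Q x (t : R) : C2_field U P Q -> closed_half x -> 0 < t ->
  is_derive t 1 (fun s => U (s *: x)) (\sum_i x 0 i * P i (t *: x)).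
Proof.
move=> fU hx t0; have [cU cP cQ dU] := fU; apply: quotient_is_derive.
pose S (z : R * 'rV[R]_n.+1) := \sum_i z.2 0 i * P i (z.1 *: z.2).
have cS : {for (t, x), continuous S} by exact: continuous_radial.
apply/cvgrPdist_le => eps e0.
(* The smallness of h comes from the joint continuity of [S] alone, before e is chosen. With h
   fixed, the bound eps then holds for all small e > 0 and survives e -> 0. *)
have [[A B] [/= nA nB] AB] := (cvgrPdist_lt _ _).1 cS _ e0.
have /nbhs_ballP[r /= r0 hr] := nA.
near=> h.
have h0 : h != 0 by near: h; exact: nbhs_dnbhs_neq.
have hr' : `|h| < r by near: h; exact: dnbhs0_lt.
have ht : `|h| < t by near: h; exact: dnbhs0_lt.
pose xe e := x + e *: delta_mx 0 ord_max.
pose D e := `|S (t, x) - h^-1 * (U ((t + h) *: xe e) - U (t *: xe e))|.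
have cD : D e @[e --> (0:R)] --> D 0.
  have cxe s : {for (0 : R), continuous (fun e => U (s *: xe e))}.
    apply: (@continuous_comp _ _ _ (fun e => s *: xe e) U); last exact: cU.
    apply: cvgZl_tmp.
    by have := @cvg_shift R n x; rewrite /continuous_at /xe scale0r addr0.
  apply: cvg_norm; apply: cvgB; first exact: cvg_cst.
  by apply: cvgMr; apply: cvgB; exact: cxe.
have De : \forall e \near (0:R)^'+, D e <= eps.
  have Bx : \forall e \near (0:R)^'+, B (xe e) by apply: cvg_within; exact: cvg_shift nB.
  near=> e.
  have e1 : 0 < e by near: e; exact: nbhs_right_gt.
  have hxe : half_space (xe e) by exact: shift_half.
  have [|s [/andP[s0 s1] es]] := @mvt_line R R (fun s => U (s *: xe e)) (fun s => S (s, xe e)) t 1 h.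
    move=> s /andP[s0 s1]; rewrite [_ *: 1]mulr1; apply: (radial_derive_open fU) => //.
    move: ht; rewrite ltr_norml => /andP[h1 h2].
    have [h3|h3] := leP 0 h; first by rewrite ltr_wpDr// mulr_ge0.
    by nra.
  rewrite /D; move: es; rewrite ![_ *: 1]mulr1 => ->; rewrite mulKf//.
  apply: ltW; apply: (AB (t + s * h, xe e)); split => /=; last by near: e.
  apply: hr; rewrite -ball_normE /ball_ /= opprD addNKr normrN normrM ger0_norm//.
  by rewrite (le_lt_trans _ hr')// ler_piMl.
rewrite -[X in X <= _]/(`|S (t, x) - h^-1 * (U ((t + h) *: x) - U (t *: x))|).
have -> : `|S (t, x) - h^-1 * (U ((t + h) *: x) - U (t *: x))| = D 0.
  by rewrite /D /xe scale0r addr0.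
rewrite leNgt; apply/negP => lt.
have De' : \forall e \near (0:R)^'+, eps < D e.
  by apply: cvg_within; apply: (cvgr_gt _ cD).
have /filter_ex[e [h2 h3]] : \forall e \near (0:R)^'+, D e <= eps /\ eps < D e.
  by near=> e; split; near: e.
by move: h2; rewrite leNgt h3.
Unshelve. all: by end_near. Qed.

End radial.

(** * Variation of the energy *)

Section energy_difference.
Context {R : realType} {n : nat}.

Lemma dirichlet_difference (V1 V2 : 'rV[R]_n.+2 -> R) P1 Q1 P2 Q2 :
  C2_field V1 P1 Q1 -> C2_field V2 P2 Q2 ->
  let w x := V2 x - V1 x in
  rint ((fun x => 2^-1 * (\sum_i P2 i x ^+ 2) - 2^-1 * (\sum_i P1 i x ^+ 2))
     \_ (@half_ball R n.+1)) =
  hemisphere_integral (fun x => w x * \sum_i (2^-1 * (P1 i x + P2 i x)) * x 0 i)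
  - rint ((fun y => w (row_snoc y 0) *
       (2^-1 * (P1 ord_max (row_snoc y 0) + P2 ord_max (row_snoc y 0)))) \_ (@unit_ball R n.+1))
  - rint ((fun x => w x * \sum_i (2^-1 * (Q1 i x + Q2 i x))) \_ (@half_ball R n.+1)).
Proof.
move=> f1 f2 w.
have fw := C2_field_comb 1 (-1) f2 f1.
have fM := C2_field_comb 2^-1 2^-1 f1 f2.
have [cw cwP cwQ dw] := fw; have [cM cMP cMQ dM] := fM.
set wf := (fun x => 1 * V2 x + -1 * V1 x) in cw dw.
set wP := (fun i x => 1 * P2 i x + -1 * P1 i x) in cwP dw.
set MP := (fun i x => 2^-1 * P1 i x + 2^-1 * P2 i x) in cMP dM.
set MQ := (fun i x => 2^-1 * Q1 i x + 2^-1 * Q2 i x) in cMQ dM.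
(* The field w grad(M), with divergence w Laplace(M) + grad(M) . grad(w). *)
pose F i x := wf x * MP i x.
pose F' i x := wf x * MQ i x + MP i x * wP i x.
have cF i : continuous (F i).
  by move=> x; apply: continuousM; [exact: cw|exact: cMP].
have cF' i : continuous (F' i).
  move=> x; apply: (@continuousD _ _ _ (fun x => wf x * MQ i x) (fun x => MP i x * wP i x)).
    by apply: continuousM; [exact: cw|exact: cMQ].
  by apply: continuousM; [exact: cMP|exact: cwP].
have dF i x : half_space x -> is_derive x (delta_mx 0 i) (F i) (F' i x).
  move=> hx; have d1 := (dw i x hx).1; have d2 := (dM i x hx).2.
  exact: is_deriveM.
have := divergence_half_ball cF cF' dF.
have wE x : wf x = w x by rewrite /wf mul1r mulN1r.
have MPE i x : MP i x = 2^-1 * (P1 i x + P2 i x) by rewrite /MP mulrDr.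
have MQE i x : MQ i x = 2^-1 * (Q1 i x + Q2 i x) by rewrite /MQ mulrDr.
have -> : (fun x => \sum_i F' i x) \_ (@half_ball R n.+1) =
    fun x => ((fun x => w x * \sum_i (2^-1 * (Q1 i x + Q2 i x))) \_ (@half_ball R n.+1)) x
    + ((fun x => 2^-1 * (\sum_i P2 i x ^+ 2) - 2^-1 * (\sum_i P1 i x ^+ 2))
     \_ (@half_ball R n.+1)) x.
  apply/funext => x; rewrite !patchE; case: ifP => _; last by rewrite addr0.
  rewrite -mulrBr -sumrB mulr_sumr mulr_sumr -big_split /=; apply: eq_bigr => i _.
  by rewrite /F' wE MQE MPE /wP; ring.
rewrite rintD; first last.
- apply: rintegrable_ball; [exact: open_half_ball|by move=> x []|].
  have [_ c1 _ _] := f1; have [_ c2 _ _] := f2.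
  have cs (P : 'I_n.+2 -> 'rV[R]_n.+2 -> R) : (forall i, continuous (P i)) ->
      continuous (fun x => 2^-1 * \sum_i P i x ^+ 2).
    move=> cP x; apply: (@continuousM _ _ (fun=> 2^-1) (fun x => \sum_i P i x ^+ 2)); first exact: cst_continuous.
    by apply: (@cvg_sumr _ _ (nbhs x)) => i; apply: (@continuousM _ _ (P i) (P i)); exact: cP.
  move=> x; apply: (@continuousB _ _ _ (fun x => 2^-1 * \sum_i P2 i x ^+ 2)); exact: cs.
- apply: rintegrable_ball; [exact: open_half_ball|by move=> x []|].
  have -> : (fun x => w x * \sum_i (2^-1 * (Q1 i x + Q2 i x))) =
      (fun x => wf x * \sum_i MQ i x).
    apply/funext => x; rewrite wE; congr (_ * _).
    by apply: eq_bigr => i _; rewrite MQE.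
  move=> x; apply: (@continuousM _ _ wf (fun x => \sum_i MQ i x)); first exact: cw.
  by apply: (@cvg_sumr _ _ (nbhs x)) => i; exact: cMQ.
have -> : (fun x => \sum_i F i x * x 0 i) =
    (fun x => w x * \sum_i (2^-1 * (P1 i x + P2 i x)) * x 0 i).
  apply/funext => x; rewrite mulr_sumr; apply: eq_bigr => i _.
  by rewrite /F wE MPE !mulrA.
have -> : (fun y : 'rV[R]_n.+1 => F ord_max (row_snoc y 0)) = (fun y => w (row_snoc y 0) *
       (2^-1 * (P1 ord_max (row_snoc y 0) + P2 ord_max (row_snoc y 0)))).
  by apply/funext => y; rewrite /F wE MPE.
by move=> <-; rewrite addrC addKr.
Qed.

End energy_difference.

(** * Joint continuity in the scale and the point *)

Section joint_continuity.
Context {R : realType} {n : nat}.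
Implicit Types (f g : R -> 'rV[R]_n.+1 -> R).

(** Only s > 0 is considered, where the powers of s are continuous. Continuity is joint so that
    compactness bounds difference quotients uniformly in x. *)
Definition jcontinuous f := forall (s : R) x, 0 < s ->
  {for (s, x), continuous (fun z : R * 'rV[R]_n.+1 => f z.1 z.2)}.

Lemma jcontinuousD f g : jcontinuous f -> jcontinuous g ->
  jcontinuous (fun s x => f s x + g s x).
Proof.
move=> cf cg s x s0.
by apply: (@continuousD _ _ _ (fun z => f z.1 z.2) (fun z => g z.1 z.2)); [exact: cf|exact: cg].
Qed.

Lemma jcontinuousM f g : jcontinuous f -> jcontinuous g ->
  jcontinuous (fun s x => f s x * g s x).
Proof.
move=> cf cg s x s0.
by apply: (@continuousM _ _ (fun z => f z.1 z.2) (fun z => g z.1 z.2)); [exact: cf|exact: cg].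
Qed.

Lemma jcontinuous_cst (c : R) : jcontinuous (fun _ _ => c).
Proof. by move=> s x s0; exact: cst_continuous. Qed.

Lemma jcontinuousN f : jcontinuous f -> jcontinuous (fun s x => - f s x).
Proof.
by move=> cf s x s0; apply: (@continuousN _ _ _ (fun z => f z.1 z.2)); exact: cf.
Qed.

Lemma jcontinuousX f k : jcontinuous f -> jcontinuous (fun s x => f s x ^+ k).
Proof.
move=> cf; elim: k => [|k IH]; first by under eq_fun do under eq_fun do rewrite expr0; exact: jcontinuous_cst.
rewrite (_ : (fun s x => _) = fun s x => f s x * f s x ^+ k); first exact: jcontinuousM.
by apply/funext => s; apply/funext => x; rewrite exprS.
Qed.

Lemma jcontinuous_sum m (f : 'I_m -> R -> 'rV[R]_n.+1 -> R) :
  (forall i, jcontinuous (f i)) -> jcontinuous (fun s x => \sum_i f i s x).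
Proof.
by move=> cf s x s0; apply: (@cvg_sumr _ _ (nbhs (s, x))) => i; exact: cf.
Qed.

Lemma jcontinuous_time (phi : R -> R) :
  (forall s, 0 < s -> {for s, continuous phi}) -> jcontinuous (fun s _ => phi s).
Proof.
move=> cphi s x s0; apply: (@continuous_comp _ _ _ fst phi); first exact: cvg_fst.
exact: cphi.
Qed.

Lemma jcontinuous_space (F : 'rV[R]_n.+1 -> R) : continuous F -> jcontinuous (fun _ x => F x).
Proof.
move=> cF s x s0; apply: (@continuous_comp _ _ _ snd F); first exact: cvg_snd.
exact: cF.
Qed.

Lemma jcontinuous_comp (phi : R -> R) f : continuous phi -> jcontinuous f ->
  jcontinuous (fun s x => phi (f s x)).
Proof.
move=> cphi cf s x s0.
apply: (@continuous_comp _ _ _ (fun z : R * 'rV[R]_n.+1 => f z.1 z.2) phi).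
  exact: cf.
exact: cphi.
Qed.

Lemma jcontinuous_dilation (F : 'rV[R]_n.+1 -> R) : continuous F ->
  jcontinuous (fun s x => F (s *: x)).
Proof. by move=> cF s x _; exact: continuous_dilation. Qed.

Lemma jcontinuous_powR r : jcontinuous (fun s _ => s `^ r).
Proof. by apply: jcontinuous_time => s; exact: continuous_powR. Qed.

Lemma jcontinuous_id : jcontinuous (fun s _ => s).
Proof. by apply: (jcontinuous_time (phi := id)) => s _; exact: cvg_id. Qed.

Lemma jcontinuous_slice f s : jcontinuous f -> 0 < s -> continuous (f s).
Proof.
move=> cf s0 x.
apply: (@continuous_comp _ _ _ (fun y : 'rV[R]_n.+1 => (s, y)) (fun z => f z.1 z.2)); last exact: cf.
by apply: (@cvg_pair _ _ _ (nbhs x) (nbhs s) (nbhs x)); [exact: cvg_cst|exact: cvg_id].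
Qed.

Lemma jcontinuous_cvg f t x : jcontinuous f -> 0 < t ->
  f (t + h) x @[h --> (0 : R)^'] --> f t x.
Proof.
move=> cf t0; apply: cvg_within_filter.
suff : {for (0 : R), continuous (fun h => f (t + h) x)}.
  by rewrite /prop_for /continuous_at addr0.
apply: (@continuous_comp _ _ _ (fun h : R => (t + h, x)) (fun z => f z.1 z.2)).
  apply: (@cvg_pair _ _ _ (nbhs (0:R)) (nbhs (t + 0)) (nbhs x)); last exact: cvg_cst.
  by apply: cvgD; [exact: cvg_cst|exact: cvg_id].
by rewrite addr0; exact: cf.
Qed.

End joint_continuity.

(** * Integrals against a weight *)

Section weighted_integrals.
Context {R : realType} {n : nat}.
Implicit Types (F : 'rV[R]_n.+1 -> R).

(* All integrals of the energy have the form [\int F (gam y) * om y dy]: [gam]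
   parametrizes the domain, and the density [om] vanishes off it. *)
Definition wint k (gam : 'rV[R]_k -> 'rV[R]_n.+1) (om : 'rV[R]_k -> R) F : R :=
  rint (fun y => F (gam y) * om y).

(** Integrability, not boundedness, is asked of [om], in view of the hemisphere. The last clause
    places the relevant points where continuous functions are bounded and time derivatives are
    available. *)
Definition weight k (gam : 'rV[R]_k -> 'rV[R]_n.+1) (om : 'rV[R]_k -> R) :=
  [/\ continuous gam, rintegrable om &
    forall y, om y != 0 -> closed_half (gam y) /\ enorm (gam y) <= 1].

Context {k : nat} {gam : 'rV[R]_k -> 'rV[R]_n.+1} {om : 'rV[R]_k -> R}.
Context (w : weight gam om).

Lemma rmeasurable_weighted F : continuous F -> rmeasurable (fun y => F (gam y) * om y).
Proof.
have [cg io _] := w; move=> cF.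
have m1 : rmeasurable (F \o gam).
  apply: continuous_rmeasurable => y; apply: continuous_comp; [exact: cg|exact: cF].
have m2 := rintegrable_measurable io.
exact: (measurable_funM m1 m2).
Qed.

Lemma rintegrable_weighted F : continuous F -> rintegrable (fun y => F (gam y) * om y).
Proof.
have [cg io wo] := w; move=> cF; have [C [C0 hC]] := continuous_ball_bounded 1 cF.
apply: le_rintegrable (rintegrableZ C io); first exact: rmeasurable_weighted.
move=> y; have [->|o0] := eqVneq (om y) 0; first by rewrite !mulr0.
by rewrite !normrM ler_wpM2r// (le_trans (hC _ (wo _ o0).2))// ler_norm.
Qed.

Lemma eq_wint F G : (forall y, om y != 0 -> F (gam y) = G (gam y)) ->
  wint gam om F = wint gam om G.
Proof.
move=> FG; apply: eq_rint => y; have [->|/FG ->//] := eqVneq (om y) 0.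
by rewrite !mulr0.
Qed.

Lemma wintD F G : continuous F -> continuous G ->
  wint gam om (fun x => F x + G x) = wint gam om F + wint gam om G.
Proof.
move=> cF cG; rewrite /wint -rintD; [|exact: rintegrable_weighted|exact: rintegrable_weighted].
by apply: eq_rint => y; rewrite mulrDl.
Qed.

Lemma wintZ c F : continuous F -> wint gam om (fun x => c * F x) = c * wint gam om F.
Proof.
move=> cF; rewrite /wint -rintZ; last exact: rintegrable_weighted.
by apply: eq_rint => y; rewrite mulrA.
Qed.

Lemma wintB F G : continuous F -> continuous G ->
  wint gam om (fun x => F x - G x) = wint gam om F - wint gam om G.
Proof.
move=> cF cG; rewrite /wint -rintB; [|exact: rintegrable_weighted|exact: rintegrable_weighted].
by apply: eq_rint => y; rewrite mulrBl.
Qed.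

(** Below the flat boundary the extension by [clamp] is constant along e_N while its P_N need not
    vanish, so the radial formula is claimed on the closed half-space only. *)
Definition time_derivative (f f' : R -> 'rV[R]_n.+1 -> R) :=
  [/\ jcontinuous f, jcontinuous f' &
    forall (s : R) x, 0 < s -> closed_half x -> is_derive s 1 (f ^~ x) (f' s x)].

(** The two summands are the two kinds of terms in the quotient of the energy: an explicit density
    f, and w / h times a coefficient c coming from the divergence theorem. The latter is never
    differentiated in time. *)
Lemma cvg_wint (t : R) (f f' V W c : R -> 'rV[R]_n.+1 -> R) : 0 < t ->
  time_derivative f f' -> time_derivative V W -> jcontinuous c ->
  wint gam om (fun x => h^-1 * (f (t + h) x - f t x)
     + h^-1 * (V (t + h) x - V t x) * c (t + h) x) @[h --> 0^'] -->
  wint gam om (fun x => f' t x + W t x * c t x).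
Proof.
move=> t0 [cf cf' df] [cV cW dV] cc; have [cg io wo] := w.
have [Cf [Cf0 hCf]] := difference_quotient_bounded t0 df cf'.
have [CV [CV0 hCV]] := difference_quotient_bounded t0 dV cW.
have [|Cc [Cc0 hCc]] := @continuous_cube_bounded R n.+1 (fun z => c z.1 z.2) (t / 2) (t + t / 2) 1.
  by move=> s x /andP[s0 _]; apply: cc; lra.
have cs (s : R) : `|s| < t / 2 -> 0 < t + s by rewrite ltr_norml => /andP[? ?]; lra.
apply: (@rint_cvg _ _ _ _ (fun y => (Cf + CV * Cc) * `|om y|) (t / 2)).
- by rewrite divr_gt0.
- move=> h /andP[_ ht]; apply: (rmeasurable_weighted
    (F := fun x => h^-1 * (f (t + h) x - f t x) + h^-1 * (V (t + h) x - V t x) * c (t + h) x)) => x.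
  have th := cs h ht.
  have q (F : R -> 'rV[R]_n.+1 -> R) : jcontinuous F ->
      continuous (fun x => h^-1 * (F (t + h) x - F t x)).
    move=> cF z; apply: (@continuousM _ _ (fun=> h^-1) (fun x => F (t + h) x - F t x)); first exact: cst_continuous.
    by apply: (@continuousB _ _ _ (F (t + h)) (F t)); exact: jcontinuous_slice.
  apply: (@continuousD _ _ _ (fun x => h^-1 * (f (t + h) x - f t x))
    (fun x => h^-1 * (V (t + h) x - V t x) * c (t + h) x)); first exact: q.
  apply: (@continuousM _ _ (fun x => h^-1 * (V (t + h) x - V t x)) (c (t + h))); first exact: q.
  exact: jcontinuous_slice.
- apply: (rmeasurable_weighted (F := fun x => f' t x + W t x * c t x)) => x.
  apply: (@continuousD _ _ _ (f' t) (fun x => W t x * c t x)).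
    exact: jcontinuous_slice.
  by apply: (@continuousM _ _ (W t) (c t)); exact: jcontinuous_slice.
- move=> h y /andP[_ ht]; rewrite normrM.
  have [->|o0] := eqVneq (om y) 0; first by rewrite normr0 !mulr0.
  have [ch g1] := wo _ o0.
  rewrite ler_wpM2r// (le_trans (ler_normD _ _))// lerD//; first exact: hCf.
  rewrite normrM ler_pM//; first exact: hCV.
  apply: (hCc (t + h) (gam y)) => //.
  by move: ht; rewrite ltr_norml => /andP[? ?]; apply/andP; lra.
- have m := rintegrable_measurable io.
  apply: rintegrableZ.
  apply: le_rintegrable io => [|y]; last by rewrite normr_id.
  exact: (measurableT_comp (@normr_measurable R setT) m).
- move=> y; have [->|o0] := eqVneq (om y) 0.
    by under eq_cvg do rewrite mulr0; rewrite mulr0; exact: cvg_cst.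
  have [ch g1] := wo _ o0.
  apply: cvgMl; apply: cvgD.
    by apply: (is_derive_quotient (f := f ^~ (gam y))); exact: df.
  apply: cvgM; last exact: jcontinuous_cvg.
  by apply: (is_derive_quotient (f := V ^~ (gam y))); exact: dV.
Qed.

End weighted_integrals.

(** * The half ball, the hemisphere and the flat disc *)

Section domains.
Context {R : realType} {n : nat}.
Local Notation ht := (@hemisphere_height R _).
Local Notation vec := 'rV[R]_n.+2.

Definition ball_weight : vec -> R := (fun=> 1 : R) \_ (@half_ball R n.+1).

Definition sphere_point (y : 'rV[R]_n.+1) : vec := row_snoc y (ht y).

Definition sphere_weight (y : 'rV[R]_n.+1) : R := (ht y)^-1.

Definition flat_point (y : 'rV[R]_n.+1) : vec := row_snoc y 0.

Definition disc_weight : 'rV[R]_n.+1 -> R := (fun=> 1 : R) \_ (@unit_ball R n.+1).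

Definition Sigma1_disc : set 'rV[R]_n.+1 :=
  [set y | (@Sigma1 R n.+1 `&` @unit_ball R n.+2) (flat_point y)].

Definition Sigma1_weight : 'rV[R]_n.+1 -> R := (fun=> 1 : R) \_ Sigma1_disc.

Lemma patch_neq0 k (A : set 'rV[R]_k) y : ((fun=> 1 : R) \_ A) y != 0 -> A y.
Proof. by rewrite patchE; case: ifPn; rewrite ?inE// eqxx. Qed.

Lemma flat_point_max y : flat_point y 0 ord_max = 0.
Proof. exact: row_snoc_max. Qed.

Lemma flat_point0 y : flat_point y 0 ord0 = y 0 ord0.
Proof.
rewrite -(row_snoc_lift y 0); congr (row_snoc _ _ _ _).
by apply: val_inj; rewrite /= /bump.
Qed.

Lemma enorm_flat y : enorm (flat_point y) = enorm y.
Proof.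
apply/eqP; rewrite -(@eqrXn2 _ 2)// ?enorm_ge0// enorm_row_snoc.
by rewrite expr0n addr0.
Qed.

Lemma Sigma1_discE y : Sigma1_disc y <-> 0 < y 0 ord0 /\ unit_ball y.
Proof.
rewrite /Sigma1_disc /= /Sigma1 /unit_ball /= flat_point_max enorm_flat flat_point0.
by split => [[[]]|[]].
Qed.

Lemma open_Sigma1_disc : open Sigma1_disc.
Proof.
rewrite (_ : Sigma1_disc = ((fun y : 'rV[R]_n.+1 => y 0 ord0) @^-1` [set x | 0 < x]) `&` @unit_ball R n.+1).
  apply: openI; last exact: open_unit_ball.
  by apply: open_comp => [x _|]; [exact: coord_continuous|exact: open_gt].
by apply/seteqP; split => y /Sigma1_discE.
Qed.

Lemma ball_weightP : weight id ball_weight.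
Proof.
split => [x||y /patch_neq0[h1 h2]]; first exact: cvg_id.
  by apply: rintegrable_ball; [exact: open_half_ball|move=> x []|exact: cst_continuous].
by split; [exact: half_closed|exact: ltW].
Qed.

Lemma sphere_point_half y : sphere_weight y != 0 ->
  half_space (sphere_point y) /\ enorm (sphere_point y) = 1.
Proof.
rewrite invr_eq0 => h0; have yb : unit_ball y.
  apply/hemisphere_height_gt0; rewrite lt0r h0; exact: sqrtr_ge0.
split; first by rewrite /half_space /= row_snoc_max; exact/hemisphere_height_gt0.
apply/eqP; rewrite -(@eqrXn2 _ 2)// ?enorm_ge0// enorm_row_snoc.
by rewrite sqr_ht// expr1n; apply/eqP; ring.
Qed.

Lemma sphere_weightP : weight sphere_point sphere_weight.
Proof.
split => [||y /sphere_point_half[h1 ->]].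
- by apply: continuous_ins => x; [exact: continuous_hemisphere_height|exact: cvg_id].
- exact: rintegrable_inv_height.
- by split; [exact: half_closed|].
Qed.

Lemma flat_point_continuous : continuous flat_point.
Proof. by apply: continuous_ins => x; [exact: cst_continuous|exact: cvg_id]. Qed.

Lemma flat_point_closed y : closed_half (flat_point y).
Proof. by rewrite /closed_half /= flat_point_max. Qed.

Lemma disc_weightP : weight flat_point disc_weight.
Proof.
split => [||y /patch_neq0 yb]; first exact: flat_point_continuous.
  by apply: rintegrable_ball; [exact: open_unit_ball|by []|exact: cst_continuous].
by split; [exact: flat_point_closed|rewrite enorm_flat; exact: ltW].
Qed.

Lemma Sigma1_weightP : weight flat_point Sigma1_weight.
Proof.
split => [||y /patch_neq0/Sigma1_discE[_ yb]]; first exact: flat_point_continuous.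
  by apply: rintegrable_ball; [exact: open_Sigma1_disc|move=> y /Sigma1_discE[]|exact: cst_continuous].
by split; [exact: flat_point_closed|rewrite enorm_flat; exact: ltW].
Qed.

Lemma rint_patch k (A : set 'rV[R]_k) (f : 'rV[R]_k -> R) :
  rint (f \_ A) = rint (fun y => f y * ((fun=> 1 : R) \_ A) y).
Proof.
apply: eq_rint => y; rewrite !patchE; case: ifP; rewrite ?mulr1 ?mulr0//.
Qed.

Lemma vol_half_ballE F : vol_integral (@half_ball R n.+1) F = wint id ball_weight F.
Proof. by rewrite vol_integralE rint_patch. Qed.

Lemma hemisphereE F : hemisphere_integral F = wint sphere_point sphere_weight F.
Proof. exact: hemisphere_integralE. Qed.

Lemma flatE F : flat_integral (@Sigma1 R n.+1 `&` @unit_ball R n.+2) F =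
  wint flat_point Sigma1_weight F.
Proof. by rewrite /flat_integral vol_integralE rint_patch. Qed.

(** Sigma1 and Sigma2 leave out the points of the flat boundary with x_1 = 0, where no boundary
    condition is imposed; they form a null set. *)
Lemma eq_rint_off_hyperplane (f g : 'rV[R]_n.+1 -> R) : rmeasurable f -> rmeasurable g ->
  (forall y : 'rV[R]_n.+1, y 0 ord0 != 0 -> f y = g y) -> rint f = rint g.
Proof.
move=> mf mg fg; rewrite /rint /Rintegral; congr fine.
apply: ae_eq_integral => //; [exact/measurable_EFinP|exact/measurable_EFinP|].
pose N := [set t : n.+1.-tuple (measurableTypeR R) | tnth t ord0 = 0].
have mN : measurable N.
  have := measurable_tnth (ord0 : 'I_n.+1) measurableT (measurable_set1 (0 : R)).
  by rewrite setTI.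
exists N; split => //.
  apply: (etrans (lebesgue_tuple_ins ord0 mN)).
  rewrite (_ : _ @^-1` _ = ([set 0] : set R) `*` setT); last first.
    apply/seteqP; split => [[s t]|[s t] [/= h _]]; rewrite /N /= tnth_mktuple unlift_none //=.
  rewrite product_measure1E//.
  by rewrite [X in (X * _)%E](@lebesgue_measure_set1 R 0) mul0e.
move=> t /=; rewrite /N /=; apply: contra_notP => t0 _.
rewrite fg// mxE; exact/eqP.
Qed.

Lemma dirichlet_differenceE (V1 V2 : vec -> R) P1 Q1 P2 Q2 :
  C2_field V1 P1 Q1 -> C2_field V2 P2 Q2 ->
  wint id ball_weight (fun x => 2^-1 * (\sum_i P2 i x ^+ 2) - 2^-1 * (\sum_i P1 i x ^+ 2)) =
  wint sphere_point sphere_weight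
    (fun x => (V2 x - V1 x) * \sum_i (2^-1 * (P1 i x + P2 i x)) * x 0 i)
  - wint flat_point disc_weight
    (fun x => (V2 x - V1 x) * (2^-1 * (P1 ord_max x + P2 ord_max x)))
  - wint id ball_weight (fun x => (V2 x - V1 x) * \sum_i (2^-1 * (Q1 i x + Q2 i x))).
Proof.
move=> f1 f2; have := dirichlet_difference f1 f2.
by rewrite /= !rint_patch hemisphereE.
Qed.

End domains.

(** * The rescaled solution and its energy *)

Section solution.
Context {R : realType} {n : nat} (lam p q : R) (hp : 1 < p) (hq : 1 < q).
Context (u : 'rV[R]_n.+2 -> R) (P Q : 'I_n.+2 -> 'rV[R]_n.+2 -> R).
Local Notation vec := 'rV[R]_n.+2.
Local Notation U := (u \o clamp).
Local Notation a := (2 / (p - 1)).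
Local Notation b := (1 - 2 * ((q - 1) / (p - 1))).
Context (fU : C2_field U P Q).
Context (hu : forall i x, half_space x -> is_derive x (delta_mx 0 i) u (P i x) /\
  partial i (partial i u) x = Q i x).

(* u^t, its first and pure second derivatives in space, and its derivative
   in t. *)
Definition scaled (t : R) (x : vec) : R := t `^ a * U (t *: x).
Definition scaled_d (t : R) (i : 'I_n.+2) (x : vec) : R := t `^ a * t * P i (t *: x).
Definition scaled_dd (t : R) (i : 'I_n.+2) (x : vec) : R := t `^ a * t ^+ 2 * Q i (t *: x).
Definition scaled_dt (t : R) (x : vec) : R :=
  a * t `^ (a - 1) * U (t *: x) + t `^ a * \sum_i x 0 i * P i (t *: x).
(** The volume integrand of the energy without its gradient term, which is the one treated by
    [dirichlet_differenceE]. *)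
Definition bulk (t : R) (x : vec) : R :=
  lam * t ^+ 2 / 2 * scaled t x ^+ 2 - 1 / (p + 1) * `|scaled t x| `^ (p + 1).
Definition bulk' (t : R) (x : vec) : R :=
  lam * t * scaled t x ^+ 2 + lam * t ^+ 2 * (scaled t x * scaled_dt t x) - spow p (scaled t x) * scaled_dt t x.
Definition sphere_density (t : R) (x : vec) : R := 1 / (p - 1) * scaled t x ^+ 2.
Definition sphere_density' (t : R) (x : vec) : R := a * (scaled t x * scaled_dt t x).
Definition flat_density (t : R) (x : vec) : R := t `^ b / (q + 1) * `|scaled t x| `^ (q + 1).
Definition flat_density' (t : R) (x : vec) : R :=
  b * t `^ (b - 1) / (q + 1) * `|scaled t x| `^ (q + 1) + t `^ b * (spow q (scaled t x) * scaled_dt t x).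

Lemma scaled_field t : 0 < t -> C2_field (scaled t) (scaled_d t) (scaled_dd t).
Proof. by move=> t0; apply: C2_field_dilation. Qed.

Lemma rescaleE t x : 0 < t -> closed_half x -> rescale p u t x = scaled t x.
Proof.
by move=> t0 hx; rewrite /rescale /scaled /= clamp_id//; exact: closed_half_scale.
Qed.

Lemma grad_rescaleE t x : 0 < t -> half_space x ->
  grad_sqr (rescale p u t) x = \sum_i scaled_d t i x ^+ 2.
Proof.
move=> t0 hx; apply: eq_bigr => i _; congr (_ ^+ 2); rewrite /partial.
have d := is_derive_dilation (hu i (half_scale t0 hx)).1.
have -> : rescale p u t = (t `^ a) \*: (fun y => u (t *: y)) by [].
by rewrite derive_val /scaled_d /GRing.scale /= mulrA.
Qed.

Lemma jcontinuous_scaled : jcontinuous scaled.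
Proof.
have [cU _ _ _] := fU; apply: jcontinuousM; first exact: jcontinuous_powR.
exact: jcontinuous_dilation.
Qed.

Lemma jcontinuous_scaled_d i : jcontinuous (fun t x => scaled_d t i x).
Proof.
have [_ cP _ _] := fU; apply: jcontinuousM; last exact: jcontinuous_dilation.
by apply: jcontinuousM; [exact: jcontinuous_powR|exact: jcontinuous_id].
Qed.

Lemma jcontinuous_scaled_dd i : jcontinuous (fun t x => scaled_dd t i x).
Proof.
have [_ _ cQ _] := fU; apply: jcontinuousM; last exact: jcontinuous_dilation.
by apply: jcontinuousM; [exact: jcontinuous_powR|apply: jcontinuousX; exact: jcontinuous_id].
Qed.

Lemma jcontinuous_coord (i : 'I_n.+2) : jcontinuous (fun (_ : R) (x : vec) => x 0 i).
Proof. by apply: jcontinuous_space; exact: coord_continuous. Qed.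

Lemma time_derivative_scaled : time_derivative scaled scaled_dt.
Proof.
have [cU cP _ _] := fU; split; first exact: jcontinuous_scaled.
  apply: jcontinuousD.
    apply: jcontinuousM; last exact: jcontinuous_dilation.
    by apply: jcontinuousM; [exact: jcontinuous_cst|exact: jcontinuous_powR].
  apply: jcontinuousM; first exact: jcontinuous_powR.
  apply: jcontinuous_sum => i; apply: jcontinuousM; first exact: jcontinuous_coord.
  exact: jcontinuous_dilation.
move=> s x s0 hx; have d1 := is_derive1_powR a s0.
have d2 := radial_derive fU hx s0.
have -> : scaled ^~ x = (fun t => t `^ a) * (fun t => U (t *: x)) by [].
by apply: is_derive_eq; rewrite /scaled_dt /GRing.scale /=; ring.
Qed.

Lemma time_derivative_sqr : time_derivative (fun t x => scaled t x ^+ 2) (fun t x => 2 * (scaled t x * scaled_dt t x)).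
Proof.
have [cV cW dV] := time_derivative_scaled.
split; first exact: jcontinuousX.
  by apply: jcontinuousM; [exact: jcontinuous_cst|exact: jcontinuousM].
move=> s x s0 hx; have d := dV s x s0 hx.
have -> : (fun t => scaled t x ^+ 2) = (scaled ^~ x) * (scaled ^~ x) by apply/funext => t; rewrite expr2.
by apply: is_derive_eq; rewrite /GRing.scale /=; ring.
Qed.

Lemma time_derivative_pow r : 1 < r -> time_derivative (fun t x => `|scaled t x| `^ (r + 1))
  (fun t x => (r + 1) * (spow r (scaled t x) * scaled_dt t x)).
Proof.
move=> r1; have [cV cW dV] := time_derivative_scaled.
split.
- apply: (jcontinuous_comp (phi := fun y => `|y| `^ (r + 1))) => // y.
  have [d _] := is_derive_powR_norm y r1.
  by apply: differentiable_continuous; exact/derivable1_diffP.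
- apply: jcontinuousM; first exact: jcontinuous_cst.
  apply: jcontinuousM => //; apply: jcontinuous_comp => //; exact: continuous_spow.
- move=> s x s0 hx; have d := dV s x s0 hx; have d1 := is_derive_powR_norm (scaled s x) r1.
  rewrite mulrA; exact: (is_derive1_comp (f := fun y => `|y| `^ (r + 1)) (g := scaled ^~ x) d1 d).
Qed.

Lemma time_derivativeD f f' g g' : time_derivative f f' -> @time_derivative R n.+1 g g' ->
  time_derivative (fun t x => f t x + g t x) (fun t x => f' t x + g' t x).
Proof.
move=> [cf cf' df] [cg cg' dg]; split; [exact: jcontinuousD|exact: jcontinuousD|].
move=> s x s0 hx; have := df s x s0 hx; have := dg s x s0 hx => d1 d2.
exact: is_deriveD.
Qed.

Lemma time_derivativeM (phi phi' : R -> R) f f' :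
  (forall s : R, 0 < s -> is_derive s 1 phi (phi' s)) ->
  (forall s : R, 0 < s -> {for s, continuous phi'}) ->
  @time_derivative R n.+1 f f' ->
  time_derivative (fun t x => phi t * f t x) (fun t x => phi' t * f t x + phi t * f' t x).
Proof.
move=> dphi cphi' [cf cf' df].
have cphi : @jcontinuous R n.+1 (fun t _ => phi t).
  by apply: jcontinuous_time => s /dphi; exact: is_derive1_continuous.
have jphi' : @jcontinuous R n.+1 (fun t _ => phi' t) by exact: jcontinuous_time.
split; first exact: jcontinuousM.
  by apply: jcontinuousD; exact: jcontinuousM.
move=> s x s0 hx; have d1 := df s x s0 hx; have d2 := dphi s s0.
have -> : (fun t => phi t * f t x) = phi * (f ^~ x) by [].
by apply: is_derive_eq; rewrite /GRing.scale /=; ring.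
Qed.

Lemma time_derivative_eq f f' g' : @time_derivative R n.+1 f f' ->
  (forall t x, f' t x = g' t x) -> time_derivative f g'.
Proof.
move=> h e; suff <- : f' = g' by [].
by apply/funext => t; apply/funext => x.
Qed.

Lemma addp1_neq0 : p + 1 != 0. Proof. by rewrite gt_eqF//; move: hp; lra. Qed.
Lemma addq1_neq0 : q + 1 != 0. Proof. by rewrite gt_eqF//; move: hq; lra. Qed.
Lemma subp1_neq0 : p - 1 != 0. Proof. by rewrite gt_eqF//; move: hp; lra. Qed.

Lemma time_derivative_bulk : time_derivative bulk bulk'.
Proof.
have d1 (s : R) : 0 < s -> is_derive s 1 (fun t => lam * t ^+ 2 / 2) (lam * s).
  move=> _; have -> : (fun t => lam * t ^+ 2 / 2) = (lam / 2) \*: (id ^+ 2 : R -> R).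
    by apply/funext => t; change (lam * t ^+ 2 / 2 = lam / 2 * t ^+ 2); ring.
  by apply: is_derive_eq; rewrite /GRing.scale /= expr1; field.
have d2 (s : R) : 0 < s -> is_derive s 1 (fun _ : R => - (1 / (p + 1))) 0.
  by move=> _; exact: is_derive_cst.
have bulk_coef (s : R) : 0 < s -> {for s, continuous (fun s => lam * s)}.
  by move=> _; apply: (@continuousM _ _ (fun=> lam) id); [exact: cst_continuous|exact: cvg_id].
have sphere_coef (s : R) : 0 < s -> {for s, continuous (fun _ : R => 0 : R)}.
  by move=> _; exact: cst_continuous.
have h := time_derivativeD (time_derivativeM d1 bulk_coef time_derivative_sqr)
  (time_derivativeM d2 sphere_coef (time_derivative_pow hp)).
have -> : bulk = fun t x => lam * t ^+ 2 / 2 * scaled t x ^+ 2 + - (1 / (p + 1)) * `|scaled t x| `^ (p + 1).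
  by apply/funext => t; apply/funext => x; rewrite mulNr.
apply: (time_derivative_eq h) => t x; rewrite /bulk'.
by field; exact: addp1_neq0.
Qed.

Lemma time_derivative_sphere_density : time_derivative sphere_density sphere_density'.
Proof.
have d2 (s : R) : 0 < s -> is_derive s 1 (fun _ : R => 1 / (p - 1)) 0.
  by move=> _; exact: is_derive_cst.
have sphere_coef (s : R) : 0 < s -> {for s, continuous (fun _ : R => 0 : R)}.
  by move=> _; exact: cst_continuous.
apply: (time_derivative_eq (time_derivativeM d2 sphere_coef time_derivative_sqr)) => t x.
by rewrite /sphere_density'; field; exact: subp1_neq0.
Qed.

Lemma time_derivative_flat_density : time_derivative flat_density flat_density'.
Proof.
have d1 (s : R) : 0 < s -> is_derive s 1 (fun t => t `^ b / (q + 1)) (b * s `^ (b - 1) / (q + 1)).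
  move=> s0; have d := is_derive1_powR b s0.
  have -> : (fun t => t `^ b / (q + 1)) = (q + 1)^-1 \*: (fun t => t `^ b).
    by apply/funext => t; rewrite /GRing.scale /= mulrC.
  by apply: is_derive_eq; rewrite /GRing.scale /= mulrC.
have bulk_coef (s : R) : 0 < s -> {for s, continuous (fun s => b * s `^ (b - 1) / (q + 1))}.
  move=> s0; apply: (@continuousM _ _ (fun s => b * s `^ (b - 1)) (fun=> (q + 1)^-1)); last exact: cst_continuous.
  apply: (@continuousM _ _ (fun=> b) (fun s => s `^ (b - 1))); first exact: cst_continuous.
  exact: continuous_powR.
apply: (time_derivative_eq (time_derivativeM d1 bulk_coef (time_derivative_pow hq))) => t x.
rewrite /flat_density'; congr (_ + _).
by field; exact: addq1_neq0.
Qed.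

Local Notation I1 := (wint id ball_weight).
Local Notation I2 := (wint (@sphere_point R n) (@sphere_weight R n)).
Local Notation I3 := (wint (@flat_point R n) (@disc_weight R n)).
Local Notation I4 := (wint (@flat_point R n) (@Sigma1_weight R n)).

Lemma continuous_grad t : 0 < t -> continuous (fun x => 2^-1 * \sum_i scaled_d t i x ^+ 2).
Proof.
move=> t0; apply: (jcontinuous_slice (f := fun t x => 2^-1 * \sum_i scaled_d t i x ^+ 2)) => //.
apply: jcontinuousM; first exact: jcontinuous_cst.
by apply: jcontinuous_sum => i; apply: jcontinuousX; exact: jcontinuous_scaled_d.
Qed.

Lemma energyE t : 0 < t -> energy lam p q u t =
  I1 (fun x => 2^-1 * \sum_i scaled_d t i x ^+ 2) + I1 (bulk t) - I4 (flat_density t) + I2 (sphere_density t).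
Proof.
move=> t0; have [cPhi _ _] := time_derivative_bulk.
have [cPsi _ _] := time_derivative_pow hq; have [cT _ _] := time_derivative_sqr.
rewrite -wintD; [|exact: ball_weightP|exact: continuous_grad|exact: jcontinuous_slice].
rewrite /energy vol_half_ballE flatE hemisphereE.
congr (_ - _ + _).
- apply: eq_wint => x /patch_neq0 hx; have hs := hx.2; have hc := half_closed hs.
  rewrite /= grad_rescaleE// rescaleE// real_normK ?num_real//.
  by rewrite /bulk; field; exact: addp1_neq0.
- have e4 : I4 (fun x => `|rescale p u t x| `^ (q + 1)) = I4 (fun x => `|scaled t x| `^ (q + 1)).
    by apply: eq_wint => y _; rewrite rescaleE//; exact: flat_point_closed.
  by rewrite e4; apply/esym; exact: (wintZ Sigma1_weightP _ (jcontinuous_slice cPsi t0)).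
- rewrite [RHS](wintZ sphere_weightP _ (jcontinuous_slice cT t0)); congr (_ * _).
  apply: eq_wint => y /sphere_point_half[hs _].
  by rewrite rescaleE//; [rewrite real_normK ?num_real|exact: half_closed].
Qed.

(** With M the mean of u^t and u^s, this and the next two are - Laplace(M), x . grad(M) and dM/dx_N:
    the factors of w = u^s - u^t in [dirichlet_differenceE]. *)
Definition bulk_coef (t s : R) (x : vec) : R := - \sum_i 2^-1 * (scaled_dd t i x + scaled_dd s i x).
Definition sphere_coef (t s : R) (x : vec) : R := \sum_i (2^-1 * (scaled_d t i x + scaled_d s i x)) * x 0 i.
Definition flat_coef (t s : R) (x : vec) : R := 2^-1 * (scaled_d t ord_max x + scaled_d s ord_max x).

Lemma jcontinuous_scaled_dd_sum t : 0 < t ->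
  jcontinuous (fun s x => \sum_i 2^-1 * (scaled_dd t i x + scaled_dd s i x)).
Proof.
move=> t0; apply: jcontinuous_sum => i.
apply: jcontinuousM; first exact: jcontinuous_cst.
apply: jcontinuousD; last exact: jcontinuous_scaled_dd.
by apply: jcontinuous_space; exact: (jcontinuous_slice (@jcontinuous_scaled_dd i) t0).
Qed.

Lemma jcontinuous_bulk_coef t : 0 < t -> jcontinuous (bulk_coef t).
Proof. by move=> t0; apply: jcontinuousN; exact: jcontinuous_scaled_dd_sum. Qed.

Lemma jcontinuous_sphere_coef t : 0 < t -> jcontinuous (sphere_coef t).
Proof.
move=> t0; apply: jcontinuous_sum => i.
apply: jcontinuousM; last exact: jcontinuous_coord.
apply: jcontinuousM; first exact: jcontinuous_cst.
apply: jcontinuousD; last exact: jcontinuous_scaled_d.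
by apply: jcontinuous_space; exact: (jcontinuous_slice (@jcontinuous_scaled_d i) t0).
Qed.

Lemma jcontinuous_flat_coef t : 0 < t -> jcontinuous (flat_coef t).
Proof.
move=> t0; apply: jcontinuousM; first exact: jcontinuous_cst.
apply: jcontinuousD; last exact: jcontinuous_scaled_d.
by apply: jcontinuous_space; exact: (jcontinuous_slice (@jcontinuous_scaled_d _) t0).
Qed.

(** Fills the empty slots of [cvg_wint]: the full flat disc carries no explicit density, and the
    integral over Sigma1 has no term in w. *)
Definition zero_field (t : R) (x : vec) : R := 0.

Lemma time_derivative_zero : time_derivative zero_field zero_field.
Proof.
split; [exact: jcontinuous_cst|exact: jcontinuous_cst|].
by move=> s x _ _; exact: is_derive_cst.
Qed.

Lemma wint_comb k (gam : 'rV[R]_k -> vec) om (c : R) (A B C : vec -> R) :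
  weight gam om -> continuous A -> continuous B -> continuous C ->
  wint gam om (fun x => c * A x + c * B x * C x) =
  c * (wint gam om A + wint gam om (fun x => B x * C x)).
Proof.
move=> w cA cB cC.
have cBC : continuous (fun x => B x * C x).
  by move=> x; apply: continuousM; [exact: cB|exact: cC].
have cABC : continuous (fun x => A x + B x * C x).
  by move=> x; apply: (@continuousD _ _ _ A (fun x => B x * C x)); [exact: cA|exact: cBC].
rewrite -wintD// -(wintZ w)//.
by apply: eq_wint => y _; rewrite mulrDr mulrA.
Qed.

Lemma energy_quotient t h : 0 < t -> 0 < t + h ->
  h^-1 * (energy lam p q u (t + h) - energy lam p q u t) =
  I1 (fun x => h^-1 * (bulk (t + h) x - bulk t x)
    + h^-1 * (scaled (t + h) x - scaled t x) * bulk_coef t (t + h) x)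
  + I2 (fun x => h^-1 * (sphere_density (t + h) x - sphere_density t x)
    + h^-1 * (scaled (t + h) x - scaled t x) * sphere_coef t (t + h) x)
  - I3 (fun x => h^-1 * (zero_field (t + h) x - zero_field t x)
    + h^-1 * (scaled (t + h) x - scaled t x) * flat_coef t (t + h) x)
  - I4 (fun x => h^-1 * (flat_density (t + h) x - flat_density t x)
    + h^-1 * (scaled (t + h) x - scaled t x) * zero_field (t + h) x).
Proof.
move=> t0 th0.
have cd f : @jcontinuous R n.+1 f -> continuous (fun x => f (t + h) x - f t x).
  move=> cf x; apply: (@continuousB _ _ _ (f (t + h)) (f t)); exact: (jcontinuous_slice cf).
have [cPhi _ _] := time_derivative_bulk; have [cPsi _ _] := time_derivative_flat_density.
have [cT _ _] := time_derivative_sphere_density; have [cz _ _] := time_derivative_zero.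
have cV := jcontinuous_scaled.
have j1 := jcontinuous_slice (jcontinuous_bulk_coef t0) th0; have j2 := jcontinuous_slice (jcontinuous_sphere_coef t0) th0.
have j3 := jcontinuous_slice (jcontinuous_flat_coef t0) th0; have j4 := jcontinuous_slice cz th0.
have w1 := @ball_weightP R n; have w2 := @sphere_weightP R n.
have w3 := @disc_weightP R n; have w4 := @Sigma1_weightP R n.
rewrite (wint_comb _ w1 (cd _ cPhi) (cd _ cV) j1).
rewrite (wint_comb _ w2 (cd _ cT) (cd _ cV) j2).
rewrite (wint_comb _ w3 (cd _ cz) (cd _ cV) j3).
rewrite (wint_comb _ w4 (cd _ cPsi) (cd _ cV) j4).
have z3 : I3 (fun x => zero_field (t + h) x - zero_field t x) = 0.
  rewrite -(mul0r (I3 (scaled t))) -(wintZ w3 0 (jcontinuous_slice cV t0)).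
  by apply: eq_wint => y _; rewrite subr0 mul0r.
have z4 : I4 (fun x => (scaled (t + h) x - scaled t x) * zero_field (t + h) x) = 0.
  rewrite -(mul0r (I4 (scaled t))) -(wintZ w4 0 (jcontinuous_slice cV t0)).
  by apply: eq_wint => y _; rewrite mulr0 mul0r.
rewrite z3 z4 !energyE//.
rewrite (wintB w1 (jcontinuous_slice cPhi th0) (jcontinuous_slice cPhi t0)).
rewrite (wintB w2 (jcontinuous_slice cT th0) (jcontinuous_slice cT t0)).
rewrite (wintB w4 (jcontinuous_slice cPsi th0) (jcontinuous_slice cPsi t0)).
have := dirichlet_differenceE (scaled_field t0) (scaled_field th0).
rewrite (wintB w1 (continuous_grad th0) (continuous_grad t0)).
have -> : I1 (fun x => (scaled (t + h) x - scaled t x) * bulk_coef t (t + h) x) =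
  - I1 (fun x => (scaled (t + h) x - scaled t x) * \sum_i 2^-1 * (scaled_dd t i x + scaled_dd (t + h) i x)).
  rewrite -mulN1r -(wintZ w1); last first.
    move=> x; apply: (@continuousM _ _ (fun x => scaled (t + h) x - scaled t x) (fun x => \sum_i 2^-1 * (scaled_dd t i x + scaled_dd (t + h) i x))).
      exact: (cd _ cV).
    exact: (jcontinuous_slice (jcontinuous_scaled_dd_sum t0) th0).
  by apply: eq_wint => y _; rewrite /bulk_coef mulrN mulN1r.
rewrite -/(sphere_coef t (t + h)) -/(flat_coef t (t + h)) => e.
have alg (c G G' A A' S S' T T' X1 X2 X3 : R) : G' - G = X2 - X3 - X1 ->
    c * (G' + A' - S' + T' - (G + A - S + T)) =
    c * (A' - A - X1) + c * (T' - T + X2) - c * (0 + X3) - c * (S' - S + 0).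
  by move=> /(canRL (subrK _)) ->; ring.
exact: alg e.
Qed.

Lemma energy_derive (t : R) : 0 < t -> is_derive t 1 (energy lam p q u)
  (I1 (fun x => bulk' t x + scaled_dt t x * bulk_coef t t x) + I2 (fun x => sphere_density' t x + scaled_dt t x * sphere_coef t t x)
   - I3 (fun x => zero_field t x + scaled_dt t x * flat_coef t t x)
   - I4 (fun x => flat_density' t x + scaled_dt t x * zero_field t x)).
Proof.
move=> t0; apply: quotient_is_derive.
have tV := time_derivative_scaled.
have l1 := cvg_wint (@ball_weightP R n) t0 time_derivative_bulk tV (jcontinuous_bulk_coef t0).
have l2 := cvg_wint (@sphere_weightP R n) t0 time_derivative_sphere_density tV (jcontinuous_sphere_coef t0).
have l3 := cvg_wint (@disc_weightP R n) t0 time_derivative_zero tV (jcontinuous_flat_coef t0).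
have [cz _ _] := time_derivative_zero.
have l4 := cvg_wint (@Sigma1_weightP R n) t0 time_derivative_flat_density tV cz.
apply: cvg_trans (cvgB (cvgB (cvgD l1 l2) l3) l4); apply: near_eq_cvg; near=> h.
rewrite energy_quotient//.
have : `|h| < t by near: h; exact: dnbhs0_lt.
by rewrite ltr_norml => /andP[? ?]; lra.
Unshelve. all: by end_near. Qed.

(** * The equation and the boundary conditions after rescaling *)

Lemma derive_rescale (t : R) (x : vec) : 0 < t -> closed_half x ->
  derive1 (fun s => rescale p u s x) t = scaled_dt t x.
Proof.
move=> t0 hx; rewrite derive1E.
have [_ _ dV] := time_derivative_scaled; have d := dV t x t0 hx.
have : is_derive t 1 (fun s => rescale p u s x) (scaled_dt t x).
  apply: near_eq_is_derive d; near=> s; rewrite rescaleE//; near: s.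
  exact: lt_nbhsr.
by move=> d'; exact: derive_val.
Unshelve. all: by end_near. Qed.

Lemma radial_identity (t : R) (x : vec) : 0 < t ->
  t * scaled_dt t x = a * scaled t x + \sum_i scaled_d t i x * x 0 i.
Proof.
move=> t0; rewrite /scaled_dt /scaled mulrDr; congr (_ + _).
  rewrite mulrA [t * _]mulrCA (_ : t * t `^ (a - 1) = t `^ a) ?mulrA//.
  by apply: mulr_powRB1; [exact: ltW|rewrite divr_gt0// subr_gt0].
rewrite !mulr_sumr; apply: eq_bigr => i _; rewrite /scaled_d; ring.
Qed.

Lemma spowZ (r c x : R) : 0 < c -> spow r (c * x) = c `^ (r - 1) * c * spow r x.
Proof.
move=> c0; rewrite /spow normrM powRM// (gtr0_norm c0); ring.
Qed.

Lemma powR_powR_D (t : R) (r s : R) : 0 < t -> t `^ r * t `^ s = t `^ (r + s).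
Proof.
move=> t0; have tn : t != 0 by rewrite gt_eqF.
by rewrite powRD// tn implybT.
Qed.

Lemma interior_equation (t : R) (x : vec) : solves_interior lam p u -> 0 < t -> half_space x ->
  \sum_i scaled_dd t i x = lam * t ^+ 2 * scaled t x - spow p (scaled t x).
Proof.
move=> hs t0 hx; have hx' := half_scale t0 hx.
have eQ : laplacian u (t *: x) = \sum_i Q i (t *: x).
  by apply: eq_bigr => i _; exact: (hu i hx').2.
rewrite /scaled_dd -mulr_sumr; have -> : \sum_i Q i (t *: x) = lam * U (t *: x) - spow p (U (t *: x)).
  rewrite /= clamp_id; last exact: half_closed.
  by have := hs _ hx'; rewrite eQ => <-; ring.
rewrite /scaled spowZ ?powR_gt0// -powRrM.
(* This fixes the exponent a = 2 / (p - 1) of the rescaling: the Laplacian and the power p both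
   acquire the factor t^(a + 2). *)
have -> : a * (p - 1) = 2%:R by field; exact: subp1_neq0.
by rewrite powR_mulrn ?ltW//; ring.
Qed.

(** On the boundary P_N is only a continuous extension. The mean value theorem on the segment from x
    into the half-space, followed by continuity, shows that its opposite is the one-sided normal
    derivative. *)
Lemma flat_normal (x : vec) : x 0 ord_max = 0 ->
  (u x - u (x - h *: - delta_mx 0 ord_max)) / h @[h --> (0 : R)^'+] --> - P ord_max x.
Proof.
move=> x0; have [cU cP _ dU] := fU.
have hc : closed_half x by rewrite /closed_half /= x0.
pose xe h := x + h *: delta_mx 0 ord_max.
have cxe : continuous (fun h : R => xe h).
  move=> h; apply: (@continuousD _ _ _ (fun=> x) (fun h : R => h *: delta_mx 0 ord_max)).
    exact: cst_continuous.
  by apply: cvgZr_tmp; exact: cvg_id.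
have cPx : P ord_max (xe h) @[h --> (0 : R)] --> P ord_max x.
  rewrite [X in _ --> X](_ : _ = P ord_max (xe 0)); last by rewrite /xe scale0r addr0.
  by apply: (@continuous_comp _ _ _ xe (P ord_max)); [exact: cxe|exact: cP].
apply/cvgrPdist_le => eps e0.
have /nbhs_ballP[r /= r0 hr] :
    \forall h \near (0 : R), `|P ord_max x - P ord_max (xe h)| <= eps.
  exact: (cvgrPdist_le _ _).1 cPx _ e0.
near=> h.
have h0 : 0 < h by near: h; exact: nbhs_right_gt.
have hr' : h < r by near: h; exact: nbhs_right_lt.
have [| |s] := @MVT R (fun h => U (xe h)) (fun h => P ord_max (xe h)) 0 h h0.
- move=> s; rewrite in_itv /= => /andP[s0 _].
  apply: (@is_derive_line R _ U xe s (delta_mx 0 ord_max) _ _).2 => [k|].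
    by rewrite /xe scalerDl addrCA.
  by apply: (dU _ _ _).1; exact: shift_half.
- apply: continuous_subspaceT => s.
  by apply: (@continuous_comp _ _ _ xe U); [exact: cxe|exact: cU].
rewrite in_itv /= => /andP[s0 s1] e.
have -> : u x - u (x - h *: - delta_mx 0 ord_max) = - (P ord_max (xe s) * h).
  move: e; rewrite /xe scale0r addr0 subr0 /= => <-.
  rewrite !clamp_id//; last by apply: half_closed; exact: shift_half.
  by rewrite scalerN opprK opprB.
rewrite mulNr mulfK ?gt_eqF// opprK addrC -normrN opprB.
apply: hr; rewrite -ball_normE /ball_ /= sub0r normrN gtr0_norm//.
exact: lt_trans hr'.
Unshelve. all: by end_near. Qed.

Lemma normal_derivativeE (x : vec) (l : R) : x 0 ord_max = 0 -> normal_derivative u x l ->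
  P ord_max x = - l.
Proof.
move=> x0 h1; have h2 := flat_normal x0; apply: oppr_inj; rewrite opprK.
by rewrite -(cvg_lim (@Rhausdorff R) h1); apply/esym/cvg_lim.
Qed.

Lemma Sigma1_scale (t : R) (x : vec) : 0 < t -> @Sigma1 R n.+1 x -> @Sigma1 R n.+1 (t *: x).
Proof. by move=> t0 [h1 h2]; split; rewrite mxE; [rewrite h1 mulr0|exact: mulr_gt0]. Qed.

Lemma Sigma2_scale (t : R) (x : vec) : 0 < t -> @Sigma2 R n.+1 x -> @Sigma2 R n.+1 (t *: x).
Proof. by move=> t0 [h1 h2]; split; rewrite mxE; [rewrite h1 mulr0|rewrite pmulr_rlt0]. Qed.

Lemma Sigma1_equation (t : R) (x : vec) : 0 < t -> @Sigma1 R n.+1 x ->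
  (forall z, @Sigma1 R n.+1 z -> normal_derivative u z (spow q (u z))) ->
  scaled_d t ord_max x = - t `^ b * spow q (scaled t x).
Proof.
move=> t0 hx hn; have hx' := Sigma1_scale t0 hx.
rewrite /scaled_d (normal_derivativeE hx'.1 (hn _ hx')) /scaled /= clamp_id; last first.
  by rewrite /closed_half /= hx'.1.
rewrite spowZ ?powR_gt0// -powRrM.
(* Origin of the power of tau in front of the Sigma1 integral: b = 1 - a (q - 1) balances the factor
   t^(a + 1) of a first derivative against the factor t^(a q) of the power q. *)
have e : t `^ b * (t `^ (a * (q - 1)) * t `^ a) = t `^ a * t.
  rewrite !powR_powR_D// -[X in _ = _ * X](powRr1 (ltW t0)) powR_powR_D//.
  by congr (_ `^ _); field; exact: subp1_neq0.
by rewrite mulrN -e; ring.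
Qed.

Lemma Sigma2_problemA (t : R) (x : vec) : 0 < t -> @Sigma2 R n.+1 x ->
  (forall z, @Sigma2 R n.+1 z -> normal_derivative u z 0) -> scaled_d t ord_max x = 0.
Proof.
move=> t0 hx hn; have hx' := Sigma2_scale t0 hx.
by rewrite /scaled_d (normal_derivativeE hx'.1 (hn _ hx')) oppr0 mulr0.
Qed.

(** Sigma2 is invariant under dilations, so u^s vanishes at x for every s > 0, not just for s =
    t. *)
Lemma Sigma2_problemB (t : R) (x : vec) : 0 < t -> @Sigma2 R n.+1 x ->
  (forall z, @Sigma2 R n.+1 z -> u z = 0) -> scaled_dt t x = 0.
Proof.
move=> t0 hx hz; have hc : closed_half x by rewrite /closed_half /= hx.1.
rewrite -derive_rescale// derive1E.
rewrite (@near_eq_derive _ _ _ _ (cst 0)) ?derive_cst//.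
near=> s; rewrite /rescale hz ?mulr0//; apply: Sigma2_scale => //.
by near: s; exact: lt_nbhsr.
Unshelve. all: by end_near. Qed.

(** * The terms of the derivative, domain by domain *)

Lemma half_sum (x : R) : 2^-1 * (x + x) = x.
Proof. by field. Qed.

(** By the equation, - (dv/dt) Laplace(v) cancels everything in [bulk'] except the derivative lam t
    of the explicit coefficient lam t^2 / 2. *)
Lemma half_ball_term (t : R) : solves_interior lam p u -> 0 < t ->
  I1 (fun x => bulk' t x + scaled_dt t x * bulk_coef t t x) =
  lam * t * vol_integral (@half_ball R n.+1) (fun x => rescale p u t x ^+ 2).
Proof.
move=> hs t0; have [cV2 _ _] := time_derivative_sqr.
have e : I1 (fun x => rescale p u t x ^+ 2) = I1 (fun x => scaled t x ^+ 2).
  by apply: eq_wint => x /patch_neq0[_ /half_closed hx]; rewrite rescaleE.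
rewrite vol_half_ballE e -(wintZ (@ball_weightP R n) _ (jcontinuous_slice cV2 t0)).
apply: eq_wint => x /patch_neq0[_ hx].
rewrite /bulk' /bulk_coef; under eq_bigr do rewrite half_sum.
by rewrite interior_equation//; ring.
Qed.

(** The coefficient 1 / (p - 1) of the sphere integral in the energy is made for this: its
    derivative adds 2 / (p - 1) v dv/dt to (dv/dt) (x . grad v), and [radial_identity] turns the sum
    into t (dv/dt)^2. *)
Lemma sphere_term (t : R) : 0 < t ->
  I2 (fun x => sphere_density' t x + scaled_dt t x * sphere_coef t t x) =
  t * hemisphere_integral (fun x => derive1 (fun s => rescale p u s x) t ^+ 2).
Proof.
move=> t0; have [_ cW _] := time_derivative_scaled.
have e : I2 (fun x => derive1 (fun s => rescale p u s x) t ^+ 2) = I2 (fun x => scaled_dt t x ^+ 2).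
  apply: eq_wint => y /sphere_point_half[/half_closed hx _].
  by rewrite derive_rescale.
rewrite hemisphereE e -(wintZ (@sphere_weightP R n) _ (jcontinuous_slice (@jcontinuousX R n.+1 scaled_dt 2 cW) t0)).
apply: eq_wint => y _; rewrite /sphere_density' /sphere_coef; under eq_bigr do rewrite half_sum.
have := radial_identity (sphere_point y) t0.
by move=> /esym/(canRL (addKr _)) ->; ring.
Qed.

(** The two integrals are joined because the cancellation is pointwise. On Sigma1 the flux (dv/dt)
    dv/dx_N cancels the part of [flat_density'] with dv/dt, leaving the derivative of the power t^b.
    On Sigma2 only the flux is present and one of its factors is zero. *)
Lemma flat_term (t : R) : problemA lam p q u \/ problemB lam p q u -> 0 < t ->
  I3 (fun x => zero_field t x + scaled_dt t x * flat_coef t t x) +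
  I4 (fun x => flat_density' t x + scaled_dt t x * zero_field t x) =
  b * t `^ (b - 1) / (q + 1) *
  flat_integral (@Sigma1 R n.+1 `&` @unit_ball R n.+2) (fun x => `|rescale p u t x| `^ (q + 1)).
Proof.
move=> hsol t0.
have [_ cW _] := time_derivative_scaled; have [cPq _ _] := time_derivative_pow hq.
have [_ cPsi' _] := time_derivative_flat_density; have [cz _ _] := time_derivative_zero.
have e : I4 (fun x => `|rescale p u t x| `^ (q + 1)) = I4 (fun x => `|scaled t x| `^ (q + 1)).
  by apply: eq_wint => y _; rewrite rescaleE//; exact: flat_point_closed.
rewrite flatE e -(wintZ (@Sigma1_weightP R n) _ (jcontinuous_slice cPq t0)) /wint.
have k1 := jcontinuous_slice (jcontinuousD cz (jcontinuousM cW (jcontinuous_flat_coef t0))) t0.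
have k2 := jcontinuous_slice (jcontinuousD cPsi' (jcontinuousM cW cz)) t0.
have i1 := rintegrable_weighted (@disc_weightP R n) k1.
have i2 := rintegrable_weighted (@Sigma1_weightP R n) k2.
rewrite -(rintD i1 i2).
have k3 := jcontinuous_slice (jcontinuousM (@jcontinuous_cst R n.+1 (b * t `^ (b - 1) / (q + 1))) cPq) t0.
apply: eq_rint_off_hyperplane.
- exact: (rintegrable_measurable (rintegrableD i1 i2)).
- exact: (rmeasurable_weighted (@Sigma1_weightP R n) k3).
move=> y y0; rewrite /disc_weight /Sigma1_weight !patchE.
case: (boolP (y \in @unit_ball R n.+1)); rewrite ?notin_setE ?inE => yb; last first.
  case: ifPn => [/set_mem hS|_]; first exact: (False_ind _ (yb ((Sigma1_discE y).1 hS).2)).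
  by rewrite !mulr0 addr0.
have fc := flat_point_max y; have f0 := flat_point0 y.
case: ifPn; rewrite ?notin_setE ?inE => hS.
  have h1 : @Sigma1 R n.+1 (flat_point y) by exact: hS.1.
  have hn : forall z, @Sigma1 R n.+1 z -> normal_derivative u z (spow q (u z)).
    by case: hsol => -[].
  rewrite /flat_coef half_sum (Sigma1_equation t0 h1 hn) /flat_density' /zero_field; ring.
rewrite !mulr0 addr0 mulr1 /zero_field add0r /flat_coef half_sum.
have h2 : @Sigma2 R n.+1 (flat_point y).
  split; first exact: fc.
  rewrite f0 lt_neqAle y0 /= leNgt; apply/negP => y1.
  by apply: hS; exact: (Sigma1_discE y).2 (conj y1 yb).
case: hsol => -[_ _ h3]; first by rewrite (Sigma2_problemA t0 h2 h3) mulr0.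
by rewrite (Sigma2_problemB t0 h2 h3) mul0r.
Qed.

Lemma energy_derive_formula (t : R) : problemA lam p q u \/ problemB lam p q u -> 0 < t ->
  is_derive t 1 (energy lam p q u)
    (t * hemisphere_integral (fun x => derive1 (fun s => rescale p u s x) t ^+ 2)
     + lam * t * vol_integral (@half_ball R n.+1) (fun x => rescale p u t x ^+ 2)
     + (2 * q - p - 1) / ((p - 1) * (q + 1)) * t `^ (- (2 * ((q - 1) / (p - 1))))
       * flat_integral (@Sigma1 R n.+1 `&` @unit_ball R n.+2)
           (fun x => `|rescale p u t x| `^ (q + 1))).
Proof.
move=> hsol t0; apply: is_derive_eq (energy_derive t0) _.
have hs : solves_interior lam p u by case: hsol => -[].
rewrite half_ball_term// sphere_term//.
rewrite -addrA -opprD flat_term//.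
have -> : b - 1 = - (2 * ((q - 1) / (p - 1))) by ring.
(* Here b = (p + 1 - 2 q) / (p - 1), which is where the sign of 2 q - p - 1 enters. *)
have -> : (2 * q - p - 1) / ((p - 1) * (q + 1)) = - (b / (q + 1)).
  by field; rewrite subp1_neq0 addq1_neq0.
move: (t `^ _) (flat_integral _ _) (hemisphere_integral _) (vol_integral _ _) => T F H E'.
ring.
Qed.

End solution.

Theorem proposition1p2 (R : realType) (n : nat) (hN : (2 <= n.+1)%N)
    (lam p q : R) (hlam : 0 < lam) (hp : 1 < p) (hq : 1 < q)
    (u : 'rV[R]_n.+1 -> R)
    (hC2 : C2_closure (@half_space R n) u)
    (hsol : problemA lam p q u \/ problemB lam p q u) :
  (forall tau : R, 0 < tau ->
     is_derive tau 1 (energy lam p q u)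
       (tau * hemisphere_integral
                (fun x => derive1 (fun t => rescale p u t x) tau ^+ 2)
        + lam * tau * vol_integral (@half_ball R n)
                        (fun x => rescale p u tau x ^+ 2)
        + (2 * q - p - 1) / ((p - 1) * (q + 1))
          * tau `^ (- (2 * ((q - 1) / (p - 1))))
          * flat_integral (@Sigma1 R n `&` @unit_ball R n.+1)
              (fun x => `|rescale p u tau x| `^ (q + 1)))) /\
  (0 <= 2 * q - p - 1 ->
   forall s t : R, 0 < s -> s <= t -> energy lam p q u s <= energy lam p q u t).
Proof.
case: n hN u hC2 hsol => [//|n] _ u hC2 hsol.
have [P [Q [fU hu]]] := C2_closure_field hC2.
have dE tau (tau0 : 0 < tau) := energy_derive_formula hp hq fU hu hsol tau0.
split => // pq s t s0; rewrite le_eqVlt => /predU1P[->//|st].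
have vol_ge0 k (A : set 'rV[R]_k) f : (forall x, 0 <= f x) -> 0 <= vol_integral A f.
  by move=> f0; apply: Rintegral_ge0 => x _; exact: f0.
have [|c] := @MVT R (energy lam p q u) _ s t st (fun x hx => dE x (lt_trans s0 (proj1 (andP hx)))).
- apply: continuous_in_subspaceT => x; rewrite inE /= in_itv /= => /andP[sx _].
  exact: is_derive1_continuous (dE x (lt_le_trans s0 sx)).
rewrite in_itv /= => /andP[sc _] e; rewrite -subr_ge0 e.
have c0 := lt_trans s0 sc.
apply: mulr_ge0; last by rewrite subr_ge0 ltW.
apply: addr_ge0; first apply: addr_ge0.
- rewrite mulr_ge0 ?(ltW c0)//; apply: vol_ge0 => y.
  by rewrite mulr_ge0 ?sqr_ge0 ?sqrtr_ge0.
- rewrite !mulr_ge0 ?(ltW c0) ?(ltW hlam)//.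
  by apply: vol_ge0 => y; exact: sqr_ge0.
- rewrite !mulr_ge0 ?powR_ge0//.
    by rewrite invr_ge0 mulr_ge0//; move: hp hq; lra.
  by apply: vol_ge0 => y; exact: powR_ge0.
Qed.
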